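(* Let $Q(t)=t^3+At^2+Bt+C\in\mathbb{C}[t]$ be a monic polynomial of degree $3$ and let $\gamma\in\mathbb{C}$. (a) There are exactly six isomorphisms from $D(Q,\gamma)$ to algebras $D(\overline{Q},\overline{\gamma})$ ($\overline Q$ monic of degree $\ge 3$, $\overline\gamma\in\mathbb{C}$), namely $\mathrm{Id}_{D(Q,\gamma)}$, $\Psi$, $\Psi^{-1}$, $\Theta$, $\Theta\circ\Psi$ and $\Theta\circ\Psi^{-1}$. (b) If $\gamma=0$ and $B=4(A^2/16-1)$ then $\mathrm{Aut}\, D(Q,\gamma)$ is isomorphic to the symmetric group $S_3$, and is generated by $\Psi$ and $\Theta$. (c) $\mathrm{Aut}\, D(Q,\gamma)$ is of order $2$ if exactly one of $B-4(A^2/16-1)-i\gamma$, $B-4(A^2/16-1)+i\gamma$ and $\gamma$ is zero. If $B=4(A^2/16-1)+i\gamma$ (resp. $B=4(A^2/16-1)-i\gamma$) and $\gamma\neq 0$ then $\mathrm{Aut}\, D(Q,\gamma)$ is generated by $\Theta\circ\Psi$ (resp. $\Theta\circ\Psi^{-1}$). If $\gamma=0$ but $B\neq 4(A^2/16-1)$ then $\mathrm{Aut}\, D(Q,\gamma)$ is generated by $\Theta$. (d) If $\gamma\neq 0$ and $B\neq 4(A^2/16-1)\pm i\gamma$ then there are no non-trivial automorphisms of $D(Q,\gamma)$.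
   Context: Write $[x,y]=xy-yx$ and $i=\sqrt{-1}$. Isomorphisms and automorphisms are those of associative unital $\mathbb{C}$-algebras. For a polynomial $Q(t)\in\mathbb{C}[t]$ of degree $n\ge 3$ and $\gamma\in\mathbb{C}$, let $P(t)$ be the unique polynomial of degree $n-1$ such that $Q(-s(s-1))-Q(-s(s+1))=(s-1)P(-s(s-1))+(s+1)P(-s(s+1))$ in $\mathbb{C}[s]$. The algebra $D(Q,\gamma)$ is the associative unital $\mathbb{C}$-algebra with generators $u,v,w$ (the standard generators) and relations $[u,v]=2w$, $[u,w]=-2uv+2w+\gamma$, $[v,w]=v^2+P(u)$ and $Q(u)+uv^2+w^2-2wv-\gamma v=0$. For every monic cubic $Q(t)=t^3+At^2+Bt+C$ and $\gamma\in\mathbb{C}$ the following are isomorphisms; the same symbol is used for all $(Q,\gamma)$, and composites are formed using the appropriate sources and targets. $\Theta: D(Q,\gamma)\to D(Q,-\gamma)$ is given by $u\mapsto u'$, $v\mapsto -v'$, $w\mapsto -w'$, where $u',v',w'$ are the standard generators of $D(Q,-\gamma)$. $\Psi: D(Q,\gamma)\to D(\tilde Q,\tilde\gamma)$ is given by $u\mapsto i\tilde v/2-\tilde u/2-(1+A/4)$, $v\mapsto -\tilde v/2+3i\tilde u/2+i(1+A/4)$, $w\mapsto\tilde w$, where $\tilde u,\tilde v,\tilde w$ are the standard generators of $D(\tilde Q,\tilde\gamma)$, $\tilde Q(t)=t^3+At^2+\tilde Bt+\tilde C$, $\tilde B=6(A^2/16-1)+3i\gamma/2-B/2$, $\tilde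 C=C-A(B/4-i\gamma/4+1-A^2/16)$, $\tilde\gamma=i(2(1-A^2/16)+B/2+i\gamma/2)$. $\Psi^{-1}: D(Q,\gamma)\to D(\hat Q,\hat\gamma)$ (equal to $\Psi^2$) is given by $u\mapsto -i\hat v/2-\hat u/2-(1+A/4)$, $v\mapsto-\hat v/2-3i\hat u/2-i(1+A/4)$, $w\mapsto\hat w$, where $\hat u,\hat v,\hat w$ are the standard generators of $D(\hat Q,\hat\gamma)$, $\hat Q(t)=t^3+At^2+\hat Bt+\hat C$, $\hat B=6(A^2/16-1)-3i\gamma/2-B/2$, $\hat C=C-A(B/4+i\gamma/4+1-A^2/16)$, $\hat\gamma=i(2(A^2/16-1)-B/2)-\gamma/2$.
   Formalization: The generator formulas given for Ψ and Ψ⁻¹ are interchanged (i replaced by −i in the images of u and v), keeping their stated targets, because as printed Ψ does not respect [u,w]=−2uv+2w+γ (e.g. A=4, B=1, C=γ=0). *)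

(* Defs.v *)
From HB Require Import structures.
From mathcomp Require Import all_boot all_order all_algebra perm.
From mathcomp Require Import boolp classical_sets functions cardinality.
From mathcomp Require Import finmap monalg ring.

Set Implicit Arguments.
Unset Strict Implicit.
Unset Printing Implicit Defensive.

Import Order.TTheory GRing.Theory Num.Theory.

Local Open Scope classical_set_scope.
Local Open Scope ring_scope.

Lemma linear_fun0 (K : pzRingType) (U V : lmodType K) (f : U -> V) :
  linear f -> f 0 = 0.
Proof. by move=> fL; have := fL (-1) 0 0; rewrite !scaleN1r addr0 oppr0 addNr. Qed.

Definition lie (A : pzRingType) (x y : A) : A := x * y - y * x.

Record two_sided_ideal (A : pzRingType) (J : A -> Prop) : Prop := {
  ideal0 : J 0;
  idealD : forall x y, J x -> J y -> J (x + y);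
  idealMl : forall a x, J x -> J (a * x);
  idealMr : forall a x, J x -> J (x * a)
}.

Definition ideal_gen (A : pzRingType) (S : seq A) (x : A) : Prop :=
  forall J : A -> Prop,
    two_sided_ideal J -> (forall s, s \in S -> J s) -> J x.

Lemma ideal_genP (A : pzRingType) (S : seq A) : two_sided_ideal (ideal_gen S).
Proof.
split=> [J HJ _|x y Hx Hy J HJ HS|a x Hx J HJ HS|a x Hx J HJ HS].
- exact: ideal0.
- by apply: idealD => //; [exact: Hx|exact: Hy].
- by apply: idealMl => //; exact: Hx.
- by apply: idealMr => //; exact: Hx.
Qed.

Section QuotientAlgebra.
Variables (K : pzRingType) (A : algType K) (S : seq A).
Local Open Scope quotient_scope.

Let idl := ideal_genP S.

Definition ideal_rel : rel A := fun x y => `[< ideal_gen S (x - y) >].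

Lemma ideal_relP x y : reflect (ideal_gen S (x - y)) (ideal_rel x y).
Proof. exact: asboolP. Qed.

Lemma idealN x : ideal_gen S x -> ideal_gen S (- x).
Proof. by move=> Hx; rewrite -mulN1r; apply: (idealMl idl). Qed.

Lemma ideal_rel_refl : reflexive ideal_rel.
Proof. by move=> x; apply/ideal_relP; rewrite subrr; exact: (ideal0 idl). Qed.

Lemma ideal_rel_sym : symmetric ideal_rel.
Proof.
by move=> x y; apply/ideal_relP/ideal_relP => /idealN; rewrite opprB.
Qed.

Lemma ideal_rel_trans : transitive ideal_rel.
Proof.
move=> y x z /ideal_relP Hxy /ideal_relP Hyz; apply/ideal_relP.
by rewrite -(subrKA y); exact: (idealD idl).
Qed.

Canonical ideal_equiv :=
  EquivRel ideal_rel ideal_rel_refl ideal_rel_sym ideal_rel_trans.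

Definition quot_alg := {eq_quot ideal_equiv}.

HB.instance Definition _ : EqQuotient _ ideal_equiv quot_alg :=
  EqQuotient.on quot_alg.
HB.instance Definition _ := Choice.on quot_alg.

(* Locked, so that failed conversions do not compute in the quotient. *)
Fact quot_key : unit. Proof. by []. Qed.

Definition to_quot : A -> quot_alg :=
  locked_with quot_key (fun x => \pi_quot_alg x).
Canonical to_quot_unlockable := [unlockable fun to_quot].

Definition quot_repr : quot_alg -> A :=
  locked_with quot_key (fun z => repr z).
Canonical quot_repr_unlockable := [unlockable fun quot_repr].

Lemma to_quot_eq x y : to_quot x = to_quot y <-> ideal_gen S (x - y).
Proof.
by rewrite [to_quot]unlock; split=> [/eqmodP/ideal_relP|H] //; apply/eqmodP/ideal_relP.
Qed.

Lemma to_quotK z : to_quot (quot_repr z) = z.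
Proof. by rewrite [to_quot]unlock [quot_repr]unlock; exact: reprK. Qed.

Lemma repr_to_quot x : ideal_gen S (quot_repr (to_quot x) - x).
Proof. by apply/to_quot_eq; rewrite to_quotK. Qed.

Definition quot_add (x y : quot_alg) := to_quot (quot_repr x + quot_repr y).
Definition quot_opp (x : quot_alg) := to_quot (- quot_repr x).
Definition quot_mul (x y : quot_alg) := to_quot (quot_repr x * quot_repr y).
Definition quot_scale (a : K) (x : quot_alg) := to_quot (a *: quot_repr x).

Lemma quot_addE x y : quot_add (to_quot x) (to_quot y) = to_quot (x + y).
Proof.
apply/to_quot_eq; rewrite opprD addrACA.
exact: (idealD idl (repr_to_quot x) (repr_to_quot y)).
Qed.

Lemma quot_oppE x : quot_opp (to_quot x) = to_quot (- x).
Proof.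
by apply/to_quot_eq; rewrite -opprD; exact: (idealN (repr_to_quot x)).
Qed.

Lemma quot_mulE x y : quot_mul (to_quot x) (to_quot y) = to_quot (x * y).
Proof.
apply/to_quot_eq.
rewrite -(subrKA (quot_repr (to_quot x) * y)) -mulrBr -mulrBl.
apply: (idealD idl); first exact: (idealMl idl _ (repr_to_quot y)).
exact: (idealMr idl _ (repr_to_quot x)).
Qed.

Lemma quot_scaleE a x : quot_scale a (to_quot x) = to_quot (a *: x).
Proof.
apply/to_quot_eq; rewrite -scalerBr -[_ - x]mul1r scalerAl.
exact: (idealMl idl _ (repr_to_quot x)).
Qed.

Lemma quot_ind (P : quot_alg -> Prop) : (forall x, P (to_quot x)) -> forall z, P z.
Proof. by move=> H z; rewrite -(to_quotK z). Qed.

Lemma quot_addA : associative quot_add.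
Proof.
elim/quot_ind=> x; elim/quot_ind=> y; elim/quot_ind=> z.
by rewrite !quot_addE addrA.
Qed.

Lemma quot_addC : commutative quot_add.
Proof. by elim/quot_ind=> x; elim/quot_ind=> y; rewrite !quot_addE addrC. Qed.

Lemma quot_add0 : left_id (to_quot 0) quot_add.
Proof. by elim/quot_ind=> x; rewrite !quot_addE add0r. Qed.

Lemma quot_addN : left_inverse (to_quot 0) quot_opp quot_add.
Proof. by elim/quot_ind=> x; rewrite quot_oppE quot_addE addNr. Qed.

HB.instance Definition _ :=
  GRing.isZmodule.Build quot_alg quot_addA quot_addC quot_add0 quot_addN.

Lemma quot_mulA : associative quot_mul.
Proof.
elim/quot_ind=> x; elim/quot_ind=> y; elim/quot_ind=> z.
by rewrite !quot_mulE mulrA.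
Qed.

Lemma quot_mul1 : left_id (to_quot 1) quot_mul.
Proof. by elim/quot_ind=> x; rewrite !quot_mulE mul1r. Qed.

Lemma quot_mulr1 : right_id (to_quot 1) quot_mul.
Proof. by elim/quot_ind=> x; rewrite !quot_mulE mulr1. Qed.

Lemma quot_mulDl : left_distributive quot_mul quot_add.
Proof.
elim/quot_ind=> x; elim/quot_ind=> y; elim/quot_ind=> z.
by rewrite quot_addE !quot_mulE quot_addE mulrDl.
Qed.

Lemma quot_mulDr : right_distributive quot_mul quot_add.
Proof.
elim/quot_ind=> x; elim/quot_ind=> y; elim/quot_ind=> z.
by rewrite quot_addE !quot_mulE quot_addE mulrDr.
Qed.

HB.instance Definition _ := GRing.Zmodule_isPzRing.Build quot_alg
  quot_mulA quot_mul1 quot_mulr1 quot_mulDl quot_mulDr.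

Lemma quot_scaleA a b v :
  quot_scale a (quot_scale b v) = quot_scale (a * b) v.
Proof. by elim/quot_ind: v => x; rewrite !quot_scaleE scalerA. Qed.

Lemma quot_scale1 : left_id 1 quot_scale.
Proof. by elim/quot_ind=> x; rewrite quot_scaleE scale1r. Qed.

Lemma quot_scaleDr : right_distributive quot_scale +%R.
Proof.
move=> a; elim/quot_ind=> x; elim/quot_ind=> y.
rewrite [to_quot x + _]quot_addE !quot_scaleE [RHS]quot_addE.
by rewrite scalerDr.
Qed.

Lemma quot_scaleDl v : {morph quot_scale^~ v : a b / a + b}.
Proof.
move=> a b; elim/quot_ind: v => x.
by rewrite !quot_scaleE [RHS]quot_addE scalerDl.
Qed.

HB.instance Definition _ := GRing.Zmodule_isLmodule.Build K quot_alg
  quot_scaleA quot_scale1 quot_scaleDr quot_scaleDl.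

Lemma quot_scaleAl (a : K) (x y : quot_alg) : a *: (x * y) = (a *: x) * y.
Proof.
elim/quot_ind: x => x; elim/quot_ind: y => y.
rewrite [to_quot x * _]quot_mulE [a *: to_quot x]quot_scaleE.
by rewrite [LHS]quot_scaleE [RHS]quot_mulE scalerAl.
Qed.

Lemma quot_scaleAr (a : K) (x y : quot_alg) : a *: (x * y) = x * (a *: y).
Proof.
elim/quot_ind: x => x; elim/quot_ind: y => y.
rewrite [to_quot x * _]quot_mulE [a *: to_quot y]quot_scaleE.
by rewrite [LHS]quot_scaleE [RHS]quot_mulE scalerAr.
Qed.

Lemma to_quot_linear : linear to_quot.
Proof.
move=> a x y; rewrite [a *: to_quot x]quot_scaleE.
by rewrite [RHS]quot_addE.
Qed.

Lemma to_quot_monoid_morphism : monoid_morphism to_quot.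
Proof. by split=> // x y; rewrite [RHS]quot_mulE. Qed.

Lemma to_quot_gen s : s \in S -> to_quot s = 0.
Proof. by move=> Ss; apply/to_quot_eq; rewrite subr0 => J _; apply. Qed.

End QuotientAlgebra.

Section FreeAlgebra.
Variable K : comNzRingType.

Lemma malg_scalerAr (a : K) (x y : {malg K[{fmonom 'I_3}]}) :
  a *: (x * y) = x * (a *: y).
Proof.
apply/malgP => k.
rewrite [LHS]mcoeffZ [RHS]mcoeffMl [X in a * X]mcoeffMl mulr_sumr.
apply: eq_bigr => k1 _.
pose E := (msupp y `|` msupp (a *: y))%fset.
have bigE (z : {malg K[{fmonom 'I_3}]}) (le : (msupp z `<=` E)%fset) :
    \sum_(k2 <- msupp z) (x@_k1 * z@_k2) *+ (mmul k1 k2 == k)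
    = \sum_(k2 <- E) (x@_k1 * z@_k2) *+ (mmul k1 k2 == k).
  apply: big_fset_incl => // i _ /mcoeff_outdom ->.
  by rewrite mulr0 mul0rn.
rewrite !bigE ?finmap.fsubsetUl ?finmap.fsubsetUr // mulr_sumr.
apply: eq_bigr => k2 _; rewrite mcoeffZ. by rewrite mulrnAr mulrCA.
Qed.

Definition words_alg := {malg K[{fmonom 'I_3}]}.

HB.instance Definition _ := GRing.Lalgebra.on words_alg.
HB.instance Definition _ := GRing.Lalgebra_isAlgebra.Build K words_alg
  malg_scalerAr.

Definition words_gen (i : 'I_3) : words_alg := << fmu i >>.

End FreeAlgebra.

Section WordsEval.
Variables (K : comNzRingType) (B : algType K) (x : 'I_3 -> B).

Definition mon_eval (m : {fmonom 'I_3}) : B := \prod_(i <- fmonom_val m) x i.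

Lemma mon_eval_mmorphism : mmorphism mon_eval.
Proof.
split; last by rewrite /mon_eval fm1 big_nil.
by move=> m1 m2; rewrite /mon_eval fmM big_cat.
Qed.

HB.instance Definition _ :=
  monalg.isMultiplicative.Build {fmonom 'I_3} B mon_eval mon_eval_mmorphism.

Definition words_eval (z : words_alg K) : B := mmap (in_alg B) mon_eval z.

Lemma words_eval_linear : linear words_eval.
Proof.
move=> a y z; rewrite /words_eval raddfD /= mmapZ /=.
by rewrite -scalerAl mul1r.
Qed.

Lemma words_eval_monoid_morphism : monoid_morphism words_eval.
Proof.
have [fM f1] := @commr_mmap_is_multiplicative _ _ _ (in_alg B) mon_eval
  (fun g m m' => comm_alg _ _).
by split.
Qed.

HB.instance Definition _ :=
  GRing.isLinear.Build K (words_alg K) B _ words_eval words_eval_linear.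
HB.instance Definition _ :=
  GRing.isMonoidMorphism.Build (words_alg K) B words_eval
    words_eval_monoid_morphism.

Lemma words_eval_gen i : words_eval (words_gen K i) = x i.
Proof.
rewrite /words_eval mmapU /= scale1r mul1r /mon_eval fmU big_seq1 //.
Qed.

End WordsEval.

Lemma words_alg_ind (K : comNzRingType) (P : words_alg K -> Prop) :
  P 0 -> P 1 -> (forall a x y, P x -> P y -> P (a *: x + y)) ->
  (forall i x, P x -> P (words_gen K i * x)) -> forall z, P z.
Proof.
move=> P0 P1 PD PX z; rewrite (monalgE z); apply: big_ind => //.
  by move=> x y Px Py; rewrite -[x]scale1r; apply: PD.
move=> k _.
have -> : << z@_k *g k >> = z@_k *: (<< k >> : {malg K[{fmonom 'I_3}]}).
  by apply/malgP => k'; rewrite [RHS]mcoeffZ !mcoeffU -mulr_natr.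
rewrite -[_ *: _]addr0; apply: PD => //.
case: k => s; elim: s => [|i s IHs].
  by rewrite -fmoneE; exact: P1.
suff -> : << FMonom (i :: s) >> = words_gen K i * << FMonom s >> by exact: PX.
rewrite /words_gen malgM_def fgmulUU mulr1; congr << _ >>.
by apply/eqP; rewrite fmP fmM fmU.
Qed.

(* The free algebra is words_alg with the generators words_gen; the pair is
   locked to keep conversion and unification from computing in it. *)
Record alg_with_gens (K : comNzRingType) := AlgWithGens {
  gens_alg : algType K;
  gens_var : 'I_3 -> gens_alg
}.

Fact free_key : unit. Proof. by []. Qed.

Definition free_alg_gens (K : comNzRingType) : alg_with_gens K :=
  locked_with free_key (@AlgWithGens K (words_alg K) (@words_gen K)).
Canonical free_alg_gens_unlockable K := [unlockable of @free_alg_gens K].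

Definition free_alg (K : comNzRingType) : algType K :=
  gens_alg (free_alg_gens K).

Definition gen_var (K : comNzRingType) (i : 'I_3) : free_alg K :=
  gens_var (free_alg_gens K) i.

Lemma free_alg_ind (K : comNzRingType) (P : free_alg K -> Prop) :
  P 0 -> P 1 -> (forall a x y, P x -> P y -> P (a *: x + y)) ->
  (forall i x, P x -> P (gen_var K i * x)) -> forall z, P z.
Proof.
rewrite /gen_var; move: P; rewrite /free_alg [free_alg_gens K]unlock.
exact: words_alg_ind.
Qed.

Lemma free_eval_exists (K : comNzRingType) (B : algType K) (x : 'I_3 -> B) :
  exists e : free_alg K -> B,
    [/\ linear e, monoid_morphism e & forall i, e (gen_var K i) = x i].
Proof.
rewrite /gen_var /free_alg [free_alg_gens K]unlock; exists (words_eval x).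
split; [exact: words_eval_linear|exact: words_eval_monoid_morphism|].
exact: words_eval_gen.
Qed.

Definition free_eval (K : comNzRingType) (B : algType K) (x : 'I_3 -> B) :
  free_alg K -> B := projT1 (cid (free_eval_exists x)).

Lemma free_evalP (K : comNzRingType) (B : algType K) (x : 'I_3 -> B) :
  [/\ linear (free_eval x), monoid_morphism (free_eval x)
    & forall i, free_eval x (gen_var K i) = x i].
Proof. by rewrite /free_eval; case: cid. Qed.

Section Presentation.
Variable K : comNzRingType.
Implicit Types S T : seq (free_alg K).

Definition quot_gen S (i : 'I_3) : quot_alg S := to_quot S (gen_var K i).

Definition alg_hom S T (f : quot_alg S -> quot_alg T) : Prop :=
  linear f /\ monoid_morphism f.

Definition alg_iso S T (f : quot_alg S -> quot_alg T) : Prop :=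
  alg_hom f /\ bijective f.

Definition is_hom_of_gens S T (x : 'I_3 -> quot_alg T)
    (f : quot_alg S -> quot_alg T) : Prop :=
  alg_hom f /\ forall i, f (quot_gen S i) = x i.

(* The homomorphism mapping the i-th generator to x i, when there is one.  It
   is then unique (hom_of_gens_unique), and it exists when the family x
   satisfies the relations S (hom_of_gensP). *)
Definition hom_of_gens S T (x : 'I_3 -> quot_alg T) :
    quot_alg S -> quot_alg T :=
  xget (fun=> 0) [set f | is_hom_of_gens x f].

Lemma hom_of_gens_unique S T (x : 'I_3 -> quot_alg T)
    (f f' : quot_alg S -> quot_alg T) :
  is_hom_of_gens x f -> is_hom_of_gens x f' -> f = f'.
Proof.
move=> [[fL [f1 fM]] fx] [[fL' [f1' fM']] fx']; apply/funext.
have pL := to_quot_linear S; have [p1 pM] := to_quot_monoid_morphism S.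
elim/quot_ind; elim/free_alg_ind => [||a y z IHy IHz|i y IHy].
- by rewrite (linear_fun0 pL) (linear_fun0 fL) (linear_fun0 fL').
- by rewrite p1 f1 f1'.
- by rewrite pL fL fL' IHy IHz.
- by rewrite pM fM fM' IHy fx fx'.
Qed.

Lemma hom_of_gensP S T (x : 'I_3 -> quot_alg T) :
  (forall s, s \in S -> to_quot T (free_eval (fun i => quot_repr (x i)) s) = 0) ->
  is_hom_of_gens x (hom_of_gens x : quot_alg S -> quot_alg T).
Proof.
move=> HS; suff [f Hf] : exists f : quot_alg S -> quot_alg T, is_hom_of_gens x f.
  by rewrite /hom_of_gens; case: xgetP => // N; case: (N f Hf).
pose ev := free_eval (fun i => quot_repr (x i)).
pose e z := to_quot T (ev z).
have pL := to_quot_linear T; have [p1 pM] := to_quot_monoid_morphism T.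
have [vL [v1 vM] vx] := free_evalP (fun i => quot_repr (x i)).
rewrite -/ev in vL v1 vM vx.
have eL : linear e by move=> k y z; rewrite /e vL pL.
have eM : {morph e : y z / y * z} by move=> y z; rewrite /e vM pM.
have e1 : e 1 = 1 by rewrite /e v1.
have e0 := linear_fun0 eL.
have eD y z : e (y + z) = e y + e z by have := eL 1 y z; rewrite !scale1r.
have eK y : ideal_gen S y -> e y = 0.
  move=> Hy; apply: (Hy (fun z => e z = 0) _ HS).
  split=> [//|y1 y2 h1 h2|y1 y2 h|y1 y2 h].
  - by rewrite eD h1 h2 addr0.
  - by rewrite eM h mulr0.
  - by rewrite eM h mul0r.
pose f (z : quot_alg S) : quot_alg T := e (quot_repr z).
have fE y : f (to_quot S y) = e y.
  have := eK _ (@repr_to_quot _ _ S y); rewrite -scaleN1r addrC eL scaleN1r => h.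
  by apply/eqP; rewrite -subr_eq0 addrC h.
have qL := to_quot_linear S; have [q1 qM] := to_quot_monoid_morphism S.
exists f; split; last first.
  by move=> i; rewrite fE /e vx to_quotK.
split; last split.
- by move=> k; elim/quot_ind=> y; elim/quot_ind=> z; rewrite -qL !fE eL.
- by rewrite -[1]q1 fE.
- by elim/quot_ind=> y; elim/quot_ind=> z; rewrite -qM !fE eM.
Qed.

Record alg_aut S := AlgAut {
  aut_fun :> quot_alg S -> quot_alg S;
  aut_iso : alg_iso aut_fun
}.

HB.instance Definition _ S := gen_eqMixin (alg_aut S).
HB.instance Definition _ S := gen_choiceMixin (alg_aut S).

Lemma aut_ext S (f f' : alg_aut S) : f =1 f' -> f = f'.
Proof.
case: f f' => [f Hf] [f' Hf'] /= /funext e; subst f'.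
by rewrite (Prop_irrelevance Hf Hf').
Qed.

Lemma alg_iso_id S : alg_iso (@id (quot_alg S)).
Proof. by split; [split | exists id]. Qed.

Lemma alg_iso_comp S T U (f : quot_alg T -> quot_alg U)
    (h : quot_alg S -> quot_alg T) :
  alg_iso f -> alg_iso h -> alg_iso (f \o h).
Proof.
move=> [[fL [f1 fM]] fB] [[hL [h1 hM]] hB]; split; last exact: bij_comp.
split=> [a x y|]; first by rewrite /= hL fL.
by split=> [|x y] /=; rewrite ?h1 ?f1 ?hM ?fM.
Qed.

Lemma alg_iso_inv S T (f : quot_alg S -> quot_alg T)
    (h : quot_alg T -> quot_alg S) :
  alg_iso f -> cancel f h -> cancel h f -> alg_iso h.
Proof.
move=> [[fL [f1 fM]] _] fK hK; split; last by exists f.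
split=> [a x y|]; first by apply: (can_inj fK); rewrite fL !hK.
by split=> [|x y]; apply: (can_inj fK); rewrite ?fM !hK ?f1.
Qed.

Lemma aut_inv_exists S (f : alg_aut S) :
  exists h : alg_aut S, cancel f h /\ cancel h f.
Proof.
have [_ [h fK hK]] := aut_iso f.
by exists (AlgAut (alg_iso_inv (aut_iso f) fK hK)).
Qed.

Definition aut_one S : alg_aut S := AlgAut (alg_iso_id S).
Definition aut_mul S (f h : alg_aut S) : alg_aut S :=
  AlgAut (alg_iso_comp (aut_iso f) (aut_iso h)).
Definition aut_inv S (f : alg_aut S) : alg_aut S :=
  projT1 (cid (aut_inv_exists f)).

Lemma aut_mulA S : associative (@aut_mul S).
Proof. by move=> f1 f2 f3; apply: aut_ext. Qed.

Lemma aut_mul1 S : left_id (aut_one S) (@aut_mul S).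
Proof. by move=> f; apply: aut_ext. Qed.

Lemma aut_mulr1 S : right_id (aut_one S) (@aut_mul S).
Proof. by move=> f; apply: aut_ext. Qed.

Lemma aut_mulV S : left_inverse (aut_one S) (@aut_inv S) (@aut_mul S).
Proof.
move=> f; apply: aut_ext => x /=.
by rewrite /aut_inv; case: cid => h [fK _] /=; rewrite fK.
Qed.

Lemma aut_mulrV S : right_inverse (aut_one S) (@aut_inv S) (@aut_mul S).
Proof.
move=> f; apply: aut_ext => x /=.
by rewrite /aut_inv; case: cid => h [_ hK] /=; rewrite hK.
Qed.

(* f * h is the composite f \o h. *)
HB.instance Definition _ S := isGroup.Build (alg_aut S)
  (@aut_mulA S) (@aut_mul1 S) (@aut_mulr1 S)
  (@aut_mulV S) (@aut_mulrV S).

End Presentation.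

Section AssocPoly.
Variable K : numFieldType.
Implicit Types (P Q M : {poly K}).

Let a : {poly K} := - ('X * ('X - 1)).
Let b : {poly K} := - ('X * ('X + 1)).

Definition assoc_poly_spec Q P : Prop :=
  size P = (size Q).-1 /\
  (Q \Po (- ('X * ('X - 1)))) - (Q \Po (- ('X * ('X + 1))))
  = ('X - 1) * (P \Po (- ('X * ('X - 1))))
    + ('X + 1) * (P \Po (- ('X * ('X + 1)))).

Definition assoc_poly Q : {poly K} := xget 0 [set P | assoc_poly_spec Q P].

Let D Q := (Q \Po a) - (Q \Po b).
Let L P := ('X - 1) * (P \Po a) + ('X + 1) * (P \Po b).

Lemma assoc_poly_aux n Q : (size Q <= n.+1)%N ->
  exists M, [/\ (size M <= n)%N, D Q = L M & M`_n.-1 = Q`_n *+ n].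
Proof.
elim: n Q => [|n IHn] Q; elim/poly_ind: Q => [|r c _] sQ.
- exists 0; rewrite size_poly0 !coef0 mul0rn.
  by split=> //; rewrite /D /L !comp_poly0; ring.
- exists 0; rewrite size_poly0 coef0 mulr0n; split=> //.
  have r0 : r = 0.
    apply/eqP; rewrite -size_poly_eq0 -leqn0.
    move: sQ; rewrite size_MXaddC; case: ifP => [/andP[/eqP -> _]|_] //.
    by rewrite size_poly0.
  by rewrite /D /L r0 mul0r add0r !comp_polyC ?comp_poly0; ring.
- exists 0; rewrite size_poly0 !coef0 mul0rn.
  by split=> //; rewrite /D /L !comp_poly0; ring.
have sr : (size r <= n.+1)%N.
  move: sQ; rewrite size_MXaddC; case: ifP => [/andP[/eqP -> _]|_] //.
  by rewrite size_poly0.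
have [M1 [s1 e1 c1]] := IHn r sr.
have sM1X : (size (M1 * 'X)%R <= n.+1)%N.
  have [->|M1n0] := eqVneq M1 0; first by rewrite mul0r size_poly0.
  by rewrite size_mulX.
have [M2 [s2 e2 _]] := IHn _ sM1X.
exists (r + M1 + M1 * 'X + M2); split.
- rewrite !(leq_trans (size_polyD _ _)) // geq_max (leq_trans s2) // andbT.
  rewrite (leq_trans (size_polyD _ _)) // geq_max sM1X andbT.
  by rewrite (leq_trans (size_polyD _ _)) // geq_max sr (leq_trans s1).
- move: e1 e2; rewrite /D /L !comp_polyD !comp_polyM !comp_polyX !comp_polyC.
  set ra := r \Po a; set rb := r \Po b.
  set ma := M1 \Po a; set mb := M1 \Po b.
  set na := M2 \Po a; set nb := M2 \Po b => e1 e2.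
  transitivity (('X - 1) * ra + ('X + 1) * rb + (ra - rb)
     - 'X ^+ 2 * (ra - rb)); first by rewrite /a /b; ring.
  rewrite e1.
  transitivity (('X - 1) * ra + ('X + 1) * rb + (('X - 1) * ma + ('X + 1) * mb)
     + (('X - 1) * ma * a + ('X + 1) * mb * b) + (ma * a - mb * b)).
    by rewrite /a /b; ring.
  by rewrite e2; ring.
- rewrite /= !coefD coefMX coefMX coefC /= addr0.
  have -> : M2`_n = 0 by apply: nth_default.
  have -> : M1`_n = 0 by apply: nth_default.
  rewrite !addr0 mulrS; congr (_ + _).
  by case: n c1 {IHn sQ sr s1 sM1X s2} => [|n] /= c1; rewrite ?mulr0n ?c1.
Qed.

Lemma assoc_poly_L0 P : L P = 0 -> P = 0.
Proof.
move=> LP0; apply/eqP; apply: contraT => P0.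
have sa : size a = 3%N.
  rewrite size_polyN mulrC size_mulX ?size_XsubC //.
  by rewrite -size_poly_eq0 size_XsubC.
have ela : lead_coef a = -1.
  by rewrite lead_coefN lead_coefM lead_coefX lead_coefXsubC mul1r.
have Eb : 'X + 1 = 'X - (-1)%:P :> {poly K} by rewrite polyCN opprK.
have sb : size b = 3%N.
  rewrite size_polyN mulrC Eb size_mulX ?size_XsubC //.
  by rewrite -size_poly_eq0 size_XsubC.
have elb : lead_coef b = -1.
  by rewrite lead_coefN Eb lead_coefM lead_coefX lead_coefXsubC mul1r.
have la : lead_coef (('X - 1) * (P \Po a)) = lead_coef P * (-1) ^+ (size P).-1.
  by rewrite lead_coefM lead_coefXsubC mul1r lead_coef_comp ?sa // ela.
have lb : lead_coef (('X + 1) * (P \Po b)) = lead_coef P * (-1) ^+ (size P).-1.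
  by rewrite lead_coefM Eb lead_coefXsubC mul1r lead_coef_comp ?sb // elb.
have ab : ('X - 1) * (P \Po a) = - (('X + 1) * (P \Po b)).
  by apply/eqP; rewrite -addr_eq0; apply/eqP.
have := lead_coefN (('X + 1) * (P \Po b)); rewrite -ab la lb => /eqP.
rewrite -addr_eq0 -mulr2n mulrn_eq0 /= mulf_eq0 lead_coef_eq0 (negbTE P0) /=.
by rewrite expf_eq0 oppr_eq0 oner_eq0 andbF.
Qed.

Lemma assoc_poly_exists Q : exists P, assoc_poly_spec Q P.
Proof.
have [sQ|] := leqP (size Q) 1.
  exists 0; split; first by rewrite size_poly0; case: (size Q) sQ => [|[]].
  by rewrite (size1_polyC sQ) !comp_polyC; ring.
case: (ltnP 1 (size Q)) => // sQ _.
have sQ' : (size Q <= (size Q).-1.+1)%N by rewrite prednK // (ltn_trans _ sQ).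
have [M [sM eM cM]] := assoc_poly_aux sQ'.
exists M; split=> //; apply/eqP; rewrite eqn_leq sM /=.
rewrite leqNgt; apply/negP => sM'.
have : M`_(size Q).-2 = 0 by apply: nth_default; case: (size Q) sM' sQ => [|[]].
rewrite cM => /eqP; rewrite mulrn_eq0 -[Q`__]/(lead_coef Q) lead_coef_eq0.
rewrite -size_poly_eq0.
by case: (size Q) sQ => [|[]].
Qed.

Lemma assoc_poly_unique Q P P' :
  assoc_poly_spec Q P -> assoc_poly_spec Q P' -> P = P'.
Proof.
move=> [_ e] [_ e']; apply/eqP; rewrite -subr_eq0; apply/eqP/assoc_poly_L0.
move: e; rewrite e' /L !comp_polyB -/a -/b => e.
by rewrite !mulrBr addrACA -opprD -e subrr.
Qed.

Lemma assoc_polyP Q : assoc_poly_spec Q (assoc_poly Q).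
Proof.
by rewrite /assoc_poly; case: xgetP => // N; case: (assoc_poly_exists Q) => P /N.
Qed.

End AssocPoly.

Section AlgebraD.
Variable C : numClosedFieldType.
Implicit Types (Q : {poly C}) (g : C).

Definition D_relators (A : algType C) Q g (u v w : A) : seq A :=
  [:: lie u v - 2 *: w;
      lie u w - (- (2 *: (u * v)) + 2 *: w + g%:A);
      lie v w - (v ^+ 2 + horner_alg u (assoc_poly Q));
      horner_alg u Q + u * v ^+ 2 + w ^+ 2 - 2 *: (w * v) - g *: v].

Definition relD Q g : seq (free_alg C) :=
  D_relators Q g (gen_var C (@Ordinal 3 0 isT)) (gen_var C (@Ordinal 3 1 isT))
    (gen_var C (@Ordinal 3 2 isT)).

Definition algD Q g : Type := quot_alg (relD Q g).

HB.instance Definition _ Q g := GRing.PzRing.on (algD Q g).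
HB.instance Definition _ Q g := GRing.Lmodule.on (algD Q g).

Definition uD Q g : algD Q g := quot_gen (relD Q g) (@Ordinal 3 0 isT).
Definition vD Q g : algD Q g := quot_gen (relD Q g) (@Ordinal 3 1 isT).
Definition wD Q g : algD Q g := quot_gen (relD Q g) (@Ordinal 3 2 isT).

(* The homomorphism u |-> a, v |-> b, w |-> c. *)
Definition homD Q g Q' g' (a b c : algD Q' g') : algD Q g -> algD Q' g' :=
  @hom_of_gens _ (relD Q g) (relD Q' g') (fun i => nth c [:: a; b] i).

Definition autD Q g : Type := alg_aut (relD Q g).

HB.instance Definition _ Q g := Group.on (autD Q g).

Record arrow_from Q g := Arrow {
  cod_poly : {poly C};
  cod_par : C;
  arrow_fun : algD Q g -> algD cod_poly cod_par
}.

Definition isos_from Q g : set (arrow_from Q g) :=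
  [set h | [/\ cod_poly h \is monic, (3 < size (cod_poly h))%N
             & @alg_iso _ (relD Q g) (relD _ _) (arrow_fun h)]].

Definition aut_arrow Q g (f : autD Q g) : arrow_from Q g :=
  @Arrow Q g Q g (aut_fun f).

Definition arrow_id Q g : arrow_from Q g := Arrow (@id (algD Q g)).

Definition Theta Q g : algD Q g -> algD Q (- g) :=
  homD (uD Q (- g)) (- vD Q (- g)) (- wD Q (- g)).

Definition arrow_Theta Q g : arrow_from Q g := Arrow (@Theta Q g).

Definition Theta_after Q g (h : arrow_from Q g) : arrow_from Q g :=
  Arrow (@Theta (cod_poly h) (cod_par h) \o arrow_fun h).

Definition cubic (A B C0 : C) : {poly C} :=
  'X^3 + A *: 'X^2 + B *: 'X + C0%:P.

Section Psi.
Variables A B C0 g : C.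

Definition tB : C := 6 * (A ^+ 2 / 16 - 1) + 3 * 'i * g / 2 - B / 2.
Definition tC : C := C0 - A * (B / 4 - 'i * g / 4 + 1 - A ^+ 2 / 16).
Definition tg : C := 'i * (2 * (1 - A ^+ 2 / 16) + B / 2 + 'i * g / 2).

Definition hB : C := 6 * (A ^+ 2 / 16 - 1) - 3 * 'i * g / 2 - B / 2.
Definition hC : C := C0 - A * (B / 4 + 'i * g / 4 + 1 - A ^+ 2 / 16).
Definition hg : C := 'i * (2 * (A ^+ 2 / 16 - 1) - B / 2) - g / 2.

(* Pitfall: the signs of i in the values of Psi and PsiV on generators are tied
   to the parameters of the target.  Comparing constant terms in the image of
   the relation for [u,w] shows that
     u |-> i v'/2 - u'/2 - (1 + A/4),
     v |-> - v'/2 + 3i u'/2 + i (1 + A/4),  w |-> w'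
   is compatible with the relations only if the coefficient B' and parameter g'
   of the target satisfy B' + i g' = 4 (A^2/16 - 1) - 2i g.  This holds for
   (hB, hg) but fails for (tB, tg) in general, so these are the values for
   PsiV; the values with i replaced by -i are the ones for Psi.  Sources that
   attach them the other way round do not get homomorphisms. *)
Definition Psi : algD (cubic A B C0) g -> algD (cubic A tB tC) tg :=
  let u := uD (cubic A tB tC) tg in
  let v := vD (cubic A tB tC) tg in
  let w := wD (cubic A tB tC) tg in
  let e : algD (cubic A tB tC) tg := 1 in
  homD (- (('i / 2) *: v) - 2^-1 *: u - (1 + A / 4) *: e)
              (- (2^-1 *: v) - (3 * 'i / 2) *: u - ('i * (1 + A / 4)) *: e)
              w.

Definition PsiV : algD (cubic A B C0) g -> algD (cubic A hB hC) hg :=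
  let u := uD (cubic A hB hC) hg in
  let v := vD (cubic A hB hC) hg in
  let w := wD (cubic A hB hC) hg in
  let e : algD (cubic A hB hC) hg := 1 in
  homD (('i / 2) *: v - 2^-1 *: u - (1 + A / 4) *: e)
              (- (2^-1 *: v) + (3 * 'i / 2) *: u + ('i * (1 + A / 4)) *: e)
              w.

Definition arrow_Psi : arrow_from (cubic A B C0) g := Arrow Psi.
Definition arrow_PsiV : arrow_from (cubic A B C0) g := Arrow PsiV.

End Psi.

End AlgebraD.

Arguments isos_from {C} Q g _.

Definition group_isog (G H : groupType) : Prop :=
  exists2 f : G -> H, bijective f & {morph f : x y / (x * y)%g}.

Definition generates (G : groupType) (S : set G) : Prop :=
  forall H : {pred G}, group_closed H -> (forall x, S x -> x \in H) ->
  forall x, x \in H.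

(* Main.v *)
From HB Require Import structures.
Require Import Defs.
From mathcomp Require Import all_boot all_order all_algebra perm.
From mathcomp Require Import complex boolp classical_sets functions cardinality.
From mathcomp Require Import reals.
From mathcomp Require Import ring zify.

(* The algebra D(Q, gamma) acts faithfully on functions on 1/3 + Z by difference
   operators: with s the variable and T the shift, u = - s (s - 1),
   v = T + b(s) + c(s) T^(-1) and w = s T - (s - 1) c(s) T^(-1).  Giving s degree 1
   and T degree n - 1, an operator has as symbol a Laurent polynomial in T, and
   the symbol of a commutator is a Poisson bracket.

   Let phi be an isomorphism from a cubic algebra, with U, V, W the images of the
   generators.  Since [U, V] = 2 W and [U, W] = - 2 U V + 2 W + gamma, a commutator
   with U raises degrees by at most deg U / 2 on average.  If deg U > 2, the symbols
   exhibit an element of the target on which every commutator with U raises the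
   degree by exactly deg U - 1, a contradiction.  If deg V > 2, the top symbol of
   the last defining relation cannot vanish.  Hence U and V are affine combinations
   of u and v, and n = 3.  Comparing coefficients in the relations leaves a
   quadratic system, whose solutions are the six maps; these are well defined by a
   computation of normal forms of noncommutative polynomials. *)

Set Implicit Arguments.
Unset Strict Implicit.
Unset Printing Implicit Defensive.

Import Order.TTheory GRing.Theory Num.Theory.
Local Open Scope ring_scope.

(** * Growth of rational functions on the lattice *)

(** The bound on deg U compares two rates. Along V -> W -> U V two brackets with U add deg U, and
    the Leibniz rule carries the rate deg U / 2 to all products; as phi is onto, it then holds for
    every element of the target. The Poisson bracket adds deg U - 1 as long as it does not vanish,
    which is more once deg U > 2. The obstacle is to exclude vanishing. If the symbol of U is a
    multiple of a power of s, brackets with it only rescale the powers of T in the symbol of v.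
    Otherwise it has a zero t != 0, and the symbols obtained from u vanish at t to an order that is
    known exactly.

    These arguments need the extreme powers of T in a symbol to be T^J and T^(-J) with nonzero
    coefficients, which is why elements are first expanded in ordered monomials. The last defining
    relation stays out of the quadratic system: it bounds deg V and, at the end, determines C. *)

Section Growth.
Variable C : numFieldType.
Implicit Types (N D p q : {poly C}) (f g : int -> C) (d e j k m : int) (c : C).

(** The coefficient c may be 0, so sums and cancellations need no case distinction on the degree. *)
Definition has_top (n : nat) c p : Prop := (size p <= n.+1)%N /\ p`_n = c.

Lemma has_topD n c c' p q :
  has_top n c p -> has_top n c' q -> has_top n (c + c') (p + q).
Proof.
move=> [sp <-] [sq <-]; split; last by rewrite coefD.
by rewrite (leq_trans (size_polyD _ _)) // geq_max sp.
Qed.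

Lemma has_topM n n' c c' p q :
  has_top n c p -> has_top n' c' q -> has_top (n + n') (c * c') (p * q).
Proof.
move=> [sp <-] [sq <-]; split.
  rewrite (leq_trans (size_polyMleq _ _)) //; lia.
rewrite coefM (bigD1 (inord n)) //= inordK ?ltnS ?leq_addr // addKn.
rewrite big1 ?addr0 // => i ni.
have {}ni : (i : nat) != n.
  apply: contraNneq ni => ni; apply/eqP/val_inj.
  by rewrite /= inordK ?ltnS ?leq_addr.
have [lin|] := ltnP i n.
  rewrite [q`__]nth_default ?mulr0 // (leq_trans sq) //; lia.
by move=> ?; rewrite [p`__]nth_default ?mul0r // (leq_trans sp) //; lia.
Qed.

Lemma has_top_lt n p : (size p <= n)%N -> has_top n 0 p.
Proof. by move=> sp; split; [exact: leqW | exact: nth_default]. Qed.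

Lemma has_topC c : has_top 0 c c%:P.
Proof. by split; [exact: size_polyC_leq1 | rewrite coefC]. Qed.

Lemma has_topXn n c : has_top n c (c *: 'X^n).
Proof.
split; last by rewrite coefZ coefXn eqxx mulr1.
by rewrite (leq_trans (size_scale_leq _ _)) // size_polyXn.
Qed.

Lemma has_topX : has_top 1 1 ('X : {poly C}).
Proof. by rewrite -['X]expr1 -[_ ^+ 1]scale1r; exact: has_topXn. Qed.

Lemma has_topMX n c p : has_top n c p -> has_top n.+1 c (p * 'X).
Proof. by move=> H; rewrite -addn1 -[c]mulr1; apply: has_topM H has_topX. Qed.

Lemma has_topN n c p : has_top n c p -> has_top n (- c) (- p).
Proof. by move=> [sp <-]; split; rewrite ?size_polyN ?coefN. Qed.

Lemma has_top_shift n c p (a : C) :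
  has_top n c p -> has_top n c (p \Po ('X + a%:P)).
Proof.
move=> [sp <-]; split.
  rewrite (leq_trans (size_comp_poly_leq _ _)) // -[a]opprK polyCN size_XsubC.
  lia.
have [->|p0] := eqVneq p 0; first by rewrite comp_poly0 !coef0.
have [lt|ge] := ltnP (size p) n.+1.
  by rewrite !nth_default // size_comp_poly2 // -[a]opprK polyCN size_XsubC.
have E : size p = n.+1 by apply/anti_leq; rewrite sp.
have e2 : size ('X + a%:P) = 2 by rewrite -[a]opprK polyCN size_XsubC.
have := @lead_coef_comp _ p ('X + a%:P); rewrite e2 => /(_ isT).
rewrite !lead_coefE size_comp_poly2 // e2 E /= => ->.
by rewrite coefD coefX coefC /= addr0 expr1n mulr1.
Qed.

(* The leading term of the difference p(X + a) - p(X) is that of a p'(X). *)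
Lemma has_top_diff n c p (a : C) : has_top n.+1 c p ->
  has_top n (n.+1%:R * a * c) (p \Po ('X + a%:P) - p).
Proof.
elim/poly_ind: p n c => [|p c0 IHp] n c [sp <-].
  by rewrite coef0 mulr0 comp_poly0 subrr; apply: has_top_lt; rewrite size_poly0.
have sp' : (size p <= n.+1)%N.
  move: sp; rewrite size_MXaddC; case: ifP => [/andP[/eqP -> _]|_] //.
  by rewrite size_poly0.
rewrite coefD coefMX coefC /= addr0 comp_polyD comp_polyM comp_polyX comp_polyC.
set pa := p \Po _.
rewrite (_ : _ - _ = (pa - p) * 'X + a%:P * pa); last by ring.
have Hp : has_top n p`_n p by [].
have H2 : has_top n (a * p`_n) (a%:P * pa).
  by rewrite -[n]add0n; apply: has_topM (has_topC _) _; apply: has_top_shift.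
case: n sp sp' Hp H2 => [|n] sp sp' Hp H2.
  have pap : pa = p by rewrite /pa (size1_polyC sp') comp_polyC.
  by move: H2; rewrite pap subrr mul0r add0r mul1r.
have := has_topD (has_topMX (IHp _ _ Hp)) H2.
by congr (has_top _ _ _); rewrite -[n.+2]addn1 natrD; ring.
Qed.

(* A base point whose translates by integers avoid the half-integers, where the
   coefficients of the difference operators below have their poles. *)
Definition lat m : C := 3^-1 + m%:~R.

Lemma latD m k : lat (m + k) = lat m + k%:~R.
Proof. by rewrite /lat intrD addrA. Qed.

Lemma lat_inj : injective lat.
Proof. by move=> m k /addrI/intr_inj. Qed.

Lemma lat_neq m k : 2 * lat m != k%:~R.
Proof.
apply/eqP; rewrite /lat => H.
have : ((2 + 6 * m - 3 * k)%:~R : C) = 0.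
  by rewrite intrB intrD !intrM -H; field.
by move/eqP; rewrite intr_eq0; lia.
Qed.

Lemma poly_lat_inj p q : (forall m, p.[lat m] = q.[lat m]) -> p = q.
Proof.
move=> H; apply/eqP; rewrite -subr_eq0; apply: contraT => npq.
have := @max_poly_roots _ (p - q) (map (fun i : nat => lat i%:Z)
  (iota 0 (size (p - q)))) npq.
rewrite size_map size_iota ltnn; apply.
  by apply/allP => x /mapP [i _ ->]; rewrite rootE hornerD hornerN H subrr.
by rewrite map_inj_uniq ?iota_uniq // => i k /lat_inj [].
Qed.

(* f is the restriction to the lattice of a rational function of s which is
   c s^d + lower order terms at infinity. *)
Definition growth d c f : Prop := exists N D (a b : nat),
  [/\ forall m, D.[lat m] != 0, forall m, f m * D.[lat m] = N.[lat m],
      has_top a 1 D, has_top b c N & b%:Z = d + a%:Z].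

Lemma growth_eq d c f g : f =1 g -> growth d c f -> growth d c g.
Proof. by move=> /funext ->. Qed.

(** Two fractions for f give N D' = N' D at infinitely many points, hence as polynomials. *)
Lemma growth_unique d c c' f : growth d c f -> growth d c' f -> c = c'.
Proof.
move=> [N [D [a [b [D0 E Da Nb ab]]]]] [N' [D' [a' [b' [D0' E' Da' Nb' ab']]]]].
have EN : N * D' = N' * D.
  by apply: poly_lat_inj => m; rewrite !hornerM -E -E' mulrAC.
have [_] := has_topM Nb Da'; have [_] := has_topM Nb' Da.
rewrite !mulr1 EN; have -> : (b' + a = b + a')%N by lia.
by move=> -> ->.
Qed.

Lemma growth0 d : growth d 0 (fun=> 0).
Proof.
have [d0|d0] := lerP 0 d.
  exists 0, 1, 0%N, `|d|%N; split=> [m|m|||]; rewrite ?hornerC ?oner_eq0 ?mul0r //.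
  - exact: has_topC.
  - by apply: has_top_lt; rewrite size_poly0.
  - lia.
exists 0, 'X^(`|d|%N), `|d|%N, 0%N; split=> [m|m|||].
- rewrite hornerXn expf_neq0 //; have := lat_neq m 0.
  by rewrite mulf_eq0 negb_or => /andP [].
- by rewrite mul0r horner0.
- by rewrite -[_ ^+ _]scale1r; exact: has_topXn.
- by apply: has_top_lt; rewrite size_poly0.
- lia.
Qed.

Lemma growthD d c c' f g :
  growth d c f -> growth d c' g -> growth d (c + c') (f \+ g).
Proof.
move=> [N [D [a [b [D0 E Da Nb ab]]]]] [N' [D' [a' [b' [D0' E' Da' Nb' ab']]]]].
exists (N * D' + N' * D), (D * D'), (a + a')%N, (b + a')%N; split=> [m|m|||].
- by rewrite hornerM mulf_neq0.
- by rewrite hornerD !hornerM -E -E' /=; ring.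
- by rewrite -[1]mulr1; exact: has_topM.
- apply: has_topD; first by rewrite -[c]mulr1; exact: has_topM.
  have -> : (b + a' = b' + a)%N by lia.
  by rewrite -[c']mulr1; exact: has_topM.
- lia.
Qed.

Lemma growthM d e c c' f g :
  growth d c f -> growth e c' g -> growth (d + e) (c * c') (f \* g).
Proof.
move=> [N [D [a [b [D0 E Da Nb ab]]]]] [N' [D' [a' [b' [D0' E' Da' Nb' ab']]]]].
exists (N * N'), (D * D'), (a + a')%N, (b + b')%N; split=> [m|m|||].
- by rewrite hornerM mulf_neq0.
- by rewrite !hornerM -E -E' /=; ring.
- by rewrite -[1]mulr1; exact: has_topM.
- exact: has_topM.
- lia.
Qed.

Lemma growth_poly n c p : has_top n c p -> growth n%:Z c (fun m => p.[lat m]).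
Proof.
move=> Hp; exists p, 1, 0%N, n; split=> [m|m|||] //.
- by rewrite hornerC oner_eq0.
- by rewrite hornerC mulr1.
- exact: has_topC.
- by rewrite addr0.
Qed.

Lemma growthC c : growth 0 c (fun=> c).
Proof. by apply: growth_eq (growth_poly (has_topC c)) => m; rewrite hornerC. Qed.

Lemma growthZ d c a f : growth d c f -> growth d (a * c) (fun m => a * f m).
Proof. by move=> H; have := growthM (growthC a) H; rewrite add0r. Qed.

Lemma growthN d c f : growth d c f -> growth d (- c) (\- f).
Proof.
by move/(growthZ (-1)); rewrite mulN1r; apply: growth_eq => m; rewrite mulN1r.
Qed.

Lemma growthV n p : has_top n 1 p -> (forall m, p.[lat m] != 0) ->
  growth (- n%:Z) 1 (fun m => p.[lat m]^-1).
Proof.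
move=> Hp p0; exists 1, p, n, 0%N; split=> // [m||].
- by rewrite mulVf // hornerC.
- exact: has_topC.
- by rewrite addNr.
Qed.

Lemma growth_lt d e c f : d < e -> growth d c f -> growth e 0 f.
Proof.
move=> de [N [D [a [b [D0 E Da Nb ab]]]]].
exists N, D, a, (b + `|e - d|)%N; split=> //; last by lia.
by apply: has_top_lt; case: Nb; lia.
Qed.

(* Allows both degrees in the definition of growth to be taken positive. *)
Lemma growth_pos d c f : growth d c f -> exists N D (a b : nat),
  [/\ forall m, D.[lat m] != 0, forall m, f m * D.[lat m] = N.[lat m],
      has_top a.+1 1 D, has_top b.+1 c N & b%:Z = d + a%:Z].
Proof.
move=> [N [D [a [b [D0 E Da Nb ab]]]]].
exists (N * 'X), (D * 'X), a, b; split=> [m|m|||] //; try exact: has_topMX.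
- rewrite hornerMX mulf_neq0 //; have := lat_neq m 0.
  by rewrite mulf_eq0 negb_or => /andP [].
- by rewrite !hornerMX mulrA E.
Qed.

Lemma growth_shift d c f j : growth d c f -> growth d c (fun m => f (m + j)).
Proof.
move=> [N [D [a [b [D0 E Da Nb ab]]]]].
exists (N \Po ('X + j%:~R%:P)), (D \Po ('X + j%:~R%:P)), a, b.
have S p m : (p \Po ('X + j%:~R%:P)).[lat m] = p.[lat (m + j)].
  by rewrite horner_comp !hornerE latD.
by split=> [m|m|||] //; rewrite ?S //; exact: has_top_shift.
Qed.

(** By the quotient rule the leading terms of numerator and denominator contribute (b + 1) j c and -
    (a + 1) j c, where b - a = d. The formula covers d <= 0 as well. *)
Lemma growth_diff d c f j : growth d c f ->
  growth (d - 1) (d%:~R * j%:~R * c) (fun m => f (m + j) - f m).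
Proof.
move=> /growth_pos [N [D [a [b [D0 E Da Nb ab]]]]].
pose S p := p \Po ('X + (j%:~R : C)%:P).
have SE p m : (S p).[lat m] = p.[lat (m + j)].
  by rewrite horner_comp !hornerE latD.
exists ((S N - N) * D - N * (S D - D)), (D * S D), (a.+1 + a.+1)%N, (b + a.+1)%N.
split=> [m|m|||].
- by rewrite hornerM SE mulf_neq0.
- by rewrite !(hornerD, hornerN, hornerM) !SE -!E; ring.
- by rewrite -[1]mulr1; apply: has_topM => //; exact: has_top_shift.
- have := has_topN (has_topM Nb (has_top_diff j%:~R Da)).
  rewrite addSnnS => H; have := has_topD (has_topM (has_top_diff j%:~R Nb) Da) H.
  congr has_top.
  have -> : d = b%:Z - a%:Z by lia.
  by rewrite intrB -!pmulrn -!natr1; ring.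
- lia.
Qed.

End Growth.

(** * Difference operators and their symbols *)

Section Endomorphisms.
Variable C : numFieldType.

Record endo := Endo {
  endo_fun :> (int -> C) -> int -> C;
  endo_lin : forall a x y m,
    endo_fun (fun k => a * x k + y k) m = a * endo_fun x m + endo_fun y m
}.

HB.instance Definition _ := gen_eqMixin endo.
HB.instance Definition _ := gen_choiceMixin endo.

Lemma endo_ext (F G : endo) : (forall x m, F x m = G x m) -> F = G.
Proof.
case: F G => [F HF] [G HG] /= H.
have E : F = G by apply/funext => x; apply/funext.
by subst G; rewrite (Prop_irrelevance HF HG).
Qed.

Fact endo_zero_lin a (x y : int -> C) (m : int) : 0 = a * 0 + 0 :> C.
Proof. by rewrite mulr0 addr0. Qed.
Definition endo_zero := @Endo (fun _ _ => 0) endo_zero_lin.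

Definition endo_one := @Endo id (fun _ _ _ _ => erefl).

Fact endo_add_lin (F G : endo) a x y m :
  F (fun k => a * x k + y k) m + G (fun k => a * x k + y k) m
  = a * (F x m + G x m) + (F y m + G y m).
Proof. by rewrite !endo_lin; ring. Qed.
Definition endo_add (F G : endo) := @Endo (fun x m => F x m + G x m) (endo_add_lin F G).

Fact endo_scale_lin b (F : endo) a x y m :
  b * F (fun k => a * x k + y k) m = a * (b * F x m) + b * F y m.
Proof. by rewrite !endo_lin; ring. Qed.
Definition endo_scale b (F : endo) := @Endo (fun x m => b * F x m) (endo_scale_lin b F).

Fact endo_mul_lin (F G : endo) a x y m :
  F (G (fun k => a * x k + y k)) m = a * F (G x) m + F (G y) m.
Proof. by rewrite -endo_lin; congr (endo_fun F _ m); apply/funext => k; rewrite endo_lin. Qed.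
Definition endo_mul (F G : endo) := @Endo (fun x => F (G x)) (endo_mul_lin F G).

Lemma endo_addA : associative endo_add.
Proof. by move=> F G H; apply: endo_ext => x m /=; rewrite addrA. Qed.
Lemma endo_addC : commutative endo_add.
Proof. by move=> F G; apply: endo_ext => x m /=; rewrite addrC. Qed.
Lemma endo_add0 : left_id endo_zero endo_add.
Proof. by move=> F; apply: endo_ext => x m /=; rewrite add0r. Qed.
Lemma endo_addN : left_inverse endo_zero (endo_scale (-1)) endo_add.
Proof. by move=> F; apply: endo_ext => x m /=; rewrite mulN1r addNr. Qed.

HB.instance Definition _ :=
  GRing.isZmodule.Build endo endo_addA endo_addC endo_add0 endo_addN.

Lemma endo_mulA : associative endo_mul.
Proof. by move=> F G H; apply: endo_ext. Qed.
Lemma endo_mul1 : left_id endo_one endo_mul.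
Proof. by move=> F; apply: endo_ext. Qed.
Lemma endo_mulr1 : right_id endo_one endo_mul.
Proof. by move=> F; apply: endo_ext. Qed.
Lemma endo_mulDl : left_distributive endo_mul endo_add.
Proof. by move=> F G H; apply: endo_ext. Qed.
Lemma endo_mulDr : right_distributive endo_mul endo_add.
Proof.
move=> F G H; apply: endo_ext => x m /=.
have := endo_lin F 1 (G x) (H x) m; rewrite mul1r => <-.
by congr (endo_fun F _ m); apply/funext => k; rewrite mul1r.
Qed.
Lemma endo_one_neq0 : endo_one != endo_zero.
Proof.
apply/eqP => /(congr1 (fun F : endo => F (fun=> 1) 0)) /= /eqP.
by rewrite oner_eq0.
Qed.

HB.instance Definition _ := GRing.Zmodule_isNzRing.Build endo
  endo_mulA endo_mul1 endo_mulr1 endo_mulDl endo_mulDr endo_one_neq0.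

Lemma endo_scaleA a b F : endo_scale a (endo_scale b F) = endo_scale (a * b) F.
Proof. by apply: endo_ext => x m /=; rewrite mulrA. Qed.
Lemma endo_scale1 : left_id 1 endo_scale.
Proof. by move=> F; apply: endo_ext => x m /=; rewrite mul1r. Qed.
Lemma endo_scaleDr : right_distributive endo_scale +%R.
Proof. by move=> a F G; apply: endo_ext => x m /=; rewrite mulrDr. Qed.
Lemma endo_scaleDl F : {morph endo_scale^~ F : a b / a + b}.
Proof. by move=> a b; apply: endo_ext => x m /=; rewrite mulrDl. Qed.

HB.instance Definition _ := GRing.Zmodule_isLmodule.Build C endo
  endo_scaleA endo_scale1 endo_scaleDr endo_scaleDl.

Lemma endo_scaleAl (a : C) (F G : endo) : a *: (F * G) = (a *: F) * G.
Proof. by apply: endo_ext. Qed.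
HB.instance Definition _ := GRing.Lmodule_isLalgebra.Build C endo endo_scaleAl.

Lemma endo_scaleAr (a : C) (F G : endo) : a *: (F * G) = F * (a *: G).
Proof.
apply: endo_ext => x m; rewrite -[LHS]/(a * F (G x) m).
have := endo_lin F a (G x) (fun=> 0) m.
have F0 : F (fun=> 0) m = 0.
  have := endo_lin F (-1) x x m; rewrite mulN1r addNr => H; rewrite -[RHS]H.
  by congr (endo_fun F _ m); apply/funext => k; rewrite mulN1r addNr.
rewrite F0 addr0 => <-.
by congr (endo_fun F _ m); apply/funext => k; exact: addr0.
Qed.
HB.instance Definition _ := GRing.Lalgebra_isAlgebra.Build C endo endo_scaleAr.

Lemma endoDE (F G : endo) x m : (F + G) x m = F x m + G x m. Proof. by []. Qed.
Lemma endoZE a (F : endo) x m : (a *: F) x m = a * F x m. Proof. by []. Qed.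
Lemma endoNE (F : endo) x m : (- F) x m = - F x m.
Proof. by rewrite -scaleN1r endoZE mulN1r. Qed.
Lemma endoME (F G : endo) x m : (F * G) x m = F (G x) m. Proof. by []. Qed.
Lemma endo1E x m : (1 : endo) x m = x m. Proof. by []. Qed.
Lemma endo0E x m : (0 : endo) x m = 0. Proof. by []. Qed.

Fact wshift_lin (f : int -> C) (j : int) a (x y : int -> C) m :
  f m * (a * x (m + j) + y (m + j)) = a * (f m * x (m + j)) + f m * y (m + j).
Proof. by ring. Qed.
Definition wshift f j := @Endo (fun x m => f m * x (m + j)) (@wshift_lin f j).

Lemma wshiftE f j x m : wshift f j x m = f m * x (m + j). Proof. by []. Qed.

Lemma wshiftM f g j k :
  wshift f j * wshift g k = wshift (fun m => f m * g (m + j)) (j + k).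
Proof.
by apply: endo_ext => x m; rewrite endoME !wshiftE mulrA addrA.
Qed.

Lemma wshiftD f g j : wshift f j + wshift g j = wshift (f \+ g) j.
Proof. by apply: endo_ext => x m; rewrite endoDE !wshiftE mulrDl. Qed.

Lemma wshiftZ a f j : a *: wshift f j = wshift (fun m => a * f m) j.
Proof. by apply: endo_ext => x m; rewrite endoZE !wshiftE mulrA. Qed.

Lemma wshiftN f j : - wshift f j = wshift (\- f) j.
Proof. by apply: endo_ext => x m; rewrite endoNE !wshiftE mulNr. Qed.

Lemma wshift0 j : wshift (fun=> 0) j = 0.
Proof. by apply: endo_ext => x m; rewrite wshiftE mul0r. Qed.

Lemma wshift1 : wshift (fun=> 1) 0 = 1.
Proof. by apply: endo_ext => x m; rewrite wshiftE mul1r addr0. Qed.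

End Endomorphisms.

(** * Symbols of difference operators and the Poisson bracket *)

Section Symbols.
Variables (C : numFieldType) (r : nat).
Implicit Types (p q : {poly C}) (F G : endo C) (f g : int -> C).
Implicit Types (d e : int) (J K k l : nat) (a c : C).

Local Notation wt d J k := (d - r%:Z * (k%:Z - J%:Z)).

(* F is a difference operator of degree at most d for the filtration in which s
   has degree 1 and the shift T has degree r, with homogeneous component
   s^d T^(-J) p(T / s^r) in degree d. *)
Inductive symbol d J : {poly C} -> endo C -> Prop :=
| symbol0 : symbol d J 0 0
| symbolS k c f p F : growth (wt d J k) c f -> symbol d J p F ->
    symbol d J (c *: 'X^k + p) (wshift f (k%:Z - J%:Z) + F).

Lemma symbol_wshift d J k c f : growth (wt d J k) c f ->
  symbol d J (c *: 'X^k) (wshift f (k%:Z - J%:Z)).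
Proof.
move=> H; rewrite -[_ *: _]addr0 -[wshift _ _]addr0.
by apply: symbolS => //; exact: symbol0.
Qed.

Lemma symbolD d J p q F G :
  symbol d J p F -> symbol d J q G -> symbol d J (p + q) (F + G).
Proof.
elim=> [|k c f p' F' H _ IH] HG; first by rewrite !add0r.
by rewrite -!addrA; apply: symbolS => //; exact: IH.
Qed.

Lemma symbolZ d J a p F : symbol d J p F -> symbol d J (a *: p) (a *: F).
Proof.
elim=> [|k c f p' F' H _ IH]; first by rewrite !scaler0; exact: symbol0.
rewrite !scalerDr scalerA wshiftZ; apply: symbolS => //; exact: growthZ.
Qed.

(** The coefficient of T^j at m: only this term of F sees the indicator function of m + j when
    evaluated at m. *)
Definition shift_coef F (j m : int) : C := F (fun i : int => (i == m + j)%:R) m.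

Lemma symbol_coef d J p F k : symbol d J p F ->
  growth (wt d J k) p`_k (shift_coef F (k%:Z - J%:Z)).
Proof.
elim=> [|l c f p' F' H _ IH]; first by rewrite coef0; exact: growth0.
rewrite coefD; apply: growthD IH.
rewrite coefZ coefXn; have [kl|kl] := eqVneq k l.
  by subst l; rewrite mulr1; apply: growth_eq H => m; rewrite wshiftE eqxx mulr1.
rewrite mulr0; apply: growth_eq (growth0 _ _) => m.
rewrite wshiftE; case: eqP => [E|]; rewrite ?mulr0 //.
by case/eqP: kl; lia.
Qed.

Lemma symbol_unique d J p q F : symbol d J p F -> symbol d J q F -> p = q.
Proof.
move=> Hp Hq; apply/polyP => k.
exact: growth_unique (symbol_coef k Hp) (symbol_coef k Hq).
Qed.

Lemma symbol_lt d e J p F : d < e -> symbol d J p F -> symbol e J 0 F.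
Proof.
move=> de; elim=> [|k c f p' F' H _ IH]; first exact: symbol0.
rewrite -[0]add0r -[X in X + 0](scale0r 'X^k); apply: symbolS IH.
by apply: growth_lt H; lia.
Qed.

Lemma symbol_widen d J p F K : symbol d J p F -> symbol d (J + K) ('X^K * p) F.
Proof.
elim=> [|k c f p' F' H _ IH]; first by rewrite mulr0; exact: symbol0.
rewrite mulrDr -scalerAr -exprD.
have -> : k%:Z - J%:Z = (K + k)%N%:Z - (J + K)%N%:Z by lia.
apply: symbolS IH; move: H; congr growth; lia.
Qed.

Lemma symbol_widen0 d J F K : symbol d J 0 F -> symbol d (J + K) 0 F.
Proof. by move/(symbol_widen K); rewrite mulr0. Qed.

Lemma symbolM d e J K p q F G :
  symbol d J p F -> symbol e K q G -> symbol (d + e) (J + K) (p * q) (F * G).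
Proof.
elim=> [|k c f p' F' Hf _ IH] HG; first by rewrite !mul0r; exact: symbol0.
rewrite !mulrDl; apply: symbolD; last exact: IH.
elim: HG => [|l c' g q' G' Hg _ IH']; first by rewrite !mulr0; exact: symbol0.
rewrite !mulrDr; apply: symbolD => //.
rewrite -scalerAr -scalerAl -exprD scalerA [c' * c]mulrC wshiftM.
have -> : k%:Z - J%:Z + (l%:Z - K%:Z) = (k + l)%N%:Z - (J + K)%N%:Z by lia.
apply: symbol_wshift.
have := growthM Hf (growth_shift (k%:Z - J%:Z) Hg).
congr growth; lia.
Qed.

(* The operator T d/dT on T^(-J) p(T). *)
Definition theta_deriv J p := 'X * p^`() - J%:R *: p.

(* The Poisson bracket of s^d T^(-J) p(T) and s^e T^(-K) q(T). *)
Definition bracket d e J K p q : {poly C} :=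
  e%:~R *: (q * theta_deriv J p) - d%:~R *: (p * theta_deriv K q).

Lemma theta_derivXn J k :
  theta_deriv J 'X^k = (k%:Z - J%:Z)%:~R *: 'X^k.
Proof.
rewrite /theta_deriv derivXn intrB -!pmulrn scalerBl; congr (_ - _).
case: k => [|k]; first by rewrite mulr0n mulr0 scale0r.
by rewrite mulrnAr -exprS scaler_nat.
Qed.

Lemma theta_derivD J p q :
  theta_deriv J (p + q) = theta_deriv J p + theta_deriv J q.
Proof. by rewrite /theta_deriv derivD -!mul_polyC; ring. Qed.

Lemma theta_derivZ J a p : theta_deriv J (a *: p) = a *: theta_deriv J p.
Proof. by rewrite /theta_deriv derivZ -!mul_polyC; ring. Qed.

Lemma bracketDl d e J K p p' q :
  bracket d e J K (p + p') q = bracket d e J K p q + bracket d e J K p' q.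
Proof. by rewrite /bracket theta_derivD -!mul_polyC; ring. Qed.

Lemma bracketDr d e J K p q q' :
  bracket d e J K p (q + q') = bracket d e J K p q + bracket d e J K p q'.
Proof. by rewrite /bracket theta_derivD -!mul_polyC; ring. Qed.

(** As T^j g(s) = g(s + j) T^j, the commutator of f T^j and g T^i has coefficient f (g(s + j) -
    g(s)) - g (f(s + i) - f(s)), and [growth_diff] gives the leading terms of the differences. *)
Lemma symbol_lie d e J K p q F G : symbol d J p F -> symbol e K q G ->
  symbol (d + e - 1) (J + K) (bracket d e J K p q) (lie F G).
Proof.
have t0 L : theta_deriv L 0 = 0 by rewrite /theta_deriv deriv0 mulr0 scaler0 subrr.
have lD (x y z : endo C) : lie (x + y) z = lie x z + lie y z.
  by rewrite /lie mulrDl mulrDr opprD addrACA.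
have lDr (x y z : endo C) : lie z (x + y) = lie z x + lie z y.
  by rewrite /lie mulrDl mulrDr opprD addrACA.
elim=> [|k c f p' F' Hf _ IH] HG.
  rewrite /bracket t0 mulr0 mul0r !scaler0 subrr /lie mul0r mulr0 subrr.
  exact: symbol0.
rewrite bracketDl lD; apply: symbolD; last exact: IH.
elim: HG => [|l c' g q' G' Hg _ IH'].
  rewrite /bracket t0 mulr0 mul0r !scaler0 subrr /lie mul0r mulr0 subrr.
  exact: symbol0.
rewrite bracketDr lDr; apply: symbolD => //.
rewrite /lie !wshiftM [l%:Z - _ + _]addrC wshiftN wshiftD.
have -> : k%:Z - J%:Z + (l%:Z - K%:Z) = (k + l)%N%:Z - (J + K)%N%:Z by lia.
rewrite /bracket !theta_derivZ !theta_derivXn.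
set j : int := k%:Z - J%:Z; set i : int := l%:Z - K%:Z.
have -> : e%:~R *: ((c' *: 'X^l) * (c *: (j%:~R *: 'X^k)))
  - d%:~R *: ((c *: 'X^k) * (c' *: (i%:~R *: 'X^l)))
  = ((e%:~R * j%:~R - d%:~R * i%:~R) * (c * c')) *: 'X^(k + l) :> {poly C}.
  rewrite exprD -!mul_polyC !(polyCM, polyCB); ring.
apply: symbol_wshift.
(* The coefficients have degrees d - r j and e - r i; the contributions of r i j cancel. *)
have -> : (e%:~R * j%:~R - d%:~R * i%:~R) * (c * c') =
  c * ((wt e K l)%:~R * j%:~R * c') - c' * ((wt d J k)%:~R * i%:~R * c).
  by rewrite -/i -/j; move: (i) (j) => i' j'; rewrite !intrB !intrM; ring.
have Hg' := growthM Hf (growth_diff j Hg).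
have Hf' := growthN (growthM Hg (growth_diff i Hf)).
have E1 : wt d J k + (wt e K l - 1) = wt (d + e - 1) (J + K) (k + l) by lia.
have E2 : wt e K l + (wt d J k - 1) = wt (d + e - 1) (J + K) (k + l) by lia.
rewrite E1 in Hg'; rewrite E2 in Hf'.
apply: growth_eq (growthD Hg' Hf') => m /=; ring.
Qed.

Lemma theta_deriv_widen J L p :
  theta_deriv (J + L) ('X^L * p) = 'X^L * theta_deriv J p.
Proof.
have H : theta_deriv L 'X^L = 0 by rewrite theta_derivXn subrr scale0r.
rewrite /theta_deriv derivM mulrDr mulrA natrD scalerDl.
move/eqP: H; rewrite /theta_deriv subr_eq0 => /eqP ->.
by rewrite -!mul_polyC; ring.
Qed.

Lemma bracket_widen d e J K L L' p q :
  bracket d e (J + L) (K + L') ('X^L * p) ('X^L' * q)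
  = 'X^(L + L') * bracket d e J K p q.
Proof. by rewrite /bracket !theta_deriv_widen exprD -!mul_polyC; ring. Qed.

(* The homogeneous component is the Laurent polynomial s^d T^(-J) p(T), while
   lower components may involve T^(-k) with k > J. *)
Definition lsymbol d J p F : Prop :=
  exists L, symbol d (J + L) ('X^L * p) F.

Lemma symbol_lsymbol d J p F : symbol d J p F -> lsymbol d J p F.
Proof. by move=> H; exists 0%N; rewrite addn0 expr0 mul1r. Qed.

Lemma lsymbol_ge d J p F : lsymbol d J p F ->
  exists L, forall M, (L <= M)%N -> symbol d (J + M) ('X^M * p) F.
Proof.
move=> [L H]; exists L => M /subnK <-; have := symbol_widen (M - L) H.
by rewrite mulrA -exprD -addnA [(L + (M - L))%N]addnC.
Qed.

Lemma lsymbol_shift d J K p F :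
  lsymbol d J p F -> lsymbol d (J + K) ('X^K * p) F.
Proof.
move=> /lsymbol_ge [L H]; exists L.
by rewrite mulrA -exprD -addnA [(L + K)%N]addnC; apply/H/leq_addl.
Qed.

Lemma lsymbolD d J p q F G :
  lsymbol d J p F -> lsymbol d J q G -> lsymbol d J (p + q) (F + G).
Proof.
move=> /lsymbol_ge [L HF] /lsymbol_ge [L' HG]; exists (L + L')%N.
by rewrite mulrDr; apply: symbolD; [apply: HF|apply: HG]; rewrite ?leq_addr ?leq_addl.
Qed.

Lemma lsymbolZ d J a p F : lsymbol d J p F -> lsymbol d J (a *: p) (a *: F).
Proof. by move=> [L H]; exists L; rewrite -scalerAr; exact: symbolZ. Qed.

Lemma lsymbolN d J p F : lsymbol d J p F -> lsymbol d J (- p) (- F).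
Proof. by rewrite -[- p]scaleN1r -[- F]scaleN1r; exact: lsymbolZ. Qed.

Lemma lsymbolB d J p q F G :
  lsymbol d J p F -> lsymbol d J q G -> lsymbol d J (p - q) (F - G).
Proof. by move=> HF /lsymbolN; exact: lsymbolD. Qed.

Lemma lsymbolM d e J K p q F G : lsymbol d J p F -> lsymbol e K q G ->
  lsymbol (d + e) (J + K) (p * q) (F * G).
Proof.
move=> [L HF] [L' HG]; exists (L + L')%N; rewrite addnACA exprD mulrACA.
exact: symbolM.
Qed.

Lemma lsymbol_lie d e J K p q F G : lsymbol d J p F -> lsymbol e K q G ->
  lsymbol (d + e - 1) (J + K) (bracket d e J K p q) (lie F G).
Proof.
move=> [L HF] [L' HG]; exists (L + L')%N; rewrite addnACA -bracket_widen.
exact: symbol_lie.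
Qed.

Lemma lsymbol0 d J : lsymbol d J 0 0.
Proof. by exists 0%N; rewrite mulr0; exact: symbol0. Qed.

Lemma lsymbol0_any d J K F : lsymbol d J 0 F -> lsymbol d K 0 F.
Proof.
move=> [L]; rewrite mulr0 => /(symbol_widen0 K) H; exists (J + L)%N.
by rewrite mulr0 addnC.
Qed.

Lemma lsymbol_lt d e J K p F : d < e -> lsymbol d J p F -> lsymbol e K 0 F.
Proof.
move=> de [L /(symbol_lt de) H]; apply: (@lsymbol0_any _ J); exists L.
by rewrite mulr0.
Qed.

Lemma lsymbol_unique d J p q F : lsymbol d J p F -> lsymbol d J q F -> p = q.
Proof.
move=> /lsymbol_ge [L HF] /lsymbol_ge [L' HG].
have := symbol_unique (HF _ (leq_addr L' L)) (HG _ (leq_addl L L')).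
by apply: mulfI; rewrite expf_neq0 // polyX_eq0.
Qed.

Lemma lsymbol_wshift0 c : lsymbol 0 0 c%:P (c *: 1).
Proof.
apply: symbol_lsymbol; rewrite -wshift1 wshiftZ -[c%:P]mulr1 mul_polyC -(expr0 'X).
apply: (@symbol_wshift 0 0 0); rewrite subrr mulr0 subr0 mulr1; exact: growthC.
Qed.

End Symbols.

(** * The representation by difference operators *)

Section Homs.
Variable K : comNzRingType.

Lemma monoid_linear_horner (A B : algType K) (f : A -> B) (u : A) (p : {poly K}) :
  linear f -> monoid_morphism f -> f (horner_alg u p) = horner_alg (f u) p.
Proof.
move=> fL [f1 fM]; have f0 := linear_fun0 fL.
have fD y z : f (y + z) = f y + f z by have := fL 1 y z; rewrite !scale1r.
have fZ a y : f (a *: y) = a *: f y by have := fL a y 0; rewrite !addr0 f0 addr0.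
elim/poly_ind: p => [|p c IH]; first by rewrite !raddf0 f0.
by rewrite !rmorphD !rmorphM /= !horner_algX !horner_algC fD fM IH fZ f1.
Qed.

(** The universal property with values in an arbitrary algebra, here [endo], which is not presented
    as a [quot_alg]. *)
Lemma quot_hom_exists (S : seq (free_alg K)) (B : algType K) (x : 'I_3 -> B) :
  (forall s, s \in S -> free_eval x s = 0) ->
  exists f : quot_alg S -> B,
    [/\ linear f, monoid_morphism f & forall i, f (quot_gen S i) = x i].
Proof.
move=> HS; have [eL [e1 eM] ex] := free_evalP x.
set e := free_eval x in HS eL e1 eM ex.
have e0 := linear_fun0 eL.
have eD y z : e (y + z) = e y + e z by have := eL 1 y z; rewrite !scale1r.
have eK y : ideal_gen S y -> e y = 0.
  move=> Hy; apply: (Hy (fun z => e z = 0) _ HS).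
  split=> [//|y1 y2 h1 h2|y1 y2 h|y1 y2 h].
  - by rewrite eD h1 h2 addr0.
  - by rewrite eM h mulr0.
  - by rewrite eM h mul0r.
pose f (z : quot_alg S) := e (quot_repr z).
have fE y : f (to_quot S y) = e y.
  by rewrite /f -[quot_repr _](subrK y) eD eK ?add0r //; exact: repr_to_quot.
have qL := to_quot_linear S; have [q1 qM] := to_quot_monoid_morphism S.
exists f; split=> [k||i]; last by rewrite fE ex.
- by elim/quot_ind=> y; elim/quot_ind=> z; rewrite -qL !fE eL.
- split; first by rewrite -[1]q1 fE.
  by elim/quot_ind=> y; elim/quot_ind=> z; rewrite -qM !fE eM.
Qed.

End Homs.

Lemma D_relators_morph (C : numClosedFieldType) (A B : algType C) (f : A -> B)
    (Q : {poly C}) g (u v w : A) : linear f -> monoid_morphism f ->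
  map f (D_relators Q g u v w) = D_relators Q g (f u) (f v) (f w).
Proof.
move=> fL fM; have [f1 fMM] := fM; have f0 := linear_fun0 fL.
have fD y z : f (y + z) = f y + f z by have := fL 1 y z; rewrite !scale1r.
have fZ a y : f (a *: y) = a *: f y by have := fL a y 0; rewrite !addr0 f0 addr0.
have fN y : f (- y) = - f y by rewrite -scaleN1r fZ scaleN1r.
have fX2 y : f (y ^+ 2) = f y ^+ 2 by rewrite !expr2 fMM.
pose E := (fD, fN, fMM, fZ, fX2, f1, fun u p => monoid_linear_horner u p fL fM).
by rewrite /D_relators /= /lie !E.
Qed.

Section Representation.
Variables (C : numClosedFieldType) (Q : {poly C}) (g : C).
Local Notation P := (assoc_poly Q).
Local Notation s m := (lat C m).
Implicit Types (m : int).

Definition u_coef m : C := - (s m * (s m - 1)).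
Definition v_coef0 m : C := - g / (2 * s m * (s m - 1)).
(** This value is forced: the parts free of T of the last two relations are linear in c(s) and c(s +
    1), and eliminating c(s + 1) leaves (2 s - 1) (2 s - 3) c(s) on one side. *)
Definition v_coefN m : C :=
  (Q.[u_coef m] + s m * P.[u_coef m] + g ^+ 2 / (4 * (s m - 1) ^+ 2))
  / ((2 * s m - 1) * (2 * s m - 3)).

Definition u_op : endo C := wshift u_coef 0.
Definition v_op : endo C :=
  wshift (fun=> 1) 1 + wshift v_coef0 0 + wshift v_coefN (- 1).
Definition w_op : endo C :=
  wshift (lat C) 1 + wshift (fun m => - (s m - 1) * v_coefN m) (- 1).

Lemma horner_wshift (f : int -> C) (p : {poly C}) :
  horner_alg (wshift f 0) p = wshift (fun m => p.[f m]) 0.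
Proof.
elim/poly_ind: p => [|p c IH].
  rewrite raddf0 -(wshift0 C 0); congr wshift; apply/funext => m.
  by rewrite horner0.
rewrite rmorphD rmorphM /= horner_algX horner_algC IH wshiftM -wshift1 wshiftZ.
rewrite wshiftD; congr wshift; apply/funext => m.
by rewrite /= !hornerE.
Qed.

Lemma half_lat_neq m k : 2 * s m + k%:~R != 0.
Proof. by rewrite -[k]opprK mulrNz subr_eq0 lat_neq. Qed.

Lemma lat_neq_int m k : s m + k%:~R != 0.
Proof.
have := half_lat_neq m (2 * k); rewrite intrM -mulrDr mulf_eq0 negb_or.
by case/andP.
Qed.

Let s0 m : s m != 0. Proof. by have := lat_neq_int m 0; rewrite addr0. Qed.
Let sN1 m : s m - 1 != 0. Proof. exact: (lat_neq_int m (-1)). Qed.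
Let sN2 m : s m - 2 != 0. Proof. exact: (lat_neq_int m (-2)). Qed.
Let s1 m : s m + 1 != 0. Proof. exact: (lat_neq_int m 1). Qed.
Let dN1 m : 2 * s m - 1 != 0. Proof. exact: (half_lat_neq m (-1)). Qed.
Let dN3 m : 2 * s m - 3 != 0. Proof. exact: (half_lat_neq m (-3)). Qed.
Let d1 m : 2 * s m + 1 != 0. Proof. exact: (half_lat_neq m 1). Qed.
Let sS m : s (m + 1) = s m + 1. Proof. exact: latD. Qed.
Let sP m : s (m - 1) = s m - 1. Proof. by rewrite latD. Qed.

Lemma assoc_poly_lat m : Q.[u_coef m] - Q.[u_coef (m + 1)]
  = (s m - 1) * P.[u_coef m] + (s m + 1) * P.[u_coef (m + 1)].
Proof.
have [_ /(congr1 (fun p => p.[s m]))] := assoc_polyP Q.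
have -> : u_coef (m + 1) = - (s m * (s m + 1)).
  by rewrite /u_coef sS; ring.
by rewrite !hornerE !horner_comp !hornerE.
Qed.

(** The part of [v, w] = v^2 + P(u) free of T. It ties the values of c at neighbouring points
    together, and the identity that defines P is what makes it true. *)
Lemma v_coefN_shift m : v_coefN (m + 1) =
  ((2 * s m - 3) * v_coefN m - v_coef0 m ^+ 2 - P.[u_coef m]) / (2 * s m + 1).
Proof.
have E := assoc_poly_lat m.
have -> : v_coefN (m + 1) = (Q.[u_coef (m + 1)] + (s m + 1) * P.[u_coef (m + 1)]
    + g ^+ 2 / (4 * s m ^+ 2)) / ((2 * s m + 1) * (2 * s m - 1)).
  rewrite /v_coefN sS; congr (_ / _); last by ring.
  by rewrite addrK.
have -> : Q.[u_coef (m + 1)] = Q.[u_coef m]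
   - ((s m - 1) * P.[u_coef m] + (s m + 1) * P.[u_coef (m + 1)]).
  by rewrite -E; ring.
rewrite /v_coefN /v_coef0; field.
by rewrite !(s0, sN1, d1, dN1, dN3).
Qed.

(** The part of the last relation free of T, solved for Q(u), with gamma replaced by 2 u b(s). *)
Lemma v_coefN_horner m : Q.[u_coef m] =
  s m * (2 * s m + 1) * v_coefN (m + 1) + (s m - 1) * (2 * s m - 3) * v_coefN m
  + u_coef m * v_coef0 m ^+ 2.
Proof.
rewrite v_coefN_shift /v_coef0 /v_coefN.
move: (Q.[_]) (P.[_]) => q p; rewrite /u_coef; field.
by rewrite !(s0, sN1, d1, dN1, dN3).
Qed.

Lemma op_relations : forall z, z \in D_relators Q g u_op v_op w_op -> z = 0.
Proof.
have bE m : v_coef0 (m + 1) = (s m - 1) / (s m + 1) * v_coef0 m.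
  rewrite /v_coef0 sS; field; by rewrite !(s0, sN1, s1).
have bE' m : v_coef0 (m - 1) = s m / (s m - 2) * v_coef0 m.
  rewrite /v_coef0 sP; field; by rewrite !(s0, sN1, sN2).
(* With gamma expressed through b(s), the remaining identities are rational in s, with the values of
   b and c left free. *)
have gE m : g = - 2 * s m * (s m - 1) * v_coef0 m.
  rewrite /v_coef0; field; by rewrite !(s0, sN1).
have idx m : [/\ m + 1 - 1 = m, m - 1 + 1 = m & m + 0 = m].
  by split; ring.
pose E := (endoDE, endoNE, endoZE, endoME, endo1E, wshiftE).
move=> z; rewrite !inE => /or4P [] /eqP ->; apply: endo_ext => x m;
  rewrite /lie ?expr2 /u_op ?horner_wshift /v_op /w_op !E endo0E;
  have [i1 i2 i3] := idx m; have [i4 i5 i6] := idx (m + 1);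
  have [i7 i8 i9] := idx (m - 1); rewrite ?(i1, i2, i3, i4, i5, i6, i7, i8, i9).
- rewrite /u_coef !sS !sP; ring.
- rewrite /u_coef !sS !sP {1}(gE m); ring.
- rewrite !sS !sP bE bE' v_coefN_shift; field.
  by rewrite !(sN2, s1, d1).
- rewrite v_coefN_horner v_coefN_shift !sS !sP bE bE' {1}(gE m) /u_coef; field.
  by rewrite !(sN2, s1, d1).
Qed.

End Representation.

Lemma algD_ind (C : numClosedFieldType) (Q : {poly C}) g (X : algD Q g -> Prop) :
  X 0 -> X 1 -> (forall a x y, X x -> X y -> X (a *: x + y)) ->
  (forall x, X x -> X (uD Q g * x)) -> (forall x, X x -> X (vD Q g * x)) ->
  (forall x, X x -> X (wD Q g * x)) -> forall z, X z.
Proof.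
move=> X0 X1 XL Xu Xv Xw.
have pL := to_quot_linear (relD Q g).
have [p1 pM] := to_quot_monoid_morphism (relD Q g).
elim/quot_ind; elim/free_alg_ind => [||a x y IHx IHy|i x IHx].
- by rewrite (linear_fun0 pL).
- by rewrite p1.
- by rewrite pL; exact: XL.
- rewrite pM; case: i => [[|[|[|//]]] lti].
  + by rewrite (bool_irrelevance lti isT); exact: Xu.
  + by rewrite (bool_irrelevance lti isT); exact: Xv.
  + by rewrite (bool_irrelevance lti isT); exact: Xw.
Qed.

(** * Spanning by ordered monomials and faithfulness *)

Section Filtration.
Variables (C : numClosedFieldType) (Q : {poly C}) (g : C).
Local Notation P := (assoc_poly Q).
Local Notation D := (algD Q g).
Local Notation r := (size Q).-2.
Local Notation u := (uD Q g).
Local Notation v := (vD Q g).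
Local Notation w := (wD Q g).
Implicit Types (x y z : D) (i j k d : nat) (e : bool) (a : C) (p : {poly C}).
Hypothesis sQ : (3 < size Q)%N.

Definition eval_u p : D :=
  to_quot (relD Q g) (horner_alg (gen_var C (@Ordinal 3 0 isT)) p).

Let pL := to_quot_linear (relD Q g).
Let p1 : to_quot (relD Q g) 1 = 1. Proof. by []. Qed.
Let pM := (to_quot_monoid_morphism (relD Q g)).2.
Let pZ a (s : free_alg C) :
  to_quot (relD Q g) (a *: s) = a *: to_quot (relD Q g) s.
Proof. by have := pL a s 0; rewrite (linear_fun0 pL) !addr0. Qed.
Let pD (s t : free_alg C) :
  to_quot (relD Q g) (s + t) = to_quot (relD Q g) s + to_quot (relD Q g) t.
Proof. by have := pL 1 s t; rewrite !scale1r. Qed.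
Let pN (s : free_alg C) : to_quot (relD Q g) (- s) = - to_quot (relD Q g) s.
Proof. by rewrite -scaleN1r pZ scaleN1r. Qed.

Lemma eval_u0 : eval_u 0 = 0.
Proof. by rewrite /eval_u raddf0 (linear_fun0 pL). Qed.

Lemma eval_uMXaddC p a : eval_u (p * 'X + a%:P) = u * eval_u p + a *: (1 : D).
Proof.
rewrite /eval_u mulrC rmorphD rmorphM /= horner_algX horner_algC.
by rewrite pD pM pZ p1.
Qed.

Lemma relD0 : [/\ lie u v = 2 *: w,
  lie u w = - (2 *: (u * v)) + 2 *: w + g *: (1 : D),
  lie v w = v ^+ 2 + eval_u P &
  eval_u Q + u * v ^+ 2 + w ^+ 2 - 2 *: (w * v) - g *: v = 0].
Proof.
have H := @to_quot_gen _ _ (relD Q g).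
have pX (s : free_alg C) : to_quot (relD Q g) (s ^+ 2) = to_quot (relD Q g) s ^+ 2.
  by rewrite !expr2 pM.
split.
- have := H _ (mem_nth 0 (isT : (0 < size (relD Q g))%N)).
  by rewrite /= /lie !(pD, pN, pM, pZ) => /eqP; rewrite subr_eq0 => /eqP.
- have := H _ (mem_nth 0 (isT : (1 < size (relD Q g))%N)).
  by rewrite /= /lie !(pD, pN, pM, pZ) => /eqP; rewrite subr_eq0 => /eqP.
- have := H _ (mem_nth 0 (isT : (2 < size (relD Q g))%N)).
  by rewrite /= /lie !(pD, pN, pM, pZ, pX) => /eqP; rewrite subr_eq0 => /eqP.
- have := H _ (mem_nth 0 (isT : (3 < size (relD Q g))%N)).
  by rewrite /= !(pD, pN, pM, pZ, pX).
Qed.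

Let vu : v * u = u * v - 2 *: w.
Proof. by have [<- _ _ _] := relD0; rewrite /lie subKr. Qed.
Let wu : w * u = u * w + 2 *: (u * v) - 2 *: w - g *: (1 : D).
Proof.
have [_ E _ _] := relD0; rewrite -[w * u](subKr (u * w)) -/(lie u w) E.
by rewrite !opprD opprK !addrA.
Qed.
Let wv : w * v = v * w - v * v - eval_u P.
Proof.
have [_ _ E _] := relD0; rewrite -[w * v](subKr (v * w)) -/(lie v w) E.
by rewrite expr2 opprD addrA.
Qed.
Let ww : w * w = g *: v + 2 *: (w * v) - (eval_u Q + u * (v * v)).
Proof.
have [_ _ _ /eqP] := relD0.
rewrite subr_eq add0r subr_eq !expr2 => /eqP <-.
by rewrite addrAC subrr add0r.
Qed.
Let scAl a x y : (a *: x) * y = a *: (x * y).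
Proof. by rewrite (quot_scaleAl a x y). Qed.
Let scAr a x y : x * (a *: y) = a *: (x * y).
Proof. by rewrite (quot_scaleAr a x y). Qed.

(** The exponent of w is Boolean because the last relation rewrites w^2. *)
Definition pbw i j e : D := u ^+ i * v ^+ j * w ^+ e.
(** The weights 2, r, r + 1 of u, v, w, with r = deg Q - 1, are the degrees of the corresponding
    difference operators. *)
Definition pbw_wt i j e : nat := (2 * i + r * j + (r + 1) * e)%N.

Lemma pbw_wtSu i j e : pbw_wt i.+1 j e = (pbw_wt i j e).+2.
Proof. by rewrite /pbw_wt; lia. Qed.

Lemma pbw_wtSv i j e : pbw_wt i j.+1 e = (pbw_wt i j e + r)%N.
Proof. by rewrite /pbw_wt; lia. Qed.

Lemma pbw_wtSw i j : pbw_wt i j true = (pbw_wt i j false + r.+1)%N.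
Proof. by rewrite /pbw_wt; lia. Qed.

Lemma pbw_wt0 : pbw_wt 0 0 false = 0%N.
Proof. by rewrite /pbw_wt; lia. Qed.

Definition pbw_wtE := (pbw_wtSu, pbw_wtSv, pbw_wtSw, pbw_wt0).

Lemma pbwSu i j e : pbw i.+1 j e = u * pbw i j e.
Proof. by rewrite /pbw exprS !mulrA. Qed.

Lemma pbw0Sv j e : pbw 0 j.+1 e = v * pbw 0 j e.
Proof. by rewrite /pbw !expr0 !mul1r exprS !mulrA. Qed.

(** With the strict bound, [fil 0] is zero and [fil 3] is spanned by the monomials of weight at most
    2. *)
Inductive fil d : D -> Prop :=
| fil0 : fil d 0
| filS a i j e z : (pbw_wt i j e < d)%N -> fil d z -> fil d (a *: pbw i j e + z).

Lemma fil_pbw d i j e : (pbw_wt i j e < d)%N -> fil d (pbw i j e).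
Proof.
move=> lt; rewrite -[pbw _ _ _]addr0 -[pbw _ _ _]scale1r.
by apply: filS => //; exact: fil0.
Qed.

Lemma filD d x y : fil d x -> fil d y -> fil d (x + y).
Proof.
by elim=> [|a i j e z lt _ IH] Hy; rewrite ?add0r // -addrA; apply: filS (IH Hy).
Qed.

Lemma filZ d a x : fil d x -> fil d (a *: x).
Proof.
elim=> [|b i j e z lt _ IH]; first by rewrite scaler0; exact: fil0.
by rewrite scalerDr scalerA; exact: filS.
Qed.

Lemma filB d x y : fil d x -> fil d y -> fil d (x - y).
Proof. by move=> Hx Hy; rewrite -[- y]scaleN1r; apply: filD; last exact: filZ. Qed.

Lemma fil_mono d d' x : (d <= d')%N -> fil d x -> fil d' x.
Proof.
move=> le; elim=> [|a i j e z lt _ IH]; first exact: fil0.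
by apply: filS => //; exact: leq_trans lt le.
Qed.

Lemma fil_mul x d m :
  (forall i j e, (pbw_wt i j e < d)%N -> fil (pbw_wt i j e + m).+1 (x * pbw i j e)) ->
  forall z, fil d z -> fil (d + m) (x * z).
Proof.
move=> H z; elim=> [|a i j e {}z lt _ IH]; first by rewrite mulr0; exact: fil0.
rewrite mulrDr scAr; apply: filD => //; apply: filZ.
by apply: fil_mono (H _ _ _ lt); rewrite -addSn leq_add2r.
Qed.

Lemma fil_mulu d z : fil d z -> fil (d + 2) (u * z).
Proof.
apply: fil_mul => i j e _; rewrite -pbwSu; apply: fil_pbw.
by rewrite ?pbw_wtE; lia.
Qed.

Lemma fil_eval_u p d z : fil d z -> fil (d + 2 * (size p).-1) (eval_u p * z).
Proof.
elim/poly_ind: p => [|p a IH] Hz; first by rewrite eval_u0 mul0r; exact: fil0.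
rewrite eval_uMXaddC mulrDl scAl mul1r -mulrA; apply: filD; last first.
  by apply: filZ; apply: fil_mono Hz; rewrite leq_addr.
have [->|p0] := eqVneq p 0; first by rewrite eval_u0 [0 * z]mul0r mulr0; exact: fil0.
apply: fil_mono (fil_mulu (IH Hz)).
rewrite size_MXaddC (negbTE p0) /= -addnA leq_add2l.
by case: (size p) (size_poly_eq0 p) => [|k _ /=]; [rewrite (negbTE p0)|lia].
Qed.

Let szP : size P = (size Q).-1. Proof. by have [] := assoc_polyP Q. Qed.

(** Moving v or w past the first letter of a monomial produces no weight above that of the product.
    The claim for v runs one weight ahead of that for w: rewriting w v^(j+1) applies v to the terms
    of w v^j, whose weight may exceed that of v^(j+1) by one. *)
Lemma fil_mulvw d :
  (forall i j e, (pbw_wt i j e < d.+1)%N ->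
    fil (pbw_wt i j e + r).+1 (v * pbw i j e)) /\
  (forall i j e, (pbw_wt i j e < d)%N ->
    fil (pbw_wt i j e + r.+1).+1 (w * pbw i j e)).
Proof.
have v0 j e : fil (pbw_wt 0 j e + r).+1 (v * pbw 0 j e).
  by rewrite -pbw0Sv; apply: fil_pbw; rewrite ?pbw_wtE; lia.
elim: d => [|d [IHv IHw]].
  split=> // i j e; case: i => [|i] lt; first exact: v0.
  by move: lt; rewrite ?pbw_wtE; lia.
have mv i j e : (pbw_wt i j e < d.+2)%N -> fil (pbw_wt i j e + r).+1 (v * pbw i j e).
  case: i => [|i] lt; first exact: v0.
  have E := pbw_wtSu i j e.
  rewrite E in lt *; rewrite pbwSu mulrA vu mulrBl scAl -mulrA; apply: filB.
    apply: fil_mono (fil_mulu (IHv _ _ _ _)); lia.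
  by apply: filZ; apply: fil_mono (IHw _ _ _ _); lia.
split=> // i j e; case: i => [|i] lt; last first.
  have E := pbw_wtSu i j e.
  rewrite E in lt *; rewrite pbwSu mulrA wu !mulrBl mulrDl !scAl mul1r -!mulrA.
  apply: filB; first apply: filB; first apply: filD.
  - by apply: fil_mono (fil_mulu (IHw _ _ _ _)); lia.
  - by apply: filZ; apply: fil_mono (fil_mulu (IHv _ _ _ _)); lia.
  - by apply: filZ; apply: fil_mono (IHw _ _ _ _); lia.
  - by apply: filZ; apply: fil_pbw; lia.
have pbw1 d' : (0 < d')%N -> fil d' 1.
  move=> lt'; have := @fil_pbw d' 0 0 false; rewrite /pbw !expr0 !mulr1; apply.
  by rewrite ?pbw_wtE; lia.
have evP p k d' : (size p <= k.+1)%N -> (2 * k < d')%N -> fil d' (eval_u p).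
  move=> sp lt'; rewrite -[eval_u p]mulr1.
  by apply: fil_mono (fil_eval_u p (pbw1 1%N _)) => //; lia.
have Ev j' : v ^+ j' = pbw 0 j' false by rewrite /pbw expr0 mul1r mulr1.
have Evw : v * w = pbw 0 1 true by rewrite /pbw expr0 mul1r !expr1.
have Ew : w = pbw 0 0 true by rewrite /pbw !expr0 !mul1r expr1.
case: j lt => [|j] lt.
  rewrite /pbw !expr0 !mul1r; case: e lt => lt; last first.
    by rewrite expr0 mulr1 Ew; apply: fil_pbw; rewrite ?pbw_wtE; lia.
  rewrite expr1 ww wv -expr2; apply: filB; first apply: filD.
  - by rewrite -[v]expr1 Ev; apply: filZ; apply: fil_pbw; rewrite ?pbw_wtE; lia.
  - apply: filZ; rewrite Evw Ev; apply: filB; first apply: filB.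
    + by apply: fil_pbw; rewrite ?pbw_wtE; lia.
    + by apply: fil_pbw; rewrite ?pbw_wtE; lia.
    + by apply: (evP _ (size Q).-2); rewrite ?szP ?pbw_wtE; lia.
  - apply: filD; first by apply: (evP _ (size Q).-1); rewrite ?pbw_wtE; lia.
    by rewrite Ev -pbwSu; apply: fil_pbw; rewrite ?pbw_wtE; lia.
have E := pbw_wtSv 0 j e.
rewrite E in lt *; rewrite pbw0Sv mulrA wv !mulrBl -!mulrA.
apply: filB; first apply: filB.
- have := @fil_mul v (pbw_wt 0 j e + r.+1).+1 r _ _ (IHw 0%N j e _).
  move=> H; apply: fil_mono (H _ _); [lia| |lia].
  by move=> i' j' e' lt'; apply: mv; lia.
- by rewrite -!pbw0Sv; apply: fil_pbw; rewrite ?pbw_wtE; lia.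
- have := @fil_eval_u P (pbw_wt 0 j e).+1 _ (fil_pbw (ltnSn _)).
  by apply: fil_mono; rewrite szP; lia.
Qed.

Lemma fil_mulv d z : fil d z -> fil (d + r) (v * z).
Proof. by apply: fil_mul => i j e lt; apply: (fil_mulvw d).1; lia. Qed.

Lemma fil_mulw d z : fil d z -> fil (d + r.+1) (w * z).
Proof. by apply: fil_mul => i j e lt; apply: (fil_mulvw d).2; lia. Qed.

Lemma fil_exists z : exists d, fil d z.
Proof.
elim/algD_ind: z => [||a x y [d Hx] [d' Hy]|x [d Hx]|x [d Hx]|x [d Hx]].
- by exists 0%N; exact: fil0.
- exists 1%N; rewrite (_ : 1 = pbw 0 0 false); first by apply: fil_pbw; rewrite ?pbw_wtE; lia.
  by rewrite /pbw !expr0 !mulr1.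
- exists (d + d')%N; apply: filD.
    by apply: filZ; apply: fil_mono Hx; rewrite leq_addr.
  by apply: fil_mono Hy; rewrite leq_addl.
- by exists (d + 2)%N; exact: fil_mulu.
- by exists (d + r)%N; exact: fil_mulv.
- by exists (d + r.+1)%N; exact: fil_mulw.
Qed.

(** Only 1, u and, when r = 2, v have weight at most 2. *)
Lemma fil3_span z : fil 3 z -> exists a b c,
  z = a *: u + b *: v + c *: (1 : D) /\ (size Q != 4%N -> b = 0).
Proof.
elim=> [|a i j e {}z lt _ [a' [b' [c' [-> Hb]]]]].
  by exists 0, 0, 0; rewrite !scale0r !addr0.
case: e lt => lt; first by move: lt; rewrite ?pbw_wtE; lia.
case: j lt => [|[|j]] lt; last by move: lt; rewrite ?pbw_wtE; lia.
  case: i lt => [|[|i]] lt; last by move: lt; rewrite ?pbw_wtE; lia.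
    exists a', b', (a + c'); split=> //.
    by rewrite /pbw !expr0 !mulr1 scalerDl addrCA.
  exists (a + a'), b', c'; split=> //.
  by rewrite /pbw !expr0 !mulr1 scalerDl -!addrA.
case: i lt => [|i] lt; last by move: lt; rewrite ?pbw_wtE; lia.
exists a', (a + b'), c'; split.
  by rewrite /pbw !expr0 mul1r mulr1 scalerDl -!addrA [LHS]addrCA.
by move=> sQ4; move: lt; rewrite ?pbw_wtE; lia.
Qed.
Lemma fil2_scalar z : fil 2 z -> exists c, z = c *: (1 : D).
Proof.
elim=> [|a i j e {}z lt _ [c ->]]; first by exists 0; rewrite scale0r.
case: e lt => lt; first by move: lt; rewrite ?pbw_wtE; lia.
case: j lt => [|j] lt; last by move: lt; rewrite ?pbw_wtE; lia.
case: i lt => [|i] lt; last by move: lt; rewrite ?pbw_wtE; lia.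
by exists (a + c); rewrite /pbw !expr0 !mulr1 scalerDl.
Qed.

End Filtration.

(** * Leading symbols of elements of the algebra *)

Section SymbolOfElements.
Variables (C : numClosedFieldType) (Q : {poly C}) (g : C).
Local Notation P := (assoc_poly Q).
Local Notation D := (algD Q g).
Local Notation r := (size Q).-2.
Implicit Types (x y z : D) (i j k d : nat) (e : bool) (a : C) (p : {poly C}).
Hypotheses (sQ : (3 < size Q)%N) (mQ : Q \is monic).

(** The leading coefficient of c(s): with n = deg Q, the numerator grows like (-1)^n s^(2n), and the
    denominator (2 s - 1) (2 s - 3) like 4 s^2. *)
Definition kap : C := (-1) ^+ (size Q).-1 / 4.

Lemma kap_neq0 : kap != 0.
Proof. by rewrite mulf_neq0 ?signr_eq0 // invr_eq0 pnatr_eq0. Qed.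

Lemma has_top_u n c p : has_top n c p -> has_top (2 * n) (c * (-1) ^+ n)
  (p \Po - ('X * ('X - 1%:P))).
Proof.
elim/poly_ind: p n c => [|p c0 IHp] n c [sp <-].
  by rewrite coef0 mul0r comp_poly0; apply: has_top_lt; rewrite size_poly0.
rewrite comp_polyD comp_polyM comp_polyX comp_polyC.
have topX1 : has_top 1 1 ('X - 1%:P : {poly C}).
  by split; rewrite ?size_XsubC // coefB coefX coefC subr0.
have topu : has_top 2 (-1) (- ('X * ('X - 1%:P)) : {poly C}).
  by rewrite -[X in - X]mulr1; apply/has_topN/(has_topM (@has_topX C) topX1).
case: n sp => [|n] sp.
  have p0 : p = 0.
    apply/eqP; rewrite -size_poly_eq0; move: sp; rewrite size_MXaddC.
    by case: ifP => [/andP[/eqP -> _]|]; rewrite ?size_poly0 //; case: (size p).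
  rewrite p0 comp_poly0 !mul0r !add0r coefC /= mulr1; exact: has_topC.
have sp' : (size p <= n.+1)%N.
  move: sp; rewrite size_MXaddC; case: ifP => [/andP[/eqP -> _]|_] //.
  by rewrite size_poly0.
have H := has_topM (IHp n p`_n (conj sp' erefl)) topu.
rewrite coefD coefMX coefC /= addr0 exprSr mulrA mulnS addnC -[X in has_top _ X]addr0.
apply: has_topD H _; apply: has_top_lt.
by rewrite (leq_trans (size_polyC_leq1 _)) // addn2.
Qed.

Lemma symbol_u : symbol r 2 0 (- 1) (u_op C).
Proof.
have -> : -1 = (-1) *: 'X^0 :> {poly C} by rewrite expr0 scaleN1r.
apply: (@symbol_wshift _ _ 2 0 0); rewrite subrr mulr0 subr0.
have H := has_top_u (@has_topX C); rewrite comp_polyX expr1 mul1r in H.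
by apply: growth_eq (growth_poly H) => m; rewrite !hornerE.
Qed.

Lemma growth_v_coefN : growth (2 * r)%N%:Z kap (v_coefN Q g).
Proof.
have topX1 c : has_top 1 1 ('X - c%:P : {poly C}).
  by split; rewrite ?size_XsubC // coefB coefX coefC subr0.
have nz c m : 2 * (lat C m - c) != 0 -> ('X - c%:P).[lat C m] != 0.
  by rewrite mulf_eq0 negb_or hornerXsubC => /andP [].
have nz1 m : ('X - (2^-1)%:P).[lat C m] != 0.
  by apply: nz; rewrite mulrBr mulfV ?pnatr_eq0 //; exact: (half_lat_neq C m (-1)).
have nz3 m : ('X - (3 / 2)%:P).[lat C m] != 0.
  apply: nz; have -> : 2 * (lat C m - 3 / 2) = 2 * lat C m + (-3)%:~R.
    by rewrite mulrNz; field.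
  exact: half_lat_neq.
have nzs m : ('X - 1%:P).[lat C m] != 0.
  by rewrite hornerXsubC; exact: (lat_neq_int C m (-1)).
have szP : size P = (size Q).-1 by have [] := assoc_polyP Q.
have eu p m : (p \Po - ('X * ('X - 1%:P))).[lat C m] = p.[u_coef C m].
  by rewrite horner_comp !hornerE.
have HQ : growth (2 * (size Q).-1)%N%:Z ((-1) ^+ (size Q).-1) (fun m => Q.[u_coef C m]).
  have H : has_top (size Q).-1 1 Q.
    by split; [exact: leqSpred|exact: (eqP mQ)].
  have := growth_poly (has_top_u H); rewrite mul1r; apply: growth_eq => m; exact: eu.
(* Only Q(u) reaches degree 2 deg Q: the term s P(u) has degree one less, and the term in gamma
   decays. *)
have HP : growth (2 * (size Q).-1)%N%:Z 0 (fun m => lat C m * P.[u_coef C m]).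
  have H : has_top r P`_r P by split=> //; rewrite szP; lia.
  have H' := growth_poly (has_topM (@has_topX C) (has_top_u H)).
  apply: growth_eq (growth_lt _ H'); last by lia.
  by move=> m; rewrite hornerM hornerX eu.
have Hg : growth (2 * (size Q).-1)%N%:Z 0
    (fun m => g ^+ 2 / (4 * (lat C m - 1) ^+ 2)).
  have H := growthZ (g ^+ 2 / 4) (growthM (growthV (topX1 1) nzs) (growthV (topX1 1) nzs)).
  apply: growth_eq (growth_lt _ H); last by lia.
  move=> m /=; rewrite hornerXsubC; have := nzs m; rewrite hornerXsubC => n1; by field.
have H := growthZ 4^-1 (growthM (growthV (topX1 2^-1) nz1) (growthV (topX1 (3 / 2)) nz3)).
have := growthM (growthD (growthD HQ HP) Hg) H.
rewrite !addr0 !mulr1 => {}H.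
have -> : (2 * r)%N%:Z = (2 * (size Q).-1)%N%:Z + (- 1%N%:Z + - 1%N%:Z) by lia.
apply: growth_eq H => m /=; rewrite /v_coefN.
move: (nz1 m) (nz3 m); rewrite !hornerXsubC => n1 n3; rewrite -!mulrA; congr (_ * _).
have d1 : 2 * lat C m - 1 != 0 by exact: (half_lat_neq C m (-1)).
have d3 : 2 * lat C m - 3 != 0 by exact: (half_lat_neq C m (-3)).
by field; rewrite d1 d3.
Qed.

Definition vpoly : {poly C} := 'X^2 + kap%:P.
Definition wpoly : {poly C} := 'X^2 - kap%:P.

Lemma symbol_v : symbol r r%:Z 1 vpoly (v_op Q g).
Proof.
have -> : vpoly = 1 *: 'X^2 + (0 *: 'X^1 + kap *: 'X^0).
  by rewrite scale1r scale0r add0r expr0 alg_polyC.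
rewrite /v_op -addrA; apply: symbolD.
  apply: (@symbol_wshift _ _ _ 1 2 1 (fun=> 1)).
  by have -> : r%:Z - r%:Z * (2 - 1) = 0 by [lia]; exact: growthC.
apply: symbolD.
  (* The coefficient b(s) decays like s^(-2) and leaves no trace in degree r. *)
  apply: (@symbol_wshift _ _ _ 1 1 0 (v_coef0 g)).
  have top1 c : has_top 1 1 ('X - c%:P : {poly C}).
    by split; rewrite ?size_XsubC // coefB coefX coefC subr0.
  have nz m : ('X - 0%:P).[lat C m] != 0.
    by rewrite hornerXsubC subr0; have := lat_neq_int C m 0; rewrite addr0.
  have nz1 m : ('X - 1%:P).[lat C m] != 0.
    by rewrite hornerXsubC; exact: (lat_neq_int C m (-1)).
  have H := growthZ (- g / 2) (growthM (growthV (top1 0) nz) (growthV (top1 1) nz1)).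
  apply: growth_eq (growth_lt _ H); last by lia.
  move=> m /=; rewrite /v_coef0; move: (nz m) (nz1 m); rewrite !hornerXsubC subr0.
  by move=> ? ?; field; apply/andP.
apply: (@symbol_wshift _ _ _ 1 0 kap (v_coefN Q g)).
by have -> : r%:Z - r%:Z * (0 - 1) = (2 * r)%N%:Z by [lia]; exact: growth_v_coefN.
Qed.

Lemma symbol_w : symbol r r.+1%:Z 1 wpoly (w_op Q g).
Proof.
have -> : wpoly = 1 *: 'X^2 + (- kap) *: 'X^0.
  by rewrite scale1r expr0 scaleNr alg_polyC.
rewrite /w_op; apply: symbolD.
  apply: (@symbol_wshift _ _ _ 1 2 1 (lat C)).
  have -> : r.+1%:Z - r%:Z * (2 - 1) = 1%N%:Z by lia.
  by apply: growth_eq (growth_poly (@has_topX C)) => m; rewrite hornerX.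
apply: (@symbol_wshift _ _ _ 1 0 (- kap)).
have -> : r.+1%:Z - r%:Z * (0 - 1) = 1%N%:Z + (2 * r)%N%:Z by lia.
rewrite -[- kap]mulN1r; apply: (growthM _ growth_v_coefN).
have H : has_top 1 (-1) (- ('X - 1%:P) : {poly C}).
  by apply: has_topN; split; rewrite ?size_XsubC // coefB coefX coefC subr0.
by apply: growth_eq (growth_poly H) => m; rewrite hornerN hornerXsubC.
Qed.

Lemma rep_exists : exists f : D -> endo C,
  [/\ linear f, monoid_morphism f, f (uD Q g) = u_op C, f (vD Q g) = v_op Q g
    & f (wD Q g) = w_op Q g].
Proof.
pose x (i : 'I_3) := nth (w_op Q g) [:: u_op C; v_op Q g] i.
have [eL eM ex] := free_evalP x.
have [|f [fL fM fx]] := @quot_hom_exists _ (relD Q g) _ x; last first.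
  by exists f; split=> //; [exact: (fx (@Ordinal 3 0 isT))
    |exact: (fx (@Ordinal 3 1 isT))|exact: (fx (@Ordinal 3 2 isT))].
move=> s /(map_f (free_eval x)); rewrite (D_relators_morph _ _ _ _ _ eL eM) !ex.
exact: op_relations.
Qed.

Definition diff_rep : D -> endo C := projT1 (cid rep_exists).

Lemma diff_repP : [/\ linear diff_rep, monoid_morphism diff_rep,
  diff_rep (uD Q g) = u_op C, diff_rep (vD Q g) = v_op Q g
  & diff_rep (wD Q g) = w_op Q g].
Proof. by rewrite /diff_rep; case: cid. Qed.

Lemma diff_rep_linear : linear diff_rep. Proof. by have [] := diff_repP. Qed.
Lemma diff_rep1 : diff_rep 1 = 1. Proof. by have [_ []] := diff_repP. Qed.
Lemma diff_repM : {morph diff_rep : x y / x * y}.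
Proof. by have [_ []] := diff_repP. Qed.
Lemma diff_rep0 : diff_rep 0 = 0.
Proof. exact: linear_fun0 diff_rep_linear. Qed.
Lemma diff_repD : {morph diff_rep : x y / x + y}.
Proof. by move=> x y; have := diff_rep_linear 1 x y; rewrite !scale1r. Qed.
Lemma diff_repZ a x : diff_rep (a *: x) = a *: diff_rep x.
Proof. by have := diff_rep_linear a x 0; rewrite !addr0 diff_rep0 addr0. Qed.
Lemma diff_repN : {morph diff_rep : x / - x}.
Proof. by move=> x; rewrite -scaleN1r diff_repZ scaleN1r. Qed.
Lemma diff_repX n : {morph diff_rep : x / x ^+ n}.
Proof.
by move=> x; elim: n => [|n IH]; rewrite ?expr0 ?diff_rep1 // !exprS diff_repM IH.
Qed.

Definition pbw_symbol i j e : {poly C} :=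
  (-1) ^+ i * (vpoly ^+ j * wpoly ^+ e).

Lemma symbolX d J p (F : endo C) n : symbol r d%:Z J p F ->
  symbol r (d * n)%N%:Z (J * n) (p ^+ n) (F ^+ n).
Proof.
move=> H; elim: n => [|n IH].
  rewrite !muln0 !expr0 -(wshift1 C) -[1]scale1r -(expr0 'X).
  by apply: (@symbol_wshift _ _ 0 0 0); rewrite subrr mulr0 subr0; exact: growthC.
by rewrite !mulnS !exprS PoszD; exact: symbolM.
Qed.

Lemma symbol_pbw i j e : symbol r (pbw_wt Q i j e)%:Z (j + e)
  (pbw_symbol i j e) (diff_rep (pbw Q g i j e)).
Proof.
have [_ _ ru rv rw] := diff_repP.
rewrite /pbw !diff_repM !diff_repX ru rv rw /pbw_symbol mulrA.
have Hu := @symbolX 2 0 _ _ i symbol_u.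
have Hv := @symbolX r 1 _ _ j symbol_v.
have Hw := @symbolX r.+1 1 _ _ e symbol_w.
have := symbolM (symbolM Hu Hv) Hw; rewrite mul0n !mul1n add0n -!PoszD.
by rewrite /pbw_wt addn1.
Qed.

Lemma size_pbw_symbol i j e : size (pbw_symbol i j e) = (2 * (j + e)).+1.
Proof.
have sv : size vpoly = 3 by rewrite size_XnaddC.
have sw : size wpoly = 3 by rewrite size_XnsubC.
have mv : vpoly \is monic by rewrite monicXnaddC.
have mw : wpoly \is monic by rewrite monicXnsubC.
have se p n : p \is monic -> size p = 3 -> size (p ^+ n) = (2 * n).+1.
  move=> mp sp; rewrite -[LHS]prednK ?size_exp ?sp //.
  by rewrite size_poly_gt0 monic_neq0 ?monic_exp.
rewrite /pbw_symbol -signr_odd; case: (odd i); rewrite ?expr0 ?mul1r ?mulN1r ?size_polyN.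
all: rewrite size_monicM ?monic_exp ?monic_neq0 ?monic_exp //.
all: by rewrite !se //; lia.
Qed.

Lemma pbw_symbol_coef0 i j e : (pbw_symbol i j e)`_0 != 0.
Proof.
rewrite -horner_coef0 /pbw_symbol /vpoly /wpoly !hornerE /= expr0n add0r sub0r.
by rewrite !mulf_neq0 ?expf_neq0 ?oppr_eq0 ?oner_eq0 ?kap_neq0.
Qed.

(** A monomial is determined by its weight d and the extreme power k = j + e of T in its symbol: d -
    r k = 2 i + e, whose parity is e. *)
Definition wt_index d k : option (nat * nat * bool) :=
  if (r * k <= d)%N then
    let t := (d - r * k)%N in
    if odd t then if k is k'.+1 then Some (t./2, k', true) else None
    else Some (t./2, k, false)
  else None.

Lemma wt_indexP d k i j e : wt_index d k = Some (i, j, e) ->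
  pbw_wt Q i j e = d /\ (j + e)%N = k.
Proof.
rewrite /wt_index; case: leqP => // le; case: ifP => [|/negbT] od.
  case: k le od => // k le od [<- <- <-]; split; last by lia.
  by rewrite /pbw_wt; move: le od; rewrite mulnS; move: (r * k)%N => rk; lia.
case=> <- <- <-; split; last by lia.
by rewrite /pbw_wt; move: le od; move: (r * k)%N => rk; lia.
Qed.

Lemma pbw_wt_index i j e :
  wt_index (pbw_wt Q i j e) (j + e) = Some (i, j, e).
Proof.
have le : (r * (j + e) <= pbw_wt Q i j e)%N.
  by rewrite mulnDr /pbw_wt; move: (r * j)%N => rj; nia.
have E : (pbw_wt Q i j e - r * (j + e) = 2 * i + e)%N.
  by rewrite mulnDr /pbw_wt; case: e le => le; move: (r * j)%N => rj; lia.
rewrite /wt_index le E; case: e le E => le E.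
  by rewrite !addn1 mul2n /= odd_double uphalf_double.
by rewrite !addn0 mul2n odd_double doubleK.
Qed.

Definition pbw_of d k : D :=
  if wt_index d k is Some (i, j, e) then pbw Q g i j e else 0.

Lemma fil_top d z : fil d.+1 z -> exists (c : nat -> C) z',
  fil d z' /\ z = \sum_(k < d.+1) c k *: pbw_of d k + z'.
Proof.
elim=> [|a i j e {}z lt _ [c [z' [Fz' ->]]]].
  exists (fun=> 0), 0; split; first exact: fil0.
  by rewrite addr0 big1 // => k _; rewrite scale0r.
have [ltd|ged] := ltnP (pbw_wt Q i j e) d.
  exists c, (a *: pbw Q g i j e + z'); split; first exact: filS.
  by rewrite addrCA.
have E : pbw_wt Q i j e = d by lia.
have le : (j + e < d.+1)%N.
  rewrite -E /pbw_wt; move: (sQ); case: e {lt ged E}; nia.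
exists (fun k => c k + a *+ (k == j + e)%N), z'; split=> //.
rewrite addrA; congr (_ + _).
have Ei : wt_index d (j + e) = Some (i, j, e) by rewrite -E pbw_wt_index.
have -> : a *: pbw Q g i j e =
    \sum_(k < d.+1) (a *+ (k == (j + e)%N :> nat)) *: pbw_of d k.
  rewrite (bigD1 (Ordinal le)) //= eqxx /pbw_of Ei big1 ?addr0 //.
  by move=> k; rewrite -val_eqE /= => /negbTE ->; rewrite scale0r.
by rewrite -big_split /=; apply: eq_bigr => k _; rewrite scalerDl addrC.
Qed.

Lemma fil_lsymbol d J z : fil d z -> lsymbol r d%:Z J 0 (diff_rep z).
Proof.
elim=> [|a i j e {}z lt _ H]; first by rewrite diff_rep0; exact: lsymbol0.
rewrite diff_rep_linear -[0]add0r; apply: lsymbolD => //.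
rewrite -[X in lsymbol _ _ _ X](scaler0 _ a); apply: lsymbolZ.
apply: lsymbol_lt (symbol_lsymbol (symbol_pbw i j e)); lia.
Qed.

(* The monomials of degree d have symbols with pairwise distinct extreme powers
   of T, so the extreme power survives in a linear combination. *)
Lemma fil_symbol d z : fil d.+1 z -> fil d z \/ exists J p,
  [/\ lsymbol r d%:Z J p (diff_rep z), p`_0 != 0, size p = (2 * J).+1
    & (r * J <= d)%N].
Proof.
move=> /fil_top [c [z' [Fz' ->]]].
suff: forall K, fil d (\sum_(k < K) c k *: pbw_of d k) \/ exists J p,
    [/\ lsymbol r d%:Z J p (diff_rep (\sum_(k < K) c k *: pbw_of d k)),
      p`_0 != 0, size p = (2 * J).+1 & (r * J <= d)%N].
  move=> /(_ d.+1) [H|[J [p [Hp p0 sp rJ]]]]; first by left; exact: filD.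
  right; exists J, p; split=> //; rewrite diff_repD -[p]addr0.
  exact: lsymbolD (fil_lsymbol _ Fz').
elim=> [|K IH]; first by left; rewrite big_ord0; exact: fil0.
have [cK|cK] := eqVneq (c K) 0.
  by rewrite big_ord_recr /= cK scale0r addr0.
case E: (wt_index d K) => [[[i j] e]|]; last first.
  by rewrite big_ord_recr /= /pbw_of E scaler0 addr0.
have [wt jeK] := wt_indexP E.
right; exists K.
pose pk k := if wt_index d k is Some (i, j, e) then pbw_symbol i j e else 0.
have Hk k : (k <= K)%N -> lsymbol r d%:Z K ('X^(K - k) * pk k) (diff_rep (pbw_of d k)).
  move=> kK; rewrite /pk /pbw_of; case Ek: (wt_index d k) => [[[i' j'] e']|]; last first.
    by rewrite mulr0 diff_rep0; exact: lsymbol0.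
  have [wt' <-] := wt_indexP Ek.
  have := lsymbol_shift (K - (j' + e')) (symbol_lsymbol (symbol_pbw i' j' e')).
  by rewrite wt' subnKC // (wt_indexP Ek).2.
have sk k : (size (pk k) <= (2 * k).+1)%N.
  rewrite /pk; case Ek: (wt_index d k) => [[[i' j'] e']|]; last by rewrite size_poly0.
  by rewrite size_pbw_symbol (wt_indexP Ek).2.
have rep_sum (M : nat) : (M <= K.+1)%N ->
    lsymbol r d%:Z K (\sum_(k < M) c k *: ('X^(K - k) * pk k))
    (diff_rep (\sum_(k < M) c k *: pbw_of d k)).
  elim: M => [|M IHM] lt; first by rewrite !big_ord0 diff_rep0; exact: lsymbol0.
  rewrite !big_ord_recr /= diff_repD diff_repZ; apply: lsymbolD; first by apply: IHM; lia.
  exact/lsymbolZ/Hk.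
exists (\sum_(k < K.+1) c k *: ('X^(K - k) * pk k)).
have szl : (size (\sum_(k < K) c k *: ('X^(K - k) * pk k))%R <= 2 * K)%N.
  rewrite (leq_trans (size_sum _ _ _)) //; apply/bigmax_leqP => k _.
  apply: leq_trans (size_scale_leq (c k) ('X^(K - k) * pk k)) _.
  apply: leq_trans (size_polyMleq ('X^(K - k)) (pk k)) _.
  by rewrite size_polyXn; move: (sk k) (ltn_ord k); lia.
have pkK : pk K = pbw_symbol i j e by rewrite /pk E.
split.
- exact: rep_sum.
- rewrite big_ord_recr /= subnn expr0 mul1r coefD coefZ coef_sum big1 ?add0r.
    by rewrite mulf_neq0 // pkK pbw_symbol_coef0.
  move=> k _; rewrite coefZ coefXnM subn_gt0 ltn_ord mulr0 //.
- rewrite big_ord_recr /= subnn expr0 mul1r addrC size_polyDl size_scale // pkK.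
    by rewrite size_pbw_symbol jeK.
  by rewrite size_pbw_symbol jeK ltnS.
- by rewrite -wt -jeK mulnDr /pbw_wt; nia.
Qed.

Lemma symbol_exists z : z != 0 -> exists d J p,
  [/\ fil d.+1 z, lsymbol r d%:Z J p (diff_rep z), p`_0 != 0, size p = (2 * J).+1
    & (r * J <= d)%N].
Proof.
move=> z0; have [d Fz] := fil_exists sQ z.
elim: d Fz => [|d IH] Fz.
  case: Fz z0 => [|a i j e {}z lt _]; first by rewrite eqxx.
  by rewrite ltn0 in lt.
have [Fz'|[J [p [H p0 sp rJ]]]] := fil_symbol Fz; first exact: IH.
by exists d, J, p; split.
Qed.

Lemma diff_rep_inj : injective diff_rep.
Proof.
move=> x y /eqP; rewrite -subr_eq0 -diff_repN -diff_repD => /eqP xy.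
apply/eqP; rewrite -subr_eq0; apply: contraT => /symbol_exists [d [J [p [_ H p0 _ _]]]].
move: H; rewrite xy => /lsymbol_unique /(_ (lsymbol0 _ _ _ _)) p_0.
by rewrite p_0 coef0 eqxx in p0.
Qed.

End SymbolOfElements.

(** * Isomorphisms are affine *)

Section Orders.
Variable C : numFieldType.
Implicit Types (p q h : {poly C}) (t : C).

Lemma deriv_XsubC_exp t n :
  ('X - t%:P) * (('X - t%:P) ^+ n)^`() = n%:R *: ('X - t%:P) ^+ n.
Proof.
rewrite deriv_exp derivXsubC mul1r; case: n => [|n].
  by rewrite mulr0n mulr0 scale0r.
by rewrite mulrnAr -exprS scaler_nat.
Qed.

(* Orders of vanishing at t add up, minus one, and the leading coefficient is
   multiplied by (e mu - d kappa) t. *)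
Lemma bracket_order (d e : int) J K p q p1 h t (mu kappa : nat) :
  p = ('X - t%:P) ^+ mu.+1 * p1 -> q = ('X - t%:P) ^+ kappa * h ->
  exists h', bracket d e J K p q = ('X - t%:P) ^+ (kappa + mu) * h' /\
    h'.[t] = (e%:~R * mu.+1%:R - d%:~R * kappa%:R) * t * p1.[t] * h.[t].
Proof.
move=> -> ->; set x := 'X - t%:P.
pose h' := (e%:~R * mu.+1%:R - d%:~R * kappa%:R) *: ('X * p1 * h)
  + x * (e%:~R *: (h * theta_deriv J p1) - d%:~R *: (p1 * theta_deriv K h)).
exists h'; split; last first.
  rewrite /h' hornerD hornerZ !hornerM !hornerX /x hornerXsubC subrr mul0r addr0.
  by rewrite !mulrA.
have x0 : x != 0 by rewrite polyXsubC_eq0.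
apply: (mulfI x0); rewrite /bracket /theta_deriv.
have E1 := deriv_XsubC_exp t mu.+1; have E2 := deriv_XsubC_exp t kappa.
rewrite -/x in E1 E2.
have -> : x * (e%:~R *: (x ^+ kappa * h * ('X * (x ^+ mu.+1 * p1)^`() - J%:R *: (x ^+ mu.+1 * p1)))
  - d%:~R *: (x ^+ mu.+1 * p1 * ('X * (x ^+ kappa * h)^`() - K%:R *: (x ^+ kappa * h))))
  = e%:~R *: (x ^+ kappa * h
       * ('X * ((x * (x ^+ mu.+1)^`()) * p1 + x * x ^+ mu.+1 * p1^`())
          - J%:R *: (x * x ^+ mu.+1 * p1)))
  - d%:~R *: (x ^+ mu.+1 * p1
       * ('X * ((x * (x ^+ kappa)^`()) * h + x * x ^+ kappa * h^`())
          - K%:R *: (x * x ^+ kappa * h))).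
  by rewrite !derivM -!mul_polyC; ring.
rewrite E1 E2 /h' /theta_deriv !exprS !exprD -!mul_polyC !(polyCM, polyCB); ring.
Qed.

(** If p vanishes at t to order mu + 1, the i-th symbol vanishes there to order exactly i mu. By
    [bracket_order] the next leading coefficient acquires the factor (2 (mu + 1) + i (a - mu - 1)) t
    p1(t), which is nonzero because mu + 1 <= a. *)
Lemma bracket_iter_order (a J : nat) p t (e : nat -> int) (K : nat -> nat)
    (q : nat -> {poly C}) :
  p != 0 -> p.[t] = 0 -> t != 0 -> (size p <= a.+1)%N ->
  (forall i, e i = 2 + i%:Z * (a%:Z - 1)) -> q 0%N = (-1)%:P ->
  (forall i, q i.+1 = bracket a%:Z (e i) J (K i) p (q i)) -> forall i, q i != 0.
Proof.
move=> p0 pt t0 sp eE q0 qS.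
have [[|mu] [p1 p1t Ep]] := multiplicity_XsubC p t.
  rewrite p0 /= expr0 mulr1 in p1t Ep.
  by rewrite -Ep rootE pt eqxx in p1t.
rewrite p0 /= rootE mulrC in p1t Ep.
have mua : (mu.+1 <= a)%N.
  have p10 : p1 != 0 by apply: contraNneq p1t => ->; rewrite horner0.
  move: sp; rewrite Ep size_monicM ?monic_exp ?monicXsubC // size_exp_XsubC.
  by move: p10; rewrite -size_poly_gt0; case: (size p1) => [//|n] _; rewrite addnS /= !addSn; lia.
suff H i : exists h, q i = ('X - t%:P) ^+ (i * mu) * h /\ h.[t] != 0.
  move=> i; have [h [-> ht]] := H i.
  rewrite mulf_neq0 ?expf_neq0 ?polyXsubC_eq0 //.
  by apply: contraNneq ht => ->; rewrite horner0.
elim: i => [|i [h [Eq ht]]].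
  by exists (-1)%:P; rewrite mul0n expr0 mul1r hornerC oppr_eq0 oner_eq0.
have [h' [Eh' ht']] := bracket_order a%:Z (e i) J (K i) Ep Eq.
exists h'; split; first by rewrite qS Eh' mulSn addnC.
rewrite ht' !mulf_neq0 // eE -[mu.+1%:R]/(mu.+1%:Z%:~R) -[(i * mu)%:R]/((i * mu)%N%:Z%:~R).
rewrite -!intrM -intrB intr_eq0.
have -> : (2 + i%:Z * (a%:Z - 1)) * mu.+1%:Z - a%:Z * (i * mu)%N%:Z
  = (2 * mu.+1 + i * (a - mu.+1))%N%:Z.
  by rewrite !(PoszD, PoszM) -subzn //; ring.
by rewrite eqz_nat addn_eq0 muln_eq0.
Qed.

End Orders.

(** * Degree bounds for the images of u and v *)

Section Nonzero.
Variables (C : numClosedFieldType) (Q : {poly C}) (g : C).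
Hypotheses (sQ : (3 < size Q)%N) (mQ : Q \is monic).

Lemma wD_neq0 : wD Q g != 0.
Proof.
apply/eqP => w0; have [_ _ _ _ rw] := diff_repP Q g.
have := symbol_lsymbol (symbol_w g sQ mQ); rewrite -rw w0 diff_rep0.
move=> /lsymbol_unique /(_ (lsymbol0 _ _ _ _)) /(congr1 (fun p : {poly C} => p`_2)).
by rewrite /wpoly coefB coefXn coefC coef0 subr0 => /eqP; rewrite oner_eq0.
Qed.

Lemma lie_neq0 : lie (uD Q g) (vD Q g) != 0.
Proof.
have [-> _ _ _] := relD0 Q g; apply/eqP => /(congr1 ( *:%R 2^-1)).
rewrite scalerA mulVf ?pnatr_eq0 // scale1r scaler0 => w0.
by move: wD_neq0; rewrite w0 eqxx.
Qed.

End Nonzero.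

Section DegreeBounds.
Variables (C : numClosedFieldType) (Q Q' : {poly C}) (g g' : C).
Hypotheses (sQ : size Q = 4%N) (mQ : Q \is monic).
Hypotheses (sQ' : (3 < size Q')%N) (mQ' : Q' \is monic).
Variable phi : algD Q g -> algD Q' g'.
Hypothesis phiI : @alg_iso _ (relD Q g) (relD Q' g') phi.
Local Notation r := (size Q').-2.
Local Notation "''u'" := (uD Q g).
Local Notation "''v'" := (vD Q g).
Local Notation "''w'" := (wD Q g).
Implicit Types (F G : endo C) (d n : int) (p q : {poly C}) (x y : algD Q g).

Let rep x : endo C := diff_rep (phi x).

Let phiL : linear phi. Proof. by case: phiI => [[]]. Qed.
Let phi1 : phi 1 = 1. Proof. by case: phiI => [[_ []]]. Qed.
Let phiM : {morph phi : x y / x * y}. Proof. by case: phiI => [[_ []]]. Qed.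
Let phi_inj : injective phi. Proof. by case: phiI => _ /bij_inj. Qed.
Let phi0 : phi 0 = 0. Proof. exact: linear_fun0 phiL. Qed.

Let repL : linear rep. Proof. by move=> a x y; rewrite /rep phiL diff_rep_linear. Qed.
Let rep1 : rep 1 = 1. Proof. by rewrite /rep phi1 diff_rep1. Qed.
Let repM : {morph rep : x y / x * y}. Proof. by move=> x y; rewrite /rep phiM diff_repM. Qed.
Let rep0 : rep 0 = 0. Proof. exact: linear_fun0 repL. Qed.
Let repD : {morph rep : x y / x + y}.
Proof. by move=> x y; have := repL 1 x y; rewrite !scale1r. Qed.
Let repZ a x : rep (a *: x) = a *: rep x.
Proof. by have := repL a x 0; rewrite !addr0 rep0 addr0. Qed.
Let repN : {morph rep : x / - x}.
Proof. by move=> x; rewrite -scaleN1r repZ scaleN1r. Qed.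
Let rep_lie x y : rep (lie x y) = lie (rep x) (rep y).
Proof. by rewrite /lie repD repN !repM. Qed.

Local Notation U := (rep 'u).
Local Notation V := (rep 'v).
Local Notation W := (rep 'w).

Let UV : lie U V = 2 *: W.
Proof. by rewrite -rep_lie; have [-> _ _ _] := relD0 Q g; rewrite repZ. Qed.
Let UW : lie U W = - (2 *: (U * V)) + 2 *: W + g *: 1.
Proof.
rewrite -rep_lie; have [_ -> _ _] := relD0 Q g.
by rewrite !repD repN !repZ repM rep1.
Qed.

(** Degrees are doubled because a bracket with U is charged a/2, which need not be an integer. *)
Definition half_deg_le n F := exists d J p, 2 * d <= n /\ lsymbol r d J p F.

Lemma lsymbol_raise d d' J p F : d <= d' -> lsymbol r d J p F ->
  exists p', lsymbol r d' J p' F.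
Proof.
rewrite le_eqVlt => /orP [/eqP <-|lt] H; first by exists p.
by exists 0; exact: lsymbol_lt lt H.
Qed.

Lemma half_deg_leD n F G :
  half_deg_le n F -> half_deg_le n G -> half_deg_le n (F + G).
Proof.
move=> [d [J [p [dn HF]]]] [d' [J' [p' [dn' HG]]]].
pose m := Num.max d d'.
have dm : d <= m by rewrite /m le_max lexx.
have dm' : d' <= m by rewrite /m le_max lexx orbT.
have [q HF'] := lsymbol_raise dm (lsymbol_shift J' HF).
have [q' HG'] := lsymbol_raise dm' (lsymbol_shift J HG).
exists m, (J + J')%N, (q + q'); split; first by rewrite /m maxEle; case: ifP.
by apply: lsymbolD => //; rewrite addnC.
Qed.

Lemma half_deg_leZ n c F : half_deg_le n F -> half_deg_le n (c *: F).
Proof. by move=> [d [J [p [dn HF]]]]; exists d, J, (c *: p); split=> //; exact: lsymbolZ. Qed.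

Lemma half_deg_le_mono n n' F : n <= n' -> half_deg_le n F -> half_deg_le n' F.
Proof.
move=> nn [d [J [p [dn HF]]]]; exists d, J, p; split=> //; exact: le_trans dn nn.
Qed.

Lemma half_deg_leM n n' F G :
  half_deg_le n F -> half_deg_le n' G -> half_deg_le (n + n') (F * G).
Proof.
move=> [d [J [p [dn HF]]]] [d' [J' [p' [dn' HG]]]].
exists (d + d'), (J + J')%N, (p * p'); split; last exact: lsymbolM.
by rewrite mulrDr lerD.
Qed.

Lemma half_deg_le_lsymbol n d J p F :
  half_deg_le n F -> lsymbol r d J p F -> p != 0 -> 2 * d <= n.
Proof.
move=> [d' [J' [p' [dn HF]]]] Hp p0; apply: le_trans dn; rewrite ler_pM2l //.
rewrite leNgt; apply/negP => lt; move: p0.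
by rewrite (lsymbol_unique Hp (lsymbol_lt _ lt HF)) eqxx.
Qed.

Lemma half_deg_le0 n : half_deg_le n 0.
Proof.
exists (- `|n|), 0%N, 0; split; last exact: lsymbol0.
by lia.
Qed.

Section Tame.
Variable a : nat.

(* N bounds the number of brackets with U, each of which may raise the degree
   by a/2 only, where a is the degree of U. *)
Fixpoint tame N n F : Prop :=
  half_deg_le n F /\ (if N is N'.+1 then tame N' (n + a%:Z) (lie U F) else True).

Lemma tame_half_deg_le N n F : tame N n F -> half_deg_le n F.
Proof. by case: N => [|N] []. Qed.

Lemma tameD N n F G : tame N n F -> tame N n G -> tame N n (F + G).
Proof.
elim: N n F G => [|N IH] n F G /= [HF tF] [HG tG]; split=> //; try exact: half_deg_leD.
by have := IH _ _ _ tF tG; rewrite /lie mulrDl mulrDr opprD addrACA.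
Qed.

Lemma tameZ N n c F : tame N n F -> tame N n (c *: F).
Proof.
elim: N n F => [|N IH] n F /= [HF tF]; split=> //; try exact: half_deg_leZ.
by have := IH _ _ tF; rewrite /lie -scalerAl -scalerAr scalerBr.
Qed.

Lemma tame_mono N n n' F : n <= n' -> tame N n F -> tame N n' F.
Proof.
elim: N n n' F => [|N IH] n n' F nn /= [HF tF]; split=> //; try exact: half_deg_le_mono nn HF.
by apply: IH tF; rewrite lerD2r.
Qed.

Lemma tameW N n F : tame N.+1 n F -> tame N n F.
Proof.
elim: N n F => [|N IH] n F; first by case.
by case=> HF /IH.
Qed.

Lemma tameM N n n' F G : tame N n F -> tame N n' G -> tame N (n + n') (F * G).
Proof.
elim: N n n' F G => [|N IH] n n' F G.
  by move=> [HF _] [HG _]; split=> //; exact: half_deg_leM.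
move=> tF tG; have HF := tameW tF; have HG := tameW tG.
case: tF => dF tF; case: tG => dG tG; split; first exact: half_deg_leM.
have -> : lie U (F * G) = lie U F * G + F * lie U G.
  by rewrite /lie mulrBl mulrBr !mulrA addrA subrK.
apply: tameD.
  by rewrite addrAC; exact: IH.
by rewrite -addrA; exact: IH.
Qed.

Lemma tame0 N n : tame N n 0.
Proof.
elim: N n => [|N IH] n /=; split=> //; try exact: half_deg_le0.
by rewrite /lie mulr0 mul0r subrr.
Qed.

Lemma tame_scalar N n c : 0 <= n -> tame N n (c *: 1).
Proof.
case: N => [|N] n0 /=; split=> //.
- by exists 0, 0%N, c%:P; split; [rewrite mulr0|exact: lsymbol_wshift0].
- by exists 0, 0%N, c%:P; split; [rewrite mulr0|exact: lsymbol_wshift0].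
- rewrite /lie -scalerAl -scalerAr mulr1 mul1r subrr; exact: tame0.
Qed.

Hypothesis Ua : half_deg_le (2 * a%:Z) U.

Lemma tame_U N : tame N (2 * a%:Z) U.
Proof. by case: N => [|N] /=; split=> //; rewrite /lie subrr; exact: tame0. Qed.

(** The bounds m for V and m + a for W reproduce themselves: [U, V] = 2 W adds a, and the product U
    V in [U, W] adds a once more. *)
Lemma tame_VW m : half_deg_le m V -> half_deg_le (m + a%:Z) W -> 0 <= m ->
  forall N, tame N m V /\ tame N (m + a%:Z) W.
Proof.
move=> HV HW m0; elim=> [|N [IHV IHW]]; first by [].
split; split=> //; first by rewrite UV; exact: tameZ.
rewrite UW -scaleNr; apply: tameD; first apply: tameD.
- apply: tameZ; have -> : m + a%:Z + a%:Z = 2 * a%:Z + m by ring.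
  exact: tameM (tame_U N) IHV.
- by apply: tameZ; apply: tame_mono IHW; lia.
- by apply: tame_scalar; lia.
Qed.

(** The generators suffice because tameness is multiplicative by the Leibniz rule ([tameM]). The
    bound n is uniform in the number N of brackets. *)
Lemma tame_all m : half_deg_le m V -> half_deg_le (m + a%:Z) W -> 0 <= m ->
  forall x, exists n, forall N, tame N n (rep x).
Proof.
move=> HV HW m0; have VW := tame_VW HV HW m0.
elim/algD_ind => [||c x y [n Hx] [n' Hy]|x [n Hx]|x [n Hx]|x [n Hx]].
- by exists 0 => N; rewrite rep0; exact: tame0.
- by exists 0 => N; rewrite rep1 -[1]scale1r; exact: tame_scalar.
- exists (Num.max n n') => N; rewrite repL; apply: tameD.
    by apply: tameZ; apply: tame_mono (Hx N); rewrite le_max lexx.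
  by apply: tame_mono (Hy N); rewrite le_max lexx orbT.
- by exists (2 * a%:Z + n) => N; rewrite repM; exact: tameM (tame_U N) (Hx N).
- by exists (m + n) => N; rewrite repM; exact: tameM (VW N).1 (Hx N).
- by exists (m + a%:Z + n) => N; rewrite repM; exact: tameM (VW N).2 (Hx N).
Qed.

Lemma tame_iter N n F i : tame (i + N) n F ->
  tame N (n + i%:Z * a%:Z) (iter i (lie U) F).
Proof.
elim: i n F => [|i IH] n F; first by rewrite mul0r addr0.
rewrite addSn iterSr => -[_ /IH]; congr tame; lia.
Qed.

(* Brackets with U raise the degree by a - 1 > a/2 as long as the symbol does
   not vanish. *)
Lemma tame_nilpotent n F (e : int) (q : nat -> {poly C}) (K : nat -> nat) :
  (2 < a)%N -> (forall N, tame N n F) ->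
  (forall i, lsymbol r (e + i%:Z * (a%:Z - 1)) (K i) (q i) (iter i (lie U) F)) ->
  exists i, q i = 0.
Proof.
(* A nonzero i-th symbol would give 2 (e + i (a - 1)) <= n + i a, that is i (a - 2) <= n - 2 e,
   which fails for this i. *)
move=> a2 tF Hq; pose m := n - 2 * e; pose i := (absz m).+1.
exists i; apply/eqP; apply: contraT => qi0.
have := half_deg_le_lsymbol (tame_half_deg_le (@tame_iter 0 n F i _)) (Hq i) qi0.
rewrite addn0 => /(_ (tF _)); rewrite /i /m; nia.
Qed.

End Tame.

Let rep_neq0 x : x != 0 -> phi x != 0.
Proof. by apply: contraNneq => E; apply/eqP/phi_inj; rewrite E phi0. Qed.

Lemma fil3_of_u : fil 3 (phi 'u).
Proof.
have u0 : 'u != 0.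
  apply/eqP => u0; have := @lie_neq0 C Q g; rewrite sQ mQ => /(_ isT isT).
  by rewrite u0 /lie mulr0 mul0r subrr eqxx.
have [a [J [p [Fa Hp p0 sp rJ]]]] := symbol_exists sQ' mQ' (rep_neq0 u0).
have [a3|a3] := ltnP a 3; first exact: fil_mono Fa.
exfalso.
have bd x : exists n : nat, half_deg_le n%:Z (rep x).
  have [d Fx] := fil_exists sQ' (phi x).
  exists (2 * d)%N, d%:Z, 0%N, 0; split; first by rewrite PoszM.
  exact: fil_lsymbol.
have [n HV] := bd 'v; have [n' HW] := bd 'w.
have Ua : half_deg_le (2 * a%:Z) U by exists a%:Z, J, p; split.
have tm (z : algD Q' g') : exists n, forall N, tame a N n (diff_rep z).
  have [_ [psi _ psiK]] := phiI; rewrite -[z]psiK.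
  (* Any m that bounds both degrees serves, since only the growth per bracket matters. *)
  apply: (tame_all Ua (m := (n + n')%N)); last by [].
    by apply: half_deg_le_mono HV; lia.
  by apply: half_deg_le_mono HW; lia.
have step (e : int) K q F i : lsymbol r (e + i%:Z * (a%:Z - 1)) K q F ->
    lsymbol r (e + i.+1%:Z * (a%:Z - 1)) (J + K)
      (bracket a%:Z (e + i%:Z * (a%:Z - 1)) J K p q) (lie U F).
  move=> /(lsymbol_lie Hp); congr lsymbol; rewrite intS; ring.
(* Symbols of the iterated brackets with U: each step adds a - 1 to the degree and J to the extreme
   power of T. *)
pose qs e K q := fix qs i := if i is i'.+1
  then bracket a%:Z (e + i'%:Z * (a%:Z - 1)) J (i' * J + K) p (qs i') else q : {poly C}.
have qsP (e : int) K q (z : algD Q' g') : lsymbol r e K q (diff_rep z) -> forall i,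
    lsymbol r (e + i%:Z * (a%:Z - 1)) (i * J + K) (qs e K q i) (iter i (lie U) (diff_rep z)).
  move=> Hq; elim=> [|i IH]; first by rewrite mul0r addr0 mul0n.
  by rewrite iterS mulSn -addnA; exact: step.
have [_ _ ru rv _] := diff_repP Q' g'.
case: (posnP J) => [J0|J_gt0].
  (* p is constant, so bracketing with it only rescales the coefficients of the
     symbol of v. *)
  have Hv := symbol_lsymbol (symbol_v g' sQ' mQ'); rewrite -rv in Hv.
  have [n1 tv] := tm (vD Q' g').
  have [i qi0] := tame_nilpotent a3 tv (qsP _ _ _ _ Hv).
  have pC : p = (p`_0)%:P by apply: size1_polyC; rewrite sp J0.
  suff qi2 : (qs r%:Z 1%N (vpoly Q') i)`_2 = (- (a%:R * p`_0)) ^+ i.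
    move/eqP: qi2; rewrite qi0 coef0 eq_sym expf_eq0 oppr_eq0.
    rewrite mulf_eq0 pnatr_eq0 (negbTE p0) orbF.
    by rewrite eqn0Ngt (ltn_trans _ a3) // andbF.
  elim: i {qi0} => [|i IHi].
    by rewrite /= /vpoly coefD coefXn coefC addr0 expr0.
  rewrite /= exprS -IHi J0 muln0 add0n pC /bracket /theta_deriv derivC mulr0.
  rewrite scale0r subrr mulr0 scaler0 sub0r coefN coefZ coefCM coefB coefZ coefXM.
  by rewrite coef_deriv coefC /=; ring.
(* At a root of p the order of vanishing of the symbols obtained from u can be
   followed exactly. *)
have [t pt] : exists t, root p t.
  by apply/closed_rootP; rewrite sp; case: (J) J_gt0.
have Hu := symbol_lsymbol (symbol_u Q'); rewrite -ru in Hu.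
have [n1 tu] := tm (uD Q' g').
have [i qi0] := tame_nilpotent a3 tu (qsP _ _ _ _ Hu).
have pn0 : p != 0 by apply: contraNneq p0 => ->; rewrite coef0.
(* Each bracket multiplies the leading coefficient at t by t, so t must not be 0. *)
have tn0 : t != 0.
  by apply: contraNneq p0 => t0; rewrite -horner_coef0; move: pt; rewrite t0.
have spa : (size p <= a.+1)%N by rewrite sp; nia.
have := @bracket_iter_order C a J p t (fun i => 2 + i%:Z * (a%:Z - 1))
  (fun i => i * J + 0)%N (qs 2 0%N (- 1)) pn0 (eqP pt) tn0 spa.
move=> /(_ (fun=> erefl) _ (fun=> erefl) i); rewrite qi0 eqxx polyCN => H.
by have := H erefl.
Qed.

Lemma half_deg_lt n F d J : half_deg_le n F -> n < 2 * d -> lsymbol r d J 0 F.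
Proof.
by move=> [d' [J' [p [dn HF]]]] lt; apply: lsymbol_lt HF; lia.
Qed.

Lemma half_deg_eval_u p (n : nat) : half_deg_le 4 U -> (size p <= n.+1)%N ->
  half_deg_le (4 * n)%N%:Z (rep (eval_u Q g p)).
Proof.
move=> HU; elim/poly_ind: p n => [|p c IH] n sp.
  by rewrite eval_u0 rep0; exact: half_deg_le0.
have Hc : half_deg_le (4 * n)%N%:Z (c *: 1).
  by exists 0, 0%N, c%:P; split; [rewrite mulr0|exact: lsymbol_wshift0].
rewrite eval_uMXaddC repD repZ rep1 repM; apply: half_deg_leD => //.
have [->|p0] := eqVneq p 0.
  by rewrite eval_u0 rep0 mulr0; exact: half_deg_le0.
move: sp; rewrite size_MXaddC (negbTE p0) /= ltnS.
case: n {Hc} => [|n] sp; first by rewrite leqn0 size_poly_eq0 (negbTE p0) in sp.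
by rewrite mulnS PoszD; apply: half_deg_leM => //; exact: IH.
Qed.

(** Were the degree smaller, phi u would be a scalar and commute with phi v, although [u, v] is
    nonzero. The bound on J comes from r J <= 2 and r >= 2. *)
Lemma symbol_of_u : exists J p, [/\ lsymbol r 2 J p U, p`_0 != 0,
  size p = (2 * J).+1 & (J <= 1)%N].
Proof.
have [F2|[J [p [Hp p0 sp rJ]]]] := fil_symbol sQ' mQ' fil3_of_u; last first.
  by exists J, p; split=> //; move: rJ; nia.
have [c Ec] := fil2_scalar sQ' F2.
have lQ := lie_neq0 g (_ : (3 < size Q)%N) mQ; rewrite sQ in lQ.
case/eqP: (lQ isT); apply: phi_inj; rewrite phi0.
apply: (@diff_rep_inj _ Q' g') => //; rewrite diff_rep0 -/(rep _) rep_lie /lie.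
have -> : U = c *: 1 by rewrite /rep Ec diff_repZ diff_rep1.
by rewrite -scalerAl -scalerAr mul1r mulr1 subrr.
Qed.

(** If V had degree b >= 3, only u v^2 and w^2 could reach degree 2 b + 2 in the last relation, so
    their symbols would cancel. The symbol Z of W is half the bracket of those of U and V, which
    makes the cancellation a differential equation for q. *)
Lemma fil3_of_v : fil 3 (phi 'v).
Proof.
have lQ := lie_neq0 g (_ : (3 < size Q)%N) mQ; rewrite sQ in lQ; have {}lQ := lQ isT.
have v0 : 'v != 0.
  by apply: contraNneq lQ => ->; rewrite /lie mulr0 mul0r subrr.
have [b [K [q [Fb Hq q0 sq rK]]]] := symbol_exists sQ' mQ' (rep_neq0 v0).
have [b3|b3] := ltnP b 3; first exact: fil_mono Fb.
exfalso; have [J [p [Hp p0 sp J1]]] := symbol_of_u.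
pose Z := 2^-1 *: bracket 2 b%:Z J K p q.
have HW : lsymbol r (b%:Z + 1) (J + K) Z W.
  have -> : W = 2^-1 *: lie U V.
    by rewrite UV scalerA mulVf ?pnatr_eq0 // scale1r.
  by apply: lsymbolZ; have := lsymbol_lie Hp Hq; congr lsymbol; lia.
(* The top symbol of Q(u) + u v^2 + w^2 - 2 w v - gamma v. *)
have E : 'X^J * (p * q ^+ 2) + Z ^+ 2 = 0.
  have HU : half_deg_le 4 U by exists 2, J, p.
  have d2 : (b%:Z + 1) + (b%:Z + 1) = 2 + (b%:Z + b%:Z) by lia.
  have H1 : lsymbol r (2 + (b%:Z + b%:Z)) (J + (K + K) + J) ('X^J * (p * q ^+ 2)) (U * V ^+ 2).
    by apply: lsymbol_shift; rewrite !expr2; apply: lsymbolM => //; exact: lsymbolM.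
  have H2 : lsymbol r (2 + (b%:Z + b%:Z)) (J + (K + K) + J) (Z ^+ 2) (W ^+ 2).
    have := lsymbolM HW HW; rewrite -d2 !expr2; congr lsymbol; lia.
  have H0 : lsymbol r (2 + (b%:Z + b%:Z)) (J + (K + K) + J) 0 (rep (eval_u Q g Q)).
    have := @half_deg_eval_u Q 3 HU; rewrite sQ => /(_ isT) /half_deg_lt; apply; lia.
  have H3 : lsymbol r (2 + (b%:Z + b%:Z)) (J + (K + K) + J) 0 (2 *: (W * V)).
    rewrite -(scaler0 _ 2); apply: lsymbolZ; apply: lsymbol_lt (lsymbolM HW Hq); lia.
  have H4 : lsymbol r (2 + (b%:Z + b%:Z)) (J + (K + K) + J) 0 (g *: V).
    rewrite -(scaler0 _ g); apply: lsymbolZ; apply: lsymbol_lt Hq; lia.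
  have := lsymbolB (lsymbolB (lsymbolD (lsymbolD H0 H1) H2) H3) H4.
  have [_ _ _ /(congr1 rep)] := relD0 Q g.
  rewrite rep0 !(repD, repN, repM, repZ) !expr2 ?repM => ->.
  by rewrite add0r !subr0 => /lsymbol_unique /(_ (lsymbol0 _ _ _ _)).
have E0 := congr1 (fun p : {poly C} => p`_0) E.
have E1 := congr1 (fun p : {poly C} => p`_1) E.
have DZ : Z = 2^-1 *: bracket 2 b%:Z J K p q by [].
(* For J = 1, X divides Z, so X^2 divides Z^2, while the coefficient of X in X p q^2 is nonzero. *)
move: DZ E E0 E1; clear HW Hp; move: Z => Z; case: J J1 sp Z => [|[|//]] _ sp Z DZ E; last first.
  rewrite expr1 !coefD !coefXM coef0 /= add0r expr2 coef0M => /eqP.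
  rewrite mulf_eq0 orbb => /eqP Z0; rewrite coef0M [(Z * Z)`_1]coefM !big_ord_recl big_ord0 /= Z0.
  rewrite mul0r mulr0 !addr0 coef0 expr2 coef0M => /eqP.
  by rewrite !mulf_eq0 (negbTE p0) (negbTE q0).
(* For J = 0 the symbol of U is c s^2. Then Z is - c times T d/dT of the symbol of V, and the
   relation becomes q^2 + c th^2 = 0. *)
move=> _ _; pose c := p`_0; have pC : p = c%:P by apply: size1_polyC; rewrite sp.
pose th := theta_deriv K q.
have thE i : th`_i = (i%:R - K%:R) * q`_i.
  rewrite /th /theta_deriv coefB coefZ coefXM coef_deriv; case: i => [|i] /=; first by ring.
  by rewrite -mulr_natr; ring.
have ZE : Z = (- c) *: th.
  rewrite DZ pC /bracket -/th /theta_deriv derivC mulr0 scale0r subrr mulr0 scaler0.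
  by rewrite sub0r mul_polyC -!scaleNr !scalerA; congr (_ *: _); field.
have {}E : q ^+ 2 + c *: th ^+ 2 = 0.
  apply: (mulfI (_ : c%:P != 0)); first by rewrite polyC_eq0.
  rewrite mulr0 -[RHS]E ZE pC expr0 -!mul_polyC polyCN; ring.
have := congr1 (fun p : {poly C} => p`_0) E.
rewrite coef0 coefD coefZ !expr2 !coef0M thE sub0r => E0.
have cK : c * K%:R ^+ 2 = -1.
  apply/eqP; rewrite -subr_eq0 opprK; have : q`_0 ^+ 2 * (c * K%:R ^+ 2 + 1) == 0.
    by rewrite -[X in _ == X]E0; apply/eqP; ring.
  by rewrite mulf_eq0 expf_eq0 (negbTE q0).
have K0 : K%:R != 0 :> C.
  by apply: contra_eq_neq cK => ->; rewrite expr0n mulr0 eq_sym oppr_eq0 oner_eq0.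
(* As c K^2 = -1, the relation reads th^2 = K^2 q^2, so th = K q or th = - K q. But T d/dT
   multiplies the lowest coefficient of q by - K and the highest by K, and both are nonzero. *)
have : (th - K%:R *: q) * (th + K%:R *: q) == 0.
  have -> : (th - K%:R *: q) * (th + K%:R *: q) = (- K%:R ^+ 2) *: (q ^+ 2 + c *: th ^+ 2)
     + (c * K%:R ^+ 2 + 1) *: th ^+ 2.
    by rewrite -!mul_polyC !(polyCD, polyCM, polyCN); ring.
  by rewrite E cK addNr scaler0 scale0r addr0.
have q2K : q`_(2 * K) != 0.
  by have := lead_coef_eq0 q; rewrite lead_coefE sq /= => ->; rewrite -size_poly_eq0 sq.
rewrite mulf_eq0 => /orP [] /eqP.
  move=> /(congr1 (fun p : {poly C} => p`_0)).
  rewrite coefB coefZ thE coef0 sub0r => H.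
  have : 2 * (K%:R * q`_0) == 0 by rewrite -oppr_eq0 -[X in _ == X]H; apply/eqP; ring.
  by rewrite !mulf_eq0 (negbTE K0) (negbTE q0) pnatr_eq0.
move=> /(congr1 (fun p : {poly C} => p`_(2 * K))).
rewrite coefD coefZ thE coef0 natrM => H.
have : 2 * (K%:R * q`_(2 * K)) == 0 by rewrite -[X in _ == X]H; apply/eqP; ring.
by rewrite !mulf_eq0 (negbTE K0) (negbTE q2K) pnatr_eq0.
Qed.

(** When deg Q' > 3 the elements of weight at most 2 are affine in u alone, so phi u and phi v would
    commute. *)
Lemma iso_affine : size Q' = 4%N /\ exists a b c a' b' c',
  phi 'u = a *: uD Q' g' + b *: vD Q' g' + c *: (1 : algD Q' g') /\
  phi 'v = a' *: uD Q' g' + b' *: vD Q' g' + c' *: (1 : algD Q' g').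
Proof.
have [a [b [c [Eu b0]]]] := fil3_span sQ' fil3_of_u.
have [a' [b' [c' [Ev b'0]]]] := fil3_span sQ' fil3_of_v.
split; last by exists a, b, c, a', b', c'.
apply/eqP; apply: contraT => sQ4.
have lQ := lie_neq0 g (_ : (3 < size Q)%N) mQ; rewrite sQ in lQ.
case/eqP: (lQ isT); apply: phi_inj; rewrite phi0.
apply: (diff_rep_inj sQ' mQ'); rewrite diff_rep0 -/(rep _) rep_lie /lie.
have EU : U = a *: diff_rep (uD Q' g') + c *: 1.
  by rewrite /rep Eu (b0 sQ4) scale0r addr0 diff_repD !diff_repZ diff_rep1.
have EV : V = a' *: diff_rep (uD Q' g') + c' *: 1.
  by rewrite /rep Ev (b'0 sQ4) scale0r addr0 diff_repD !diff_repZ diff_rep1.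
rewrite EU EV; move: (diff_rep _) => x.
rewrite !mulrDl !mulrDr -!scalerAl -!scalerAr !mulr1 !mul1r !scalerA.
rewrite [a' * a]mulrC [c' * c]mulrC [a' * c]mulrC [c' * a]mulrC.
by rewrite addrACA subrr.
Qed.

End DegreeBounds.

(** * Noncommutative normal forms and existence of the maps *)

Section NoncommutativeNormalForms.
Variable K : fieldType.

(* Noncommutative polynomials in three letters 0, 1, 2 standing for u, v, w,
   with symbolic coefficients, so that normal forms are computed by evaluation. *)
Inductive coef := Var of nat | Nat of nat | Add of coef & coef | Mul of coef & coef
  | Opp of coef.
Definition ncpoly := seq (coef * seq nat).

Definition nc_scale (c : coef) (p : ncpoly) : ncpoly :=
  [seq (Mul c t.1, t.2) | t <- p].
Definition nc_mul (p q : ncpoly) : ncpoly :=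
  flatten [seq [seq (Mul t.1 s.1, t.2 ++ s.2) | s <- q] | t <- p].

Definition one_ := Nat 1.
Definition two_ := Nat 2.
Definition mtwo_ := Opp (Nat 2).
Definition mone_ := Opp (Nat 1).

(* Variables 0, 1, 2, 3 are the parameters A, B, C and gamma of the algebra. *)
Definition rule_vu : ncpoly := [:: (one_, [:: 0; 1]); (mtwo_, [:: 2])]%N.
Definition rule_wu : ncpoly := [:: (one_, [:: 0; 2]); (two_, [:: 0; 1]);
  (mtwo_, [:: 2]); (Opp (Var 3), [::])]%N.
Definition rule_wv : ncpoly := [:: (one_, [:: 1; 2]); (mone_, [:: 1; 1]);
  (Opp (Nat 3), [:: 0; 0]); (Opp (Add (Nat 8) (Mul (Nat 2) (Var 0))), [:: 0]);
  (Opp (Add (Add (Nat 8) (Mul (Nat 2) (Var 0))) (Var 1)), [::])]%N.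
Definition rule_ww : ncpoly := [:: (mone_, [:: 0; 0; 0]); (Opp (Var 0), [:: 0; 0]);
  (Opp (Var 1), [:: 0]); (Opp (Var 2), [::]); (mone_, [:: 0; 1; 1]);
  (two_, [:: 2; 1]); (Var 3, [:: 1])]%N.

(** Rewrites the leftmost reducible pair. The irreducible words in the three letters are u^i v^j w^e
    with e at most 1. *)
Fixpoint reduce (s : seq nat) : option ncpoly :=
  match s with
  | [::] => None
  | x :: s' =>
    let rest := omap (map (fun t : coef * seq nat => (t.1, x :: t.2))) (reduce s') in
    if s' is y :: s'' then
      let app := map (fun t : coef * seq nat => (t.1, t.2 ++ s'')) in
      match x, y with
      | 1, 0 => Some (app rule_vu)
      | 2, 0 => Some (app rule_wu)
      | 2, 1 => Some (app rule_wv)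
      | 2, 2 => Some (app rule_ww)
      | _, _ => rest
      end
    else rest
  end%N.

(** When the fuel runs out the word is returned unchanged and keeps its value, so correctness
    requires no termination argument. *)
Fixpoint normal_word (fuel : nat) (s : seq nat) : ncpoly :=
  if fuel is n.+1 then
    if reduce s is Some p then
      flatten [seq nc_scale t.1 (normal_word n t.2) | t <- p]
    else [:: (one_, s)]
  else [:: (one_, s)].

Fixpoint insert_term (c : coef) (s : seq nat) (p : ncpoly) : ncpoly :=
  if p is (c', s') :: p' then
    if s == s' then (Add c c', s) :: p' else (c', s') :: insert_term c s p'
  else [:: (c, s)].

Definition collect (p : ncpoly) : ncpoly :=
  foldr (fun t => insert_term t.1 t.2) [::] p.

Definition normal_form (p : ncpoly) : ncpoly :=
  collect (flatten [seq nc_scale t.1 (normal_word 30 t.2) | t <- p]).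

Variable env : seq K.

Fixpoint coef_eval (c : coef) : K :=
  match c with
  | Var i => env`_i
  | Nat n => n%:R
  | Add c d => coef_eval c + coef_eval d
  | Mul c d => coef_eval c * coef_eval d
  | Opp c => - coef_eval c
  end.

Variable A : algType K.
Variable gens : nat -> A.

Fixpoint word_eval (s : seq nat) : A :=
  if s is x :: s' then gens x * word_eval s' else 1.

Fixpoint nc_eval (p : ncpoly) : A :=
  if p is t :: p' then coef_eval t.1 *: word_eval t.2 + nc_eval p' else 0.

Lemma word_eval_cat s t : word_eval (s ++ t) = word_eval s * word_eval t.
Proof. by elim: s => [|x s IH] /=; rewrite ?mul1r // IH mulrA. Qed.

Lemma nc_eval_cat p q : nc_eval (p ++ q) = nc_eval p + nc_eval q.
Proof. by elim: p => [|t p IH] /=; rewrite ?add0r // IH addrA. Qed.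

Lemma nc_eval_scale c p : nc_eval (nc_scale c p) = coef_eval c *: nc_eval p.
Proof. by elim: p => [|t p IH] /=; rewrite ?scaler0 // IH scalerDr scalerA. Qed.

Lemma nc_eval_mul p q : nc_eval (nc_mul p q) = nc_eval p * nc_eval q.
Proof.
have ZM c d (x y : A) : (c *: x) * (d *: y) = (c * d) *: (x * y).
  by rewrite -scalerAl -scalerAr scalerA.
elim: p => [|t p IH] /=; first by rewrite mul0r.
rewrite nc_eval_cat IH mulrDl; congr (_ + _).
elim: q {IH} => [|s q IH] /=; first by rewrite mulr0.
by rewrite IH mulrDr word_eval_cat ZM.
Qed.

Lemma nc_eval_prefix x p :
  nc_eval (map (fun t : coef * seq nat => (t.1, x :: t.2)) p) = gens x * nc_eval p.
Proof. by elim: p => [|t p IH] /=; rewrite ?mulr0 // IH mulrDr scalerAr. Qed.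

Lemma nc_eval_suffix s p :
  nc_eval (map (fun t : coef * seq nat => (t.1, t.2 ++ s)) p) = nc_eval p * word_eval s.
Proof.
by elim: p => [|t p IH] /=; rewrite ?mul0r // IH mulrDl word_eval_cat scalerAl.
Qed.

Hypotheses (Hvu : gens 1 * gens 0 = nc_eval rule_vu)
  (Hwu : gens 2 * gens 0 = nc_eval rule_wu)
  (Hwv : gens 2 * gens 1 = nc_eval rule_wv)
  (Hww : gens 2 * gens 2 = nc_eval rule_ww).

Lemma nc_eval_reduce s p : reduce s = Some p -> nc_eval p = word_eval s.
Proof.
elim: s p => [//|x s IH] p.
have rest : omap (map (fun t : coef * seq nat => (t.1, x :: t.2))) (reduce s) = Some p ->
    nc_eval p = word_eval (x :: s).
  case: (reduce s) IH => [q|] //= IH [<-].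
  by rewrite nc_eval_prefix (IH q).
rewrite [reduce _]/=; case: s IH rest => [|y s] IH rest; first exact: rest.
case: x rest => [|[|[|x]]] rest; try exact: rest.
  case: y IH rest => [|y] IH rest; last exact: rest.
  by case=> <-; rewrite [LHS](nc_eval_suffix s rule_vu) -Hvu -mulrA.
case: y IH rest => [|[|[|y]]] IH rest; last exact: rest.
- by case=> <-; rewrite [LHS](nc_eval_suffix s rule_wu) -Hwu -mulrA.
- by case=> <-; rewrite [LHS](nc_eval_suffix s rule_wv) -Hwv -mulrA.
- by case=> <-; rewrite [LHS](nc_eval_suffix s rule_ww) -Hww -mulrA.
Qed.

Lemma nc_eval_flatten (f : seq nat -> ncpoly) p :
  (forall s, nc_eval (f s) = word_eval s) ->
  nc_eval (flatten [seq nc_scale t.1 (f t.2) | t <- p]) = nc_eval p.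
Proof.
by move=> H; elim: p => [//|t p IH] /=; rewrite nc_eval_cat nc_eval_scale H IH.
Qed.

Lemma nc_eval_normal_word n s : nc_eval (normal_word n s) = word_eval s.
Proof.
have base t : nc_eval [:: (one_, t)] = word_eval t by rewrite /= scale1r addr0.
elim: n s => [|n IH] s; first exact: base.
rewrite [normal_word _ _]/=; case E: (reduce s) => [p|]; last exact: base.
by rewrite (nc_eval_flatten p IH) (nc_eval_reduce E).
Qed.

Lemma nc_eval_insert c s p :
  nc_eval (insert_term c s p) = coef_eval c *: word_eval s + nc_eval p.
Proof.
elim: p => [|[c' s'] p IH] //=; case: eqP => [->|_] /=; last by rewrite IH addrCA.
by rewrite scalerDl addrA.
Qed.

Lemma nc_eval_normal_form p : nc_eval (normal_form p) = nc_eval p.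
Proof.
rewrite /normal_form -[RHS](nc_eval_flatten p (nc_eval_normal_word 30)).
by elim: (flatten _) => [//|t q IH] /=; rewrite nc_eval_insert IH.
Qed.

Fixpoint coefs_vanish (p : ncpoly) : Prop :=
  if p is t :: p' then coef_eval t.1 = 0 /\ coefs_vanish p' else True.

(** Reduces an identity in the algebra to finitely many identities between scalars. *)
Lemma nc_eval_eq0 p : coefs_vanish (normal_form p) -> nc_eval p = 0.
Proof.
rewrite -nc_eval_normal_form; elim: (normal_form p) => [//|t q IH] /= [-> /IH ->].
by rewrite scale0r addr0.
Qed.

Definition nc_coef (p : ncpoly) (s : seq nat) : coef :=
  foldr (fun t c => if t.2 == s then Add t.1 c else c) (Nat 0) p.

Lemma nc_eval_coefs (l : seq (seq nat)) p :
  uniq l -> all (fun t : coef * seq nat => t.2 \in l) p ->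
  nc_eval p = \sum_(s <- l) coef_eval (nc_coef p s) *: word_eval s.
Proof.
move=> ul; elim: p => [_|t p IH /= /andP [tl /IH ->]].
  by rewrite big1 // => s _; rewrite /= scale0r.
rewrite (bigD1_seq t.2) //= [RHS](bigD1_seq t.2) //= eqxx /= scalerDl addrA.
by congr (_ + _); apply: eq_bigr => s /negbTE; rewrite eq_sym => ->.
Qed.

End NoncommutativeNormalForms.

(** * Relations of cubic algebras and the order 3 substitution *)

Section Cubic.
Variables (K : fieldType) (A : algType K).
Implicit Types (a b c g io : K) (u v w : A).

Definition cubic_relations a b c g u v w : Prop :=
  [/\ lie u v = 2 *: w,
      lie u w = - (2 *: (u * v)) + 2 *: w + g *: 1,
      lie v w = v ^+ 2 + (3 *: u ^+ 2 + (8 + 2 * a) *: u + (8 + 2 * a + b) *: 1) &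
      u ^+ 3 + a *: u ^+ 2 + b *: u + c *: 1 + u * v ^+ 2 + w ^+ 2
        - 2 *: (w * v) - g *: v = 0].

(** For io = i these are the parameters of the target of [Psi], for io = - i those of the target of
    [PsiV]; a single computation with io^2 = -1 treats both. *)
Definition rotB io a b g := 6 * (a ^+ 2 / 16 - 1) + 3 * io * g / 2 - b / 2.
Definition rotC io a b c g := c - a * (b / 4 - io * g / 4 + 1 - a ^+ 2 / 16).
Definition rotg io a b g := io * (2 * (1 - a ^+ 2 / 16) + b / 2 + io * g / 2).
Definition rotu io a u v : A := - ((io / 2) *: v) - 2^-1 *: u - (1 + a / 4) *: 1.
Definition rotv io a u v : A :=
  - (2^-1 *: v) - (3 * io / 2) *: u - (io * (1 + a / 4)) *: 1.

Definition gens3 u v w (i : nat) : A := nth w [:: u; v] i.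

Section Rules.
Variables (a b c g : K) (u v w : A) (e : seq K).
Hypothesis H : cubic_relations a b c g u v w.
Local Notation ev := (nc_eval [:: a, b, c, g & e] (gens3 u v w)).

Lemma cubic_vu : v * u = ev rule_vu.
Proof.
have [E _ _ _] := H; rewrite /rule_vu /= !mulr1 addr0 scale1r scaleNr -E /lie.
by rewrite subKr.
Qed.

Lemma cubic_wu : w * u = ev rule_wu.
Proof.
have [_ E _ _] := H; rewrite /rule_wu /= !mulr1 addr0 scale1r !scaleNr.
rewrite -[w * u](subKr (u * w)) -/(lie u w) E.
by rewrite !opprD opprK -!addrA.
Qed.

Lemma cubic_wv : w * v = ev rule_wv.
Proof.
have [_ _ E _] := H; rewrite /rule_wv /= !mulr1 addr0 !scaleNr !scale1r.
rewrite -[w * v](subKr (v * w)) -/(lie v w) E.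
by rewrite !opprD -!addrA !expr2.
Qed.

Lemma cubic_ww : w * w = ev rule_ww.
Proof.
have [_ _ _ /eqP] := H; rewrite subr_eq add0r subr_eq => /eqP E.
rewrite -expr2 -[w ^+ 2](addKr (u ^+ 3 + a *: u ^+ 2 + b *: u + c *: 1 + u * v ^+ 2)).
rewrite E /rule_ww /= !mulr1 addr0 !scaleNr !scale1r !exprS expr0 !mulr1 !opprD -!addrA.
by congr (_ + _); congr (_ + _); congr (_ + _); congr (_ + _); congr (_ + _); rewrite addrC.
Qed.

End Rules.
End Cubic.

Section Rotation.
Variables (K : numFieldType) (A : algType K).
Implicit Types (a b c g io : K) (u v w : A).

Definition rotu_nc : ncpoly := [:: (Opp (Mul (Var 4) (Var 5)), [:: 1]);
  (Opp (Var 5), [:: 0]);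
  (Opp (Add (Nat 1) (Mul (Var 0) (Mul (Var 5) (Var 5)))), [::])]%N.
Definition rotv_nc : ncpoly := [:: (Opp (Var 5), [:: 1]);
  (Opp (Mul (Nat 3) (Mul (Var 4) (Var 5))), [:: 0]);
  (Opp (Mul (Var 4) (Add (Nat 1) (Mul (Var 0) (Mul (Var 5) (Var 5))))), [::])]%N.
Definition w_nc : ncpoly := [:: (one_, [:: 2])]%N.

Ltac nc_normalize :=
  apply: nc_eval_eq0; [exact: cubic_vu|exact: cubic_wu|exact: cubic_wv|exact: cubic_ww|];
  match goal with |- coefs_vanish _ (normal_form ?p) =>
    let t := eval vm_compute in (normal_form p) in
    change (normal_form p) with t
  end.

(** Here u, v, w belong to the target of the map. The parameters of the source arise from those of
    the target by the opposite rotation, hence the sign of io. *)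
Lemma rot_relations a b c g io u v w : io ^+ 2 = -1 ->
  cubic_relations a b c g u v w ->
  cubic_relations a (rotB (- io) a b g) (rotC (- io) a b c g) (rotg (- io) a b g)
    (rotu io a u v) (rotv io a u v) w.
Proof.
move=> io2 H.
(* The values of variables 4 to 8. Since [coef] has no division, 1/2 is a variable and 1/4 is its
   square. *)
pose e := [:: io; 2^-1; rotB (- io) a b g; rotC (- io) a b c g; rotg (- io) a b g].
pose ev := nc_eval [:: a, b, c, g & e] (gens3 u v w).
have h2 : 1 + a / 4 = 1 + a * (2^-1 * 2^-1) by field.
have EU : rotu io a u v = ev rotu_nc.
  by rewrite /ev /rotu h2 /= !mulr1 addr0 !scaleNr -addrA.
have EV : rotv io a u v = ev rotv_nc.
  by rewrite /ev /rotv h2 /= !mulr1 addr0 !scaleNr -addrA -mulrA.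
have EW : w = ev w_nc by rewrite /ev /= mulr1 addr0 scale1r.
have evM p q : ev p * ev q = ev (nc_mul p q) by rewrite /ev nc_eval_mul.
have evD p q : ev p + ev q = ev (p ++ q) by rewrite /ev nc_eval_cat.
have evZ k p : coef_eval [:: a, b, c, g & e] k *: ev p = ev (nc_scale k p).
  by rewrite /ev nc_eval_scale.
have evN p : - ev p = ev (nc_scale mone_ p) by rewrite -evZ /= scaleN1r.
have evA k : coef_eval [:: a, b, c, g & e] k *: 1 = ev [:: (k, [::])].
  by rewrite /ev /= addr0.
have ev_eq p : ev p = 0 -> forall x y, x - y = ev p -> x = y.
  by move=> -> x y /eqP; rewrite subr_eq0 => /eqP.
pose E := (evM, evD, evN, evZ, evA).
rewrite EU EV {1}EW; split.
(* The difference of the two sides is rewritten as a value of [ev] first; this determines p, which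
   is then normalized. *)
- apply: ev_eq; last first.
    by rewrite /lie -[2]/(coef_eval [:: a, b, c, g & e] two_) !E; reflexivity.
  by nc_normalize; rewrite /=; do ![split=> //]; field: io2.
- apply: ev_eq; last first.
    rewrite /lie -[2]/(coef_eval [:: a, b, c, g & e] two_).
    rewrite -[rotg _ _ _ _]/(coef_eval [:: a, b, c, g & e] (Var 8)) !E; reflexivity.
  by nc_normalize; rewrite /= /rotg; do ![split=> //]; field: io2.
- apply: ev_eq; last first.
    rewrite /lie expr2 expr2 -[3]/(coef_eval [:: a, b, c, g & e] (Nat 3)).
    rewrite -[8 + 2 * a + _]/(coef_eval [:: a, b, c, g & e]
      (Add (Add (Nat 8) (Mul (Nat 2) (Var 0))) (Var 6))).
    rewrite -[8 + 2 * a]/(coef_eval [:: a, b, c, g & e]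
      (Add (Nat 8) (Mul (Nat 2) (Var 0)))) !E; reflexivity.
  by nc_normalize; rewrite /= /rotB; do ![split=> //]; field: io2.
- apply: ev_eq; last first.
    rewrite subr0 !exprS expr0 !mulr1.
    rewrite -[2]/(coef_eval [:: a, b, c, g & e] two_).
    rewrite -[rotg _ _ _ _]/(coef_eval [:: a, b, c, g & e] (Var 8)).
    rewrite -[rotB _ _ _ _]/(coef_eval [:: a, b, c, g & e] (Var 6)).
    rewrite -[rotC _ _ _ _ _]/(coef_eval [:: a, b, c, g & e] (Var 7)).
    rewrite -[a in a *: _]/(coef_eval [:: a, b, c, g & e] (Var 0)).
    rewrite !E; reflexivity.
  by nc_normalize; rewrite /= /rotB /rotC /rotg; do ![split=> //]; field: io2.
Qed.

End Rotation.

Section CubicAlgebra.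
Variable C : numClosedFieldType.
Implicit Types (a b c g io eta : C).

Lemma cubicE a b c : cubic a b c = 'X^3 + (a *: 'X^2 + b *: 'X + c%:P).
Proof. by rewrite /cubic !addrA. Qed.

Lemma size_cubic_tail a b c : (size (a *: 'X^2 + b *: 'X + c%:P)%R < 4)%N.
Proof.
rewrite ltnS; apply/leq_sizeP => j j3.
rewrite !coefD !coefZ coefXn coefX coefC.
by case: j j3 => [|[|[|j]]] //= _; rewrite !mulr0 !addr0.
Qed.

Lemma size_cubic a b c : size (cubic a b c) = 4%N.
Proof. by rewrite cubicE size_polyDl size_polyXn // size_cubic_tail. Qed.

Lemma cubic_monic a b c : cubic a b c \is monic.
Proof.
by rewrite monicE cubicE lead_coefDl ?lead_coefXn // size_polyXn size_cubic_tail.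
Qed.

Lemma monic_size4 (Q : {poly C}) : Q \is monic -> size Q = 4%N ->
  exists a b c, Q = cubic a b c.
Proof.
move=> mQ sQ; exists Q`_2, Q`_1, Q`_0; apply/polyP => j.
rewrite /cubic !coefD !coefZ !coefXn coefX coefC.
case: j => [|[|[|[|j]]]] /=; rewrite ?(mulr0, mulr1, addr0, add0r) //.
  by have := monicP mQ; rewrite lead_coefE sQ.
by rewrite nth_default // sQ.
Qed.

Lemma cubic_inj a b c a' b' c' :
  cubic a b c = cubic a' b' c' -> [/\ a = a', b = b' & c = c'].
Proof.
move=> E; have coefE i : (cubic a b c)`_i = (cubic a' b' c')`_i by rewrite E.
move: (coefE 2) (coefE 1%N) (coefE 0%N); rewrite /cubic !coefD !coefZ !coefXn !coefX !coefC /=.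
by rewrite !(mulr0, mulr1, addr0, add0r).
Qed.

Lemma assoc_poly_cubic a b c :
  assoc_poly (cubic a b c) = 3 *: 'X^2 + (8 + 2 * a) *: 'X + (8 + 2 * a + b)%:P.
Proof.
apply: assoc_poly_unique (assoc_polyP _) _; split.
  rewrite size_cubic -addrA size_polyDl size_scale ?pnatr_eq0 ?size_polyXn //.
  rewrite ltnS; apply/leq_sizeP => j j3; rewrite coefD coefZ coefX coefC.
  by case: j j3 => [|[|j]] //= _; rewrite mulr0 addr0.
rewrite /cubic !(comp_polyD, comp_polyZ, comp_polyC, comp_polyX, comp_Xn_poly).
rewrite -!mul_polyC !(polyC_natr, polyCD, polyCM); ring.
Qed.

Lemma cubic_relationsP (A : algType C) a b c g (u v w : A) :
  cubic_relations a b c g u v w <->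
  forall z, z \in D_relators (cubic a b c) g u v w -> z = 0.
Proof.
have hX n : horner_alg u 'X^n = u ^+ n by rewrite rmorphXn /= horner_algX.
have hZ k p : horner_alg u (k *: p) = k *: horner_alg u p.
  by rewrite -mul_polyC rmorphM /= horner_algC -scalerAl mul1r.
have EQ : horner_alg u (cubic a b c) = u ^+ 3 + a *: u ^+ 2 + b *: u + c *: 1.
  by rewrite /cubic !rmorphD /= horner_algC !hZ horner_algX !hX.
have EP : horner_alg u (assoc_poly (cubic a b c))
   = 3 *: u ^+ 2 + (8 + 2 * a) *: u + (8 + 2 * a + b) *: 1.
  rewrite assoc_poly_cubic; move: (8 + 2 * a + b) => k; move: (8 + 2 * a) => l.
  by rewrite !rmorphD /= horner_algC !hZ horner_algX !hX.
rewrite /D_relators EQ EP; split.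
  case=> E1 E2 E3 E4 z; rewrite !inE => /or4P [] /eqP -> //.
  - by rewrite E1 subrr.
  - by rewrite E2 subrr.
  - by rewrite E3 subrr.
move=> H; split.
- by apply/eqP; rewrite -subr_eq0; apply/eqP/H; rewrite !inE eqxx.
- by apply/eqP; rewrite -subr_eq0; apply/eqP/H; rewrite !inE eqxx ?orbT.
- by apply/eqP; rewrite -subr_eq0; apply/eqP/H; rewrite !inE eqxx ?orbT.
- by apply: H; rewrite !inE eqxx ?orbT.
Qed.

Lemma cubic_relations_sign (A : algType C) a b c g eta (u v w : A) :
  eta ^+ 2 = 1 -> cubic_relations a b c g u v w ->
  cubic_relations a b c (eta * g) u (eta *: v) (eta *: w).
Proof.
move=> e2 [E1 E2 E3 E4]; split.
- rewrite /lie -scalerAl -scalerAr -scalerBr -/(lie u v) E1.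
  by rewrite !scalerA mulrC.
- rewrite /lie -scalerAl -!scalerAr -scalerBr -/(lie u w) E2.
  by rewrite !scalerDr scalerN !scalerA ![eta * 2]mulrC.
- rewrite /lie expr2 -!scalerAl -!scalerAr !scalerA -scalerBr -/(lie v w) E3.
  by rewrite -expr2 e2 !scale1r.
- rewrite !expr2 -!scalerAl -!scalerAr !scalerA [eta * g * eta]mulrAC -!expr2.
  by rewrite e2 !scale1r !mul1r -mulrA -expr2 e2 mulr1.
Qed.

(** The relations yield the parameters of the source from those of the target, while the maps are
    listed by their source. This and the next two lemmas pass from one description to the other. *)
Lemma rotBK io a b g : io ^+ 2 = -1 ->
  rotB io a (rotB (- io) a b g) (rotg (- io) a b g) = b.
Proof. by move=> io2; rewrite /rotB /rotg; field: io2. Qed.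

Lemma rotgK io a b g : io ^+ 2 = -1 ->
  rotg io a (rotB (- io) a b g) (rotg (- io) a b g) = g.
Proof. by move=> io2; rewrite /rotB /rotg; field: io2. Qed.

Lemma rotCK io a b c g : io ^+ 2 = -1 ->
  rotC io a (rotB (- io) a b g) (rotC (- io) a b c g) (rotg (- io) a b g) = c.
Proof. by move=> io2; rewrite /rotB /rotC /rotg; field: io2. Qed.

Lemma rep_cubic a b c g : cubic_relations a b c g
  (diff_rep (uD (cubic a b c) g)) (diff_rep (vD (cubic a b c) g))
  (diff_rep (wD (cubic a b c) g)).
Proof.
have [_ _ -> -> ->] := diff_repP (cubic a b c) g.
by apply/cubic_relationsP; exact: op_relations.
Qed.

(** The relations are checked on difference operators and brought back by the faithfulness of the
    representation. *)
Lemma homD_is_hom Q g a b c g' (x y z : algD (cubic a b c) g') :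
  (forall s, s \in D_relators Q g (diff_rep x) (diff_rep y) (diff_rep z) -> s = 0) ->
  is_hom_of_gens (fun i : 'I_3 => nth z [:: x; y] i)
    (homD x y z : algD Q g -> algD (cubic a b c) g').
Proof.
move=> H; apply: hom_of_gensP => s Ss.
have sQ' : (3 < size (cubic a b c))%N by rewrite size_cubic.
apply: (diff_rep_inj sQ' (cubic_monic a b c)); rewrite diff_rep0.
set t := free_eval _.
have [eL eM ex] := free_evalP (fun i => quot_repr ((fun i : 'I_3 => nth z [:: x; y] i) i)).
rewrite -/t in eL eM ex; have [e1 eMM] := eM.
pose e s := diff_rep (to_quot (relD (cubic a b c) g') (t s)).
have pL := to_quot_linear (relD (cubic a b c) g').
have [p1 pM] := to_quot_monoid_morphism (relD (cubic a b c) g').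
have fL : linear e by move=> k p q; rewrite /e eL pL diff_rep_linear.
have fM : monoid_morphism e.
  by split=> [|p q]; rewrite /e ?e1 ?p1 ?diff_rep1 // eMM pM diff_repM.
have fx i : e (gen_var C i) = diff_rep (nth z [:: x; y] i).
  by rewrite /e ex to_quotK.
apply: H; rewrite -(fx (@Ordinal 3 0 isT)) -(fx (@Ordinal 3 1 isT)).
rewrite -(fx (@Ordinal 3 2 isT)) -(D_relators_morph _ _ _ _ _ fL fM).
exact: (map_f e Ss).
Qed.

End CubicAlgebra.

(** * The quadratic system *)

Section Solve.
Variable C : numClosedFieldType.

Section Independence.
Variables (Q : {poly C}) (g : C).
Hypotheses (sQ : size Q = 4%N) (mQ : Q \is monic).
Local Notation u := (diff_rep (uD Q g)).
Local Notation v := (diff_rep (vD Q g)).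
Local Notation w := (diff_rep (wD Q g)).

(** Read off degree by degree: u^2, u v and v^2 have degree 4, w has degree 3, u and v have degree
    2, and within each degree the symbols are independent Laurent polynomials in T. *)
Lemma quadratic_indep (c1 c2 c3 c4 c5 c6 c7 : C) :
  c1 *: 1 + (c2 *: u + (c3 *: v + (c4 *: w + (c5 *: (u * u) + (c6 *: (u * v)
    + c7 *: (v * v)))))) = 0 ->
  [/\ c1 = 0, c2 = 0, c3 = 0 & c4 = 0] /\ [/\ c5 = 0, c6 = 0 & c7 = 0].
Proof.
have sQ' : (3 < size Q)%N by rewrite sQ.
have [_ _ ru rv rw] := diff_repP Q g.
have Hu : lsymbol 2 2 0 (-1) u.
  by have := symbol_lsymbol (symbol_u Q); rewrite sQ -ru.
have Hv : lsymbol 2 2 1 (vpoly Q) v.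
  by have := symbol_lsymbol (symbol_v g sQ' mQ); rewrite -rv sQ.
have Hw : lsymbol 2 3 1 (wpoly Q) w.
  by have := symbol_lsymbol (symbol_w g sQ' mQ); rewrite -rw sQ.
have zero d e J p (F : endo C) k : d < e -> lsymbol 2 d J p F ->
    forall K, lsymbol 2 e K 0 (k *: F).
  by move=> de HF K; rewrite -(scaler0 _ k); apply: lsymbolZ; exact: lsymbol_lt HF.
have H1 e K k : 0 < e -> lsymbol 2 e K 0 (k *: (1 : endo C)).
  by move=> e0; apply: zero e0 _ _; rewrite -[1]scale1r; exact: lsymbol_wshift0.
have uniq0 d J p : lsymbol 2 d J p (0 : endo C) -> p = 0.
  by move=> H; exact: lsymbol_unique H (lsymbol0 _ _ _ _).
move=> E.
have /uniq0 E4 : lsymbol 2 4 2 (0 + (0 + (0 + (0 + (c5 *: ('X^2 * ((-1) * (-1)))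
    + (c6 *: ('X^1 * (-1 * vpoly Q)) + c7 *: (vpoly Q * vpoly Q))))))) (0 : endo C).
  rewrite -E; apply: lsymbolD; first exact: H1.
  apply: lsymbolD; first exact: zero Hu _.
  apply: lsymbolD; first exact: zero Hv _.
  apply: lsymbolD; first exact: zero Hw _.
  apply: lsymbolD; first exact: lsymbolZ (lsymbol_shift 2 (lsymbolM Hu Hu)).
  apply: lsymbolD; first exact: lsymbolZ (lsymbol_shift 1 (lsymbolM Hu Hv)).
  exact: lsymbolZ (lsymbolM Hv Hv).
pose Z0 := (mulr0, mul0r, mulr1, mulrN1, addr0, add0r, subr0, sub0r, oppr0).
pose CE := (coefD, coefB, coefN, coefZ, coefXn, coefX, coefC).
have {}E4 : c7 *: 'X^4 - c6 *: 'X^3 + (c5 + 2 * kap Q * c7) *: 'X^2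
    - (c6 * kap Q) *: 'X + (c7 * kap Q ^+ 2)%:P = 0.
  rewrite -[RHS]E4 /vpoly -!mul_polyC !(polyC_natr, polyCD, polyCM, polyC_exp); ring.
have c7_0 : c7 = 0.
  have := congr1 (fun p : {poly C} => p`_4) E4; rewrite /= !CE /=.
  by rewrite !Z0.
have c6_0 : c6 = 0.
  have := congr1 (fun p : {poly C} => p`_3) E4; rewrite /= !CE /=.
  by rewrite !Z0 => /eqP; rewrite oppr_eq0 => /eqP.
have c5_0 : c5 = 0.
  have := congr1 (fun p : {poly C} => p`_2) E4; rewrite /= !CE /= c7_0.
  by rewrite !Z0.
split=> //; move: E; rewrite c5_0 c6_0 c7_0 !scale0r !addr0 => E.
have c4_0 : c4 = 0.
  have /uniq0 E3 : lsymbol 2 3 1 (0 + (0 + (0 + c4 *: wpoly Q))) (0 : endo C).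
    rewrite -E; apply: lsymbolD; first exact: H1.
    apply: lsymbolD; first exact: zero Hu _.
    by apply: lsymbolD; [exact: zero Hv _|exact: lsymbolZ].
  have := congr1 (fun p : {poly C} => p`_2) E3; rewrite /= /wpoly !add0r !CE /=.
  by rewrite !Z0.
move: E; rewrite c4_0 !scale0r !addr0 => E.
have /uniq0 E2 : lsymbol 2 2 1 (0 + (c2 *: ('X^1 * -1) + c3 *: vpoly Q)) (0 : endo C).
  rewrite -E; apply: lsymbolD; first exact: H1.
  by apply: lsymbolD; apply: lsymbolZ => //; exact: lsymbol_shift Hu.
have c3_0 : c3 = 0.
  have := congr1 (fun p : {poly C} => p`_2) E2; rewrite /= /vpoly mulrN1 !CE /=.
  by rewrite !Z0.
have c2_0 : c2 = 0.
  have := congr1 (fun p : {poly C} => p`_1) E2; rewrite /= /vpoly mulrN1 c3_0 !CE /=.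
  by rewrite !Z0 => /eqP; rewrite oppr_eq0 => /eqP.
split=> //; move: E; rewrite c2_0 c3_0 !scale0r !addr0 => /eqP.
by rewrite scaler_eq0 oner_eq0 orbF => /eqP.
Qed.

End Independence.

Definition quadratic_words : seq (seq nat) :=
  [:: [::]; [:: 0]; [:: 1]; [:: 2]; [:: 0; 0]; [:: 0; 1]; [:: 1; 1]]%N.

(** Coefficients may be compared only on the words of [quadratic_indep]. The words u w and v w also
    occur, but in a commutator with a multiple of w their coefficients cancel formally. *)
Lemma nc_eval_quadratic (a b c g : C) (e : seq C) (p : ncpoly) :
  let env := [:: a, b, c, g & e] in
  all (fun t : coef * seq nat => t.2 \in quadratic_words ++ [:: [:: 0; 2]; [:: 1; 2]]%N)
    (normal_form p) ->
  coef_eval env (nc_coef (normal_form p) [:: 0; 2]%N) = 0 ->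
  coef_eval env (nc_coef (normal_form p) [:: 1; 2]%N) = 0 ->
  nc_eval env (gens3 (diff_rep (uD (cubic a b c) g))
    (diff_rep (vD (cubic a b c) g)) (diff_rep (wD (cubic a b c) g))) p = 0 ->
  forall s, s \in quadratic_words -> coef_eval env (nc_coef (normal_form p) s) = 0.
Proof.
move=> env Hp Huw Hvw; have H := rep_cubic a b c g.
rewrite -nc_eval_normal_form; [|exact: cubic_vu|exact: cubic_wu|exact: cubic_wv
  |exact: cubic_ww].
rewrite (nc_eval_coefs _ _ _ Hp) // !big_cons big_nil.
rewrite Huw Hvw !scale0r !addr0 /= !mulr1.
move=> /(quadratic_indep (size_cubic a b c) (cubic_monic a b c)).
case=> -[E1 E2 E3 E4] [E5 E6 E7] s; rewrite !inE.
by do 6?[case/orP => [/eqP -> //|]]; move=> /eqP ->.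
Qed.

(* The equations satisfied by the coefficients of an affine substitution
   u -> al u + be v + de, v -> al' u + be' v + de' between cubic algebras. *)
Lemma quadratic_system (a b g as_ bs gs al be de al' be' de' : C) :
  let D := al * be' - be * al' in
  D != 0 ->
  D * be + 2 * be * be' = 0 ->
  3 * D * be + 2 * al * al' = 0 ->
  - D * al + al * be' + be * al' = 0 ->
  be * de' + de * be' = 0 ->
  D * be * (8 + 2 * a) + 2 * (al * de' + de * al') = 0 ->
  D * al * g + D * be * (8 + 2 * a + b) + 2 * de * de' - gs = 0 ->
  D * be' - be' ^+ 2 - 3 * be ^+ 2 = 0 ->
  3 * D * be' - al' ^+ 2 - 3 * al ^+ 2 = 0 ->
  D * be' * (8 + 2 * a) - 2 * al' * de' - 6 * al * de - (8 + 2 * as_) * al = 0 ->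
  D * al' * g + D * be' * (8 + 2 * a + b) - de' ^+ 2 - 3 * de ^+ 2
    - (8 + 2 * as_) * de - (8 + 2 * as_ + bs) = 0 ->
  [/\ [/\ al = 1, be = 0 & de = 0], [/\ al' = 0, be' ^+ 2 = 1 & de' = 0]
    & [/\ as_ = a, bs = b & gs = be' * g]] \/
  exists io eta, [/\ io ^+ 2 = -1, eta ^+ 2 = 1,
    [/\ al = - 2^-1, be = - (io / 2) & de = - (1 + a / 4)],
    [/\ al' = eta * - (3 * io / 2), be' = eta * - 2^-1
      & de' = eta * - (io * (1 + a / 4))]
    & [/\ as_ = a, bs = rotB (- io) a b g & gs = eta * rotg (- io) a b g]].
Proof.
(* [Uvv] is the coefficient of v v in the relation for [U, W], [Vvv] that in the relation for
   [V, W], and so on; [U1] and [V1] are the constant terms. *)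
move=> D Dn0 Uvv Uuu Uuv Uv Uu U1 Vvv Vuu Vu V1.
have n2 : (2 : C) != 0 by rewrite pnatr_eq0.
have cancel (k x y : C) : k != 0 -> k * (x - y) = 0 -> x = y.
  by move=> k0 /eqP; rewrite mulf_eq0 (negbTE k0) subr_eq0 => /eqP.
have eq0 (k x : C) : k != 0 -> k * x = 0 -> x = 0.
  by move=> k0 /eqP; rewrite mulf_eq0 (negbTE k0) => /eqP.
have DE : D = al * be' - be * al' by [].
move: (D) DE Dn0 Uvv Uuu Uuv Uu U1 Vvv Vuu Vu V1 => {}D DE Dn0 Uvv Uuu Uuv Uu U1 Vvv Vuu Vu V1.
have [be0|be0] := eqVneq be 0.
  left; rewrite {}be0 in DE Uvv Uuu Uuv Uv Uu U1 Vvv Vuu Vu V1 *.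
  rewrite mul0r subr0 in DE.
  have [al0 be'0] : al != 0 /\ be' != 0.
    by move: Dn0; rewrite DE mulf_eq0 negb_or => /andP [].
  have al1 : al = 1.
    by apply: (cancel (- al * be')); rewrite ?mulf_neq0 ?oppr_eq0 // -[RHS]Uuv DE; ring.
  subst al; rewrite mul1r in DE; subst D.
  have al'0 : al' = 0 by apply: (eq0 2) => //; rewrite -[RHS]Uuu; ring.
  have de0 : de = 0 by apply: (eq0 be') => //; rewrite -[RHS]Uv; ring.
  have de'0 : de' = 0.
    by apply: (eq0 2) => //; rewrite -[RHS]Uu al'0; ring.
  subst al' de de'.
  have be'2 : be' ^+ 2 = 1.
    by apply: (cancel 3); rewrite ?pnatr_eq0 // -[RHS]Vuu; ring.
  have asE : as_ = a.
    by apply: (cancel (- 2)); rewrite ?oppr_eq0 // -[RHS]Vu; ring: be'2.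
  split; split=> //.
  - by apply: (cancel (-1)); rewrite ?oppr_eq0 ?oner_eq0 // -[RHS]V1 asE; ring: be'2.
  - by apply: (cancel (-1)); rewrite ?oppr_eq0 ?oner_eq0 // -[RHS]U1; ring.
right.
have DE2 : D = - 2 * be' by apply: (cancel be) => //; rewrite -[RHS]Uvv; ring.
rewrite {}DE2 in DE Dn0 Uuu Uuv Uu U1 Vvv Vuu Vu V1 *; have be'0 : be' != 0.
  by apply: contraNneq Dn0 => ->; rewrite mulr0.
have E1 : be * al' = - 3 * al * be'.
  by apply: (cancel 1); rewrite ?oner_eq0 // -[RHS]Uuv; ring.
(* With D = - 2 be' and [E1], the definition of D becomes 4 al be' = - 2 be'. *)
have alE : al = - 2^-1.
  apply: (cancel (4 * be')); first by rewrite mulf_neq0 ?pnatr_eq0.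
  have -> : 4 * be' * (al - - 2^-1) = (al * be' - - 3 * al * be') + 2 * be' by field.
  by rewrite -E1 -DE; ring.
subst al.
have al'E : al' = - 6 * be * be'.
  by apply: (cancel (-1)); rewrite ?oppr_eq0 ?oner_eq0 // -[RHS]Uuu; field.
have be2 : be ^+ 2 = - 4^-1.
  apply: (cancel (- 6 * be')); first by rewrite mulf_neq0 ?oppr_eq0 ?pnatr_eq0.
  have -> : - 6 * be' * (be ^+ 2 - - 4^-1) = be * al' - - 3 * - 2^-1 * be'.
    by rewrite al'E; field.
  by rewrite E1 subrr.
have be'2 : be' ^+ 2 = 4^-1.
  apply: (cancel (- 3)); first by rewrite oppr_eq0 pnatr_eq0.
  have -> : - 3 * (be' ^+ 2 - 4^-1) = - 2 * be' * be' - be' ^+ 2 - 3 * be ^+ 2.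
    by rewrite be2; field.
  exact: Vvv.
(* From be^2 = -1/4 and be'^2 = 1/4, these rescalings are a square root of -1 and a sign. *)
have [io beE] : exists io, be = - (io / 2) by exists (- 2 * be); field.
have [eta be'E] : exists eta, be' = eta * - 2^-1 by exists (- 2 * be'); field.
have io2 : io ^+ 2 = -1.
  by apply: (mulfI (_ : 4^-1 != 0)); rewrite ?invr_eq0 ?pnatr_eq0 // mulrN1 -[RHS]be2 beE; field.
have eta2 : eta ^+ 2 = 1.
  by apply: (mulfI (_ : 4^-1 != 0)); rewrite ?invr_eq0 ?pnatr_eq0 // mulr1 -[RHS]be'2 be'E; field.
rewrite {}beE {}be'E {Dn0} in be0 be'0 al'E Uv Uu U1 Vu V1 *; exists io, eta.
have de'E : de' = eta * io * de.
  by apply: (cancel _ _ _ be0); rewrite -[RHS]Uv; field: io2.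
have deE : de = - (1 + a / 4).
  have io0 : io != 0 by apply: contraNneq be0 => ->; rewrite mul0r oppr0.
  have eta0 : eta != 0 by apply: contraNneq be'0 => ->; rewrite mul0r.
  apply: (cancel (- 4 * eta * io)); first by rewrite !mulf_neq0 ?oppr_eq0 ?pnatr_eq0.
  by rewrite -[RHS]Uu de'E al'E; field.
have asE : as_ = a.
  apply: (cancel 1); rewrite ?oner_eq0 // -[RHS]Vu de'E deE al'E.
  by field: io2 eta2.
split=> //.
  by split=> //; [rewrite al'E; field|rewrite de'E deE; ring].
split=> //; rewrite /rotB /rotg.
- apply: (cancel (-1)); rewrite ?oppr_eq0 ?oner_eq0 // -[RHS]V1 de'E deE al'E asE.
  by field: io2 eta2.
- apply: (cancel (-1)); rewrite ?oppr_eq0 ?oner_eq0 // -[RHS]U1 de'E deE.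
  by field: io2 eta2.
Qed.

(** Variables 4 to 9 are the coefficients of U and V, variable 10 is the factor of w in W, and
    variables 11, 12, 13 are the parameters gamma, A, B of the relations that U, V, W satisfy. *)
Definition affine_u_nc : ncpoly :=
  [:: (Var 4, [:: 0]); (Var 5, [:: 1]); (Var 6, [::])]%N.
Definition affine_v_nc : ncpoly :=
  [:: (Var 7, [:: 0]); (Var 8, [:: 1]); (Var 9, [::])]%N.
Definition scaled_w_nc : ncpoly := [:: (Var 10, [:: 2])]%N.

Definition affine_uw_nc : ncpoly :=
  nc_mul affine_u_nc scaled_w_nc ++ nc_scale mone_ (nc_mul scaled_w_nc affine_u_nc)
  ++ nc_scale two_ (nc_mul affine_u_nc affine_v_nc)
  ++ nc_scale mtwo_ scaled_w_nc ++ nc_scale mone_ [:: (Var 11, [::])].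
Definition affine_vw_nc : ncpoly :=
  nc_mul affine_v_nc scaled_w_nc ++ nc_scale mone_ (nc_mul scaled_w_nc affine_v_nc)
  ++ nc_scale mone_ (nc_mul affine_v_nc affine_v_nc)
  ++ nc_scale (Opp (Nat 3)) (nc_mul affine_u_nc affine_u_nc)
  ++ nc_scale (Opp (Add (Nat 8) (Mul (Nat 2) (Var 12)))) affine_u_nc
  ++ nc_scale mone_ [:: (Add (Add (Nat 8) (Mul (Nat 2) (Var 12))) (Var 13), [::])].

Section Equations.
Variables a b c g as_ bs cs gs al be de al' be' de' : C.
Local Notation u := (diff_rep (uD (cubic a b c) g)).
Local Notation v := (diff_rep (vD (cubic a b c) g)).
Local Notation w := (diff_rep (wD (cubic a b c) g)).
Variables (U V W : endo C).
Hypotheses (EU : U = al *: u + be *: v + de *: 1)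
  (EV : V = al' *: u + be' *: v + de' *: 1).
Local Notation Dl := (al * be' - be * al').

Local Notation env := [:: a; b; c; g; al; be; de; al'; be'; de'; Dl; gs; as_; bs].
Local Notation ev := (nc_eval env (gens3 u v w)).

Let ev_u : ev affine_u_nc = U.
Proof. by rewrite EU /= !mulr1 addr0 addrA. Qed.
Let ev_v : ev affine_v_nc = V.
Proof. by rewrite EV /= !mulr1 addr0 addrA. Qed.
Let ev_w : ev scaled_w_nc = Dl *: w.
Proof. by rewrite /= mulr1 addr0. Qed.
Let ev_1 k : ev [:: (k, [::])] = coef_eval env k *: 1.
Proof. by rewrite /= addr0. Qed.

Lemma affine_lie : lie U V = 2 *: W -> W = Dl *: w.
Proof.
have H := rep_cubic a b c g.
have -> : lie U V = 2 *: (Dl *: w).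
  have := @nc_eval_eq0 _ env _ (gens3 u v w) (cubic_vu _ H) (cubic_wu _ H)
    (cubic_wv _ H) (cubic_ww _ H) (nc_mul affine_u_nc affine_v_nc
    ++ nc_scale mone_ (nc_mul affine_v_nc affine_u_nc) ++ nc_scale mtwo_ scaled_w_nc).
  rewrite !(nc_eval_cat, nc_eval_mul, nc_eval_scale) ev_u ev_v ev_w /=.
  rewrite scaleN1r scaleNr => H0; apply/eqP; rewrite -subr_eq0 /lie -addrA; apply/eqP.
  by apply: H0; do ![split=> //]; ring.
move=> /(congr1 ( *:%R 2^-1)).
by rewrite !scalerA mulrA mulVf ?pnatr_eq0 // mul1r scale1r.
Qed.

Hypothesis H : cubic_relations as_ bs cs gs U V (Dl *: w).

Let uw0 s : s \in quadratic_words ->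
  coef_eval env (nc_coef (normal_form affine_uw_nc) s) = 0.
Proof.
apply: nc_eval_quadratic; [by vm_compute|by cbn; ring|by cbn; ring|].
rewrite /affine_uw_nc !(nc_eval_cat, nc_eval_mul, nc_eval_scale) ev_u ev_v ev_w ev_1 /=.
have [_ E _ _] := H; rewrite !scaleN1r scaleNr addrA -/(lie U _) E.
have -> : 2 *: (U * V) + (- (2 *: (Dl *: w)) - gs *: 1)
    = - (- (2 *: (U * V)) + 2 *: (Dl *: w) + gs *: 1).
  by rewrite !opprD opprK addrA.
exact: subrr.
Qed.

Let vw0 s : s \in quadratic_words ->
  coef_eval env (nc_coef (normal_form affine_vw_nc) s) = 0.
Proof.
apply: nc_eval_quadratic; [by vm_compute|by cbn; ring|by cbn; ring|].
rewrite /affine_vw_nc !(nc_eval_cat, nc_eval_mul, nc_eval_scale) ev_u ev_v ev_w ev_1 /=.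
have [_ _ E _] := H; rewrite !scaleN1r !scaleNr addrA -/(lie V _) E -!expr2.
by rewrite -!opprD -[3 *: U ^+ 2 + _ + _]addrA subrr.
Qed.

Lemma affine_solve : Dl != 0 ->
  [/\ [/\ al = 1, be = 0 & de = 0], [/\ al' = 0, be' ^+ 2 = 1 & de' = 0]
    & [/\ as_ = a, bs = b & gs = be' * g]] \/
  exists io eta, [/\ io ^+ 2 = -1, eta ^+ 2 = 1,
    [/\ al = - 2^-1, be = - (io / 2) & de = - (1 + a / 4)],
    [/\ al' = eta * - (3 * io / 2), be' = eta * - 2^-1
      & de' = eta * - (io * (1 + a / 4))]
    & [/\ as_ = a, bs = rotB (- io) a b g & gs = eta * rotg (- io) a b g]].
Proof.
have := uw0 (isT : [::]%N \in quadratic_words).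
have := uw0 (isT : [:: 0]%N \in quadratic_words).
have := uw0 (isT : [:: 1]%N \in quadratic_words).
have := uw0 (isT : [:: 0; 0]%N \in quadratic_words).
have := uw0 (isT : [:: 0; 1]%N \in quadratic_words).
have := uw0 (isT : [:: 1; 1]%N \in quadratic_words).
have := vw0 (isT : [::]%N \in quadratic_words).
have := vw0 (isT : [:: 0]%N \in quadratic_words).
have := vw0 (isT : [:: 0; 0]%N \in quadratic_words).
have := vw0 (isT : [:: 1; 1]%N \in quadratic_words).
cbn; rewrite /= => Vvv Vuu Vu V1 Uvv Uuv Uuu Uv Uu U1 Dn0.
apply: (quadratic_system Dn0).
- by rewrite -[RHS]Uvv; ring.
- by rewrite -[RHS]Uuu; ring.
- by apply: (mulfI (_ : 2 != 0)); rewrite ?pnatr_eq0 // mulr0 -[RHS]Uuv; ring.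
- by apply: (mulfI (_ : 2 != 0)); rewrite ?pnatr_eq0 // mulr0 -[RHS]Uv; ring.
- by rewrite -[RHS]Uu; ring.
- by rewrite -[RHS]U1; ring.
- by rewrite -[RHS]Vvv; ring.
- by rewrite -[RHS]Vuu; ring.
- by rewrite -[RHS]Vu; ring.
- by rewrite -[RHS]V1; ring.
Qed.

End Equations.

End Solve.

(** * Classification of the isomorphisms *)

Section Classification.
Variable C : numClosedFieldType.

Definition affine_map (Q Q' : {poly C}) (g g' : C) (f : algD Q g -> algD Q' g')
    (al be de al' be' de' k : C) : Prop :=
  [/\ f (uD Q g) = al *: uD Q' g' + be *: vD Q' g' + de *: (1 : algD Q' g'),
      f (vD Q g) = al' *: uD Q' g' + be' *: vD Q' g' + de' *: (1 : algD Q' g')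
    & f (wD Q g) = k *: wD Q' g'].

(** The last relation contains c only as a multiple of 1. This recovers the constant term of the
    polynomial, which is absent from the quadratic system. *)
Lemma cubic_relations_c (A : algType C) a b c c' g (u v w : A) :
  cubic_relations a b c g u v w -> cubic_relations a b c' g u v w -> c = c'.
Proof.
move=> [_ _ _ E] [_ _ _ E'].
have : (c - c') *: (1 : A) = 0.
  rewrite scalerBl; move: E; rewrite -E'.
  by do 4![move/addIr]; move/addrI => ->; rewrite subrr.
by move/eqP; rewrite scaler_eq0 oner_eq0 orbF subr_eq0 => /eqP.
Qed.

Variables (A B C0 g : C).
Local Notation Q := (cubic A B C0).

Lemma hom_cubic_relations (E : algType C) (f : algD Q g -> E) :
  linear f -> monoid_morphism f ->
  cubic_relations A B C0 g (f (uD Q g)) (f (vD Q g)) (f (wD Q g)).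
Proof.
move=> fL fM; have [f1 fMM] := fM; apply/cubic_relationsP.
pose e s := f (to_quot (relD Q g) s).
have pL := to_quot_linear (relD Q g).
have [p1 pM] := to_quot_monoid_morphism (relD Q g).
have eL : linear e by move=> k p q; rewrite /e pL fL.
have eM : monoid_morphism e by split=> [|p q]; rewrite /e ?p1 // pM fMM.
move=> z; rewrite -[f (uD Q g)]/(e _) -[f (vD Q g)]/(e _) -[f (wD Q g)]/(e _).
rewrite -(D_relators_morph _ _ _ _ _ eL eM) => /mapP [s Hs ->].
by rewrite /e to_quot_gen // (linear_fun0 fL).
Qed.

Lemma iso_classification (Q' : {poly C}) (g' : C) (phi : algD Q g -> algD Q' g') :
  Q' \is monic -> (3 < size Q')%N -> @alg_iso _ (relD Q g) (relD Q' g') phi ->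
  (exists eta, [/\ eta ^+ 2 = 1, Q' = Q, g' = eta * g
    & affine_map phi 1 0 0 0 eta 0 eta]) \/
  exists io eta, [/\ io ^+ 2 = -1, eta ^+ 2 = 1,
    Q' = cubic A (rotB io A B (eta * g)) (rotC io A B C0 (eta * g)),
    g' = rotg io A B (eta * g)
    & affine_map phi (- 2^-1) (- (io / 2)) (- (1 + A / 4)) (eta * - (3 * io / 2))
        (eta * - 2^-1) (eta * - (io * (1 + A / 4))) eta].
Proof.
move=> mQ' sQ' phiI; have mQ := cubic_monic A B C0; have sQ := size_cubic A B C0.
have [sQ4 [al [be [de [al' [be' [de' [Eu Ev]]]]]]]] := iso_affine sQ mQ sQ' mQ' phiI.
have [a [b [c EQ']]] := monic_size4 mQ' sQ4; subst Q'.
have [[phiL [phi1 phiM]] phiB] := phiI.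
have H : cubic_relations A B C0 g (diff_rep (phi (uD Q g))) (diff_rep (phi (vD Q g)))
    (diff_rep (phi (wD Q g))).
  apply: (@hom_cubic_relations _ (fun x => diff_rep (phi x))).
    by move=> k x y; rewrite phiL diff_rep_linear.
  by split=> [|x y]; rewrite ?phi1 ?diff_rep1 // phiM diff_repM.
have EU : diff_rep (phi (uD Q g)) = al *: diff_rep (uD (cubic a b c) g')
    + be *: diff_rep (vD (cubic a b c) g') + de *: 1.
  by rewrite Eu !diff_repD !diff_repZ diff_rep1.
have EV : diff_rep (phi (vD Q g)) = al' *: diff_rep (uD (cubic a b c) g')
    + be' *: diff_rep (vD (cubic a b c) g') + de' *: 1.
  by rewrite Ev !diff_repD !diff_repZ diff_rep1.
have [E1 _ _ _] := H; have EW := affine_lie 0 0 0 EU EV E1.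
set Dl := al * be' - be * al' in EW.
have Dl0 : Dl != 0.
  have sQ3 : (3 < size Q)%N by rewrite sQ.
  apply: contraNneq (wD_neq0 g sQ3 mQ) => Dl0; apply/eqP; apply: (bij_inj phiB).
  rewrite (linear_fun0 phiL).
  by apply: (diff_rep_inj sQ' mQ'); rewrite EW Dl0 scale0r diff_rep0.
have Ew : phi (wD Q g) = Dl *: wD (cubic a b c) g'.
  by apply: (diff_rep_inj sQ' mQ'); rewrite EW diff_repZ.
have H' := H; rewrite EW in H'.
have R0 := rep_cubic a b c g'.
case: (affine_solve EU EV H' Dl0).
  case=> -[al1 be0 de0] [al'0 eta2 de'0] [EA EB Eg]; left; exists be'.
  have DlE : Dl = be' by rewrite /Dl al1 be0 mul1r mul0r subr0.
  have R := cubic_relations_sign eta2 R0.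
  rewrite EU EV EA EB Eg al1 be0 de0 al'0 de'0 DlE !scale0r scale1r !addr0 add0r in H'.
  have Ec := cubic_relations_c H' R.
  split=> //; first by rewrite EA EB Ec.
    by rewrite Eg mulrA -expr2 eta2 mul1r.
  by split; rewrite ?Eu ?Ev ?Ew ?al1 ?be0 ?de0 ?al'0 ?de'0 ?DlE.
case=> io [eta [io2 eta2 [alE beE deE] [al'E be'E de'E] [EA EB Eg]]].
right; exists io, eta.
have DlE : Dl = eta by rewrite /Dl alE beE al'E be'E; field: io2.
have R := cubic_relations_sign eta2 (rot_relations io2 R0).
have EU' : diff_rep (phi (uD Q g)) = rotu io a (diff_rep (uD (cubic a b c) g'))
    (diff_rep (vD (cubic a b c) g')).
  rewrite EU alE beE deE /rotu !scaleNr.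
  by congr (_ - _); exact: addrC.
have EV' : diff_rep (phi (vD Q g)) = eta *: rotv io a (diff_rep (uD (cubic a b c) g'))
    (diff_rep (vD (cubic a b c) g')).
  rewrite EV al'E be'E de'E /rotv !scalerBr !scalerN !scalerA !mulrN !scaleNr.
  by congr (_ - _); exact: addrC.
rewrite EU' EV' EA EB Eg DlE in H'.
have Ec := cubic_relations_c H' R.
(* The system has given the source in terms of the target; rotation by io now solves for the
   target. *)
have Eeg : eta * g = rotg (- io) a b g' by rewrite Eg mulrA -expr2 eta2 mul1r.
split=> //.
- by rewrite EA EB Ec Eeg rotBK // rotCK.
- by rewrite EA EB Eeg rotgK.
- have {}deE : de = - (1 + A / 4) by rewrite EA.
  have {}de'E : de' = eta * - (io * (1 + A / 4)) by rewrite EA.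
  by split; [rewrite Eu alE beE deE|rewrite Ev al'E be'E de'E|rewrite Ew DlE].
Qed.

End Classification.

Lemma add3ACA (V : nmodType) (a b c x y z : V) :
  a + b + c + (x + y + z) = a + x + (b + y) + (c + z).
Proof. by rewrite addrACA; congr (_ + _); exact: addrACA. Qed.

(** * Arrows and automorphism groups *)

Section Arrows.
Variable C : numClosedFieldType.
Implicit Types (Q : {poly C}) (A B g io eta : C).

Lemma hom_of_gens_ext Q Q' g g' (f f' : algD Q g -> algD Q' g') :
  @alg_hom _ (relD Q g) (relD Q' g') f -> @alg_hom _ (relD Q g) (relD Q' g') f' ->
  f (uD Q g) = f' (uD Q g) -> f (vD Q g) = f' (vD Q g) -> f (wD Q g) = f' (wD Q g) ->
  f = f'.
Proof.
move=> Hf Hf' Eu Ev Ew.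
apply: (@hom_of_gens_unique _ _ _ (fun i => f (quot_gen (relD Q g) i))) => //.
split=> // -[[|[|[|//]]] lti]; rewrite (bool_irrelevance lti isT).
- exact/esym/Eu.
- exact/esym/Ev.
- exact/esym/Ew.
Qed.

Lemma affine_map_ext Q Q' g g' (f f' : algD Q g -> algD Q' g') al be de al' be' de' k :
  @alg_hom _ (relD Q g) (relD Q' g') f -> @alg_hom _ (relD Q g) (relD Q' g') f' ->
  affine_map f al be de al' be' de' k -> affine_map f' al be de al' be' de' k -> f = f'.
Proof.
by move=> Hf Hf' [Eu Ev Ew] [Eu' Ev' Ew']; apply: hom_of_gens_ext => //;
  rewrite ?Eu ?Eu' ?Ev ?Ev' ?Ew ?Ew'.
Qed.

Lemma affine_map_comp Q1 Q2 Q3 g1 g2 g3 (f : algD Q1 g1 -> algD Q2 g2)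
    (h : algD Q2 g2 -> algD Q3 g3) a b c a' b' c' k x y z x' y' z' l :
  @alg_hom _ (relD Q2 g2) (relD Q3 g3) h ->
  affine_map f a b c a' b' c' k -> affine_map h x y z x' y' z' l ->
  affine_map (h \o f) (a * x + b * x') (a * y + b * y') (a * z + b * z' + c)
    (a' * x + b' * x') (a' * y + b' * y') (a' * z + b' * z' + c') (k * l).
Proof.
move=> [hL [h1 hM]] [Eu Ev Ew] [Eu' Ev' Ew']; have h0 := linear_fun0 hL.
have hD p q : h (p + q) = h p + h q by have := hL 1 p q; rewrite !scale1r.
have hZ d p : h (d *: p) = d *: h p by have := hL d p 0; rewrite !addr0 h0 addr0.
have gen p q d : h (p *: uD Q2 g2 + q *: vD Q2 g2 + d *: (1 : algD Q2 g2)) =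
   (p * x + q * x') *: uD Q3 g3 + (p * y + q * y') *: vD Q3 g3
   + (p * z + q * z' + d) *: (1 : algD Q3 g3).
  rewrite !hD !hZ Eu' Ev' h1 !scalerDr !scalerA !scalerDl.
  by rewrite [in LHS]add3ACA -[LHS]addrA.
by split; rewrite /= ?Eu ?Ev ?gen // Ew hZ Ew' scalerA.
Qed.

Lemma affine_map_id Q g : affine_map (@id (algD Q g)) 1 0 0 0 1 0 1.
Proof. by split; rewrite ?scale1r ?scale0r ?addr0 ?add0r ?addr0. Qed.

Lemma alg_hom_comp Q1 Q2 Q3 g1 g2 g3 (f : algD Q1 g1 -> algD Q2 g2)
    (h : algD Q2 g2 -> algD Q3 g3) :
  @alg_hom _ (relD Q1 g1) (relD Q2 g2) f -> @alg_hom _ (relD Q2 g2) (relD Q3 g3) h ->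
  @alg_hom _ (relD Q1 g1) (relD Q3 g3) (h \o f).
Proof.
move=> [fL [f1 fM]] [hL [h1 hM]]; split=> [a x y|]; first by rewrite /= fL hL.
by split=> [|x y]; rewrite /= ?f1 ?h1 ?fM ?hM.
Qed.

(** Only the coefficients of v are compared, since they already separate the six maps. *)
Lemma affine_map_uniq A B (C0 : C) Q g g' (f : algD Q g -> algD (cubic A B C0) g')
    a b c a' b' c' k x y z x' y' z' l :
  affine_map f a b c a' b' c' k -> affine_map f x y z x' y' z' l -> b = y /\ b' = y'.
Proof.
have H p q d p' q' d' (t : algD (cubic A B C0) g') :
    t = p *: uD _ _ + q *: vD _ _ + d *: (1 : algD (cubic A B C0) g') ->
    t = p' *: uD _ _ + q' *: vD _ _ + d' *: (1 : algD (cubic A B C0) g') -> q = q'.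
  move=> -> /(congr1 (@diff_rep _ _ _)); rewrite !diff_repD !diff_repZ diff_rep1.
  move=> /eqP; rewrite -subr_eq0 => /eqP E.
  have := @quadratic_indep _ _ g' (size_cubic A B C0) (cubic_monic A B C0)
    (d - d') (p - p') (q - q') 0 0 0 0.
  rewrite !scale0r !addr0 => -[].
    by rewrite -[RHS]E !scalerBl !opprD add3ACA addrC.
  by move=> -[_ _ /eqP]; rewrite subr_eq0 => /eqP.
move=> [Eu Ev _] [Eu' Ev' _]; split; [exact: H Eu Eu'|exact: H Ev Ev'].
Qed.

Lemma alg_hom_id Q g : @alg_hom _ (relD Q g) (relD Q g) id.
Proof. by []. Qed.

(** Homomorphisms are determined on generators, so two maps are inverse as soon as both composites
    have the affine coefficients of the identity. *)
Lemma affine_iso Q Q' g g' (f : algD Q g -> algD Q' g') (f' : algD Q' g' -> algD Q g) :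
  @alg_hom _ (relD Q g) (relD Q' g') f -> @alg_hom _ (relD Q' g') (relD Q g) f' ->
  affine_map (f' \o f) 1 0 0 0 1 0 1 -> affine_map (f \o f') 1 0 0 0 1 0 1 ->
  @alg_iso _ (relD Q g) (relD Q' g') f.
Proof.
move=> Hf Hf' E E'; split=> //; exists f' => x.
  have H := affine_map_ext (alg_hom_comp Hf Hf') (@alg_hom_id Q g) E
    (@affine_map_id Q g).
  exact: (congr1 (fun k : algD Q g -> algD Q g => k x) H).
have H := affine_map_ext (alg_hom_comp Hf' Hf) (@alg_hom_id Q' g') E'
  (@affine_map_id Q' g').
exact: (congr1 (fun k : algD Q' g' -> algD Q' g' => k x) H).
Qed.

Lemma homD_cubic A B (C0 : C) g a b c g' (x y z : algD (cubic a b c) g') :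
  cubic_relations A B C0 g (diff_rep x) (diff_rep y) (diff_rep z) ->
  let h : algD (cubic A B C0) g -> algD (cubic a b c) g' := homD x y z in
  [/\ @alg_hom _ (relD (cubic A B C0) g) (relD (cubic a b c) g') h,
    h (uD _ _) = x, h (vD _ _) = y & h (wD _ _) = z].
Proof.
move=> /cubic_relationsP /homD_is_hom [Hh hx] h.
by split=> //; [exact: (hx (@Ordinal 3 0 isT))|exact: (hx (@Ordinal 3 1 isT))
  |exact: (hx (@Ordinal 3 2 isT))].
Qed.

Section RotationMaps.
Variables (A B C0 g B' C' g' : C).
Local Notation D' := (algD (cubic A B' C') g').
Local Notation u := (uD (cubic A B' C') g').
Local Notation v := (vD (cubic A B' C') g').
Local Notation w := (wD (cubic A B' C') g').

Lemma rot_hom io (x y : D') : io ^+ 2 = -1 ->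
  B = rotB (- io) A B' g' -> C0 = rotC (- io) A B' C' g' -> g = rotg (- io) A B' g' ->
  x = (- 2^-1) *: u + (- (io / 2)) *: v + (- (1 + A / 4)) *: (1 : D') ->
  y = (- (3 * io / 2)) *: u + (- 2^-1) *: v + (- (io * (1 + A / 4))) *: (1 : D') ->
  let h : algD (cubic A B C0) g -> D' := homD x y w in
  @alg_hom _ (relD (cubic A B C0) g) (relD (cubic A B' C') g') h /\
  affine_map h (- 2^-1) (- (io / 2)) (- (1 + A / 4))
    (- (3 * io / 2)) (- 2^-1) (- (io * (1 + A / 4))) 1.
Proof.
move=> io2 EB EC Eg Ex Ey h.
have [|Hh hu hv hw] := @homD_cubic A B C0 g A B' C' g' x y w.
  rewrite EB EC Eg; have := rot_relations io2 (rep_cubic A B' C' g').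
  congr cubic_relations.
    rewrite Ex !diff_repD !diff_repZ diff_rep1 /rotu !scaleNr.
    by congr (_ - _); exact: addrC.
  rewrite Ey !diff_repD !diff_repZ diff_rep1 /rotv !scaleNr.
  by congr (_ - _); exact: addrC.
by split=> //; split; rewrite /h; [rewrite hu Ex|rewrite hv Ey|rewrite hw scale1r].
Qed.

Lemma sign_hom : B' = B -> C' = C0 -> g' = - g ->
  let h : algD (cubic A B C0) g -> D' := homD u (- v) (- w) in
  @alg_hom _ (relD (cubic A B C0) g) (relD (cubic A B' C') g') h /\
  affine_map h 1 0 0 0 (-1) 0 (-1).
Proof.
move=> EB EC Eg h.
have [|Hh hu hv hw] := @homD_cubic A B C0 g A B' C' g' u (- v) (- w).
  have e2 : (-1) ^+ 2 = 1 :> C by rewrite sqrrN expr1n.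
  have := cubic_relations_sign e2 (rep_cubic A B' C' g').
  by rewrite !diff_repN !scaleN1r mulN1r Eg opprK EB EC.
by split=> //; split; rewrite /h ?hu ?hv ?hw ?scale1r ?scaleN1r ?scale0r ?addr0 ?add0r.
Qed.

End RotationMaps.

End Arrows.

(** * Recognizing the symmetric group on three letters *)

Section DihedralOrder6.
Local Open Scope group_scope.

Definition dih (G : groupType) (f h : G) (x : 'I_3 * bool) : G := h ^+ x.2 * f ^+ x.1.

(** Obtained from f^i h = h f^(3 - i). The law does not mention the group, so any two groups in
    which [dih] is a bijection are isomorphic. *)
Definition dih_mul (x y : 'I_3 * bool) : 'I_3 * bool :=
  (inord (((if y.2 then 3 - x.1 else x.1) + y.1) %% 3), x.2 (+) y.2)%N.

Lemma dih_morph (G : groupType) (f h : G) : f ^+ 3 = 1 -> h ^+ 2 = 1 ->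
  f * h = h * f ^+ 2 ->
  forall x y, dih f h x * dih f h y = dih f h (dih_mul x y).
Proof.
move=> f3 h2 fh [i j] [i' j']; rewrite /dih /dih_mul /=.
have fmod n : f ^+ (n %% 3) = f ^+ n.
  by rewrite {2}(divn_eq n 3) expgnDr mulnC expgnA f3 expg1n mul1g.
have fnh n : (n <= 3)%N -> f ^+ n * h = h * f ^+ (3 - n).
  case: n => [|[|[|[|//]]]] _.
  - by rewrite expg0 mul1g subn0 f3 mulg1.
  - exact: fh.
  - by rewrite expg2 -mulgA fh mulgA fh -mulgA -expgnDr -(fmod (2 + 2)%N).
  - by rewrite f3 mul1g subnn expg0 mulg1.
rewrite inordK ?ltn_pmod // fmod expgnDr.
have li := ltn_ord i.
case: j' => /=; last first.
  by rewrite expg0 mul1g addbF mulgA.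
rewrite expg1 addbT mulgA -[h ^+ j * _ * h]mulgA fnh 1?ltnW // mulgA.
case: j => /=; rewrite ?expg1 ?expg0 ?mul1g; last by rewrite -mulgA.
by rewrite -expg2 h2 mul1g.
Qed.

Definition rot3 : 'S_3 := perm (@ordS_inj 3).
Definition refl3 : 'S_3 := tperm ord0 (inord 1).

Lemma val_rot3X n x : val ((rot3 ^+ n) x) = ((x + n) %% 3)%N.
Proof.
elim: n x => [|n IH] x; first by rewrite expg0 perm1 addn0 modn_small.
by rewrite expgS permM IH permE /= modnDml addSnnS.
Qed.

(** This is x -> 1 - x modulo 3, written without subtraction. *)
Lemma val_refl3 x : val (refl3 x) = ((1 + 2 * x) %% 3)%N.
Proof.
rewrite permE /= -!val_eqE /= inordK //.
by case: x => -[|[|[|//]]] /= _; rewrite ?inordK.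
Qed.

Lemma rot3_order : rot3 ^+ 3 = 1.
Proof.
apply/permP => x; apply: val_inj; rewrite perm1 [LHS]val_rot3X.
by rewrite modnDr modn_small.
Qed.

Lemma refl3_order : refl3 ^+ 2 = 1.
Proof. by rewrite expg2 tperm2. Qed.

Lemma rot3_refl3 : rot3 * refl3 = refl3 * rot3 ^+ 2.
Proof.
apply/permP => x; apply: val_inj; rewrite [in LHS]permM [in RHS]permM [RHS]val_rot3X !val_refl3.
by rewrite [val (rot3 x)](val_rot3X 1 x); lia.
Qed.

(** The permutations are the affine maps x -> i + x and x -> 1 + i - x modulo 3, told apart by their
    values at 0 and 1; there are 6 on each side. *)
Lemma dih_S3_bij : bijective (dih rot3 refl3).
Proof.
apply: inj_card_bij; last by rewrite card_Sn card_prod card_ord card_bool.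
have E i j x : val (dih rot3 refl3 (i, j) x)
    = (((if j then 1 + 2 * x else x) + i) %% 3)%N.
  rewrite /dih permM [LHS]val_rot3X /=; case: j; rewrite ?expg0 ?perm1 //.
  by rewrite expg1 val_refl3 modnDml.
move=> [i j] [i' j'] /permP H.
have := congr1 val (H ord0); have := congr1 val (H (inord 1)); rewrite !E !inordK //=.
have := ltn_ord i; have := ltn_ord i'.
case: j {H}; case: j' => /= lt lt' E1 E0; try (exfalso; lia);
  by congr (_, _); apply: val_inj => /=; lia.
Qed.

Lemma isog_S3 (G : groupType) (f h : G) : f ^+ 3 = 1 -> h ^+ 2 = 1 ->
  f * h = h * f ^+ 2 -> bijective (dih f h) -> group_isog G 'S_3.
Proof.
move=> f3 h2 fh [k Kk kK]; exists (dih rot3 refl3 \o k).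
  by apply: bij_comp dih_S3_bij _; exists (dih f h).
move=> x y /=; rewrite (dih_morph rot3_order refl3_order rot3_refl3).
by rewrite -{1}(kK x) -{1}(kK y) dih_morph // Kk.
Qed.

End DihedralOrder6.

(** * The maps of the theorem are isomorphisms, and there are no others *)

Section RotationIso.
Variables (C : numClosedFieldType) (A B C0 g B' C' g' io : C).
Local Notation Q := (cubic A B C0).
Local Notation Q' := (cubic A B' C').
Local Notation u := (uD Q' g').
Local Notation v := (vD Q' g').
Local Notation w := (wD Q' g').
Hypotheses (io2 : io ^+ 2 = -1) (EB : B' = rotB io A B g)
  (EC : C' = rotC io A B C0 g) (Eg : g' = rotg io A B g).

(** The inverse is the rotation by - io, which starts at the rotated parameters and returns to the
    original ones. *)
Lemma rot_iso (x y : algD Q' g') :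
  x = (- 2^-1) *: u + (- (io / 2)) *: v + (- (1 + A / 4)) *: (1 : algD Q' g') ->
  y = (- (3 * io / 2)) *: u + (- 2^-1) *: v
      + (- (io * (1 + A / 4))) *: (1 : algD Q' g') ->
  let h : algD Q g -> algD Q' g' := homD x y w in
  @alg_iso _ (relD Q g) (relD Q' g') h /\
  affine_map h (- 2^-1) (- (io / 2)) (- (1 + A / 4))
    (- (3 * io / 2)) (- 2^-1) (- (io * (1 + A / 4))) 1.
Proof.
move=> Ex Ey h.
have ion2 : (- io) ^+ 2 = -1 by rewrite sqrrN.
have EB' : B = rotB (- io) A B' g' by rewrite EB Eg -{2 3}[io]opprK rotBK.
have EC' : C0 = rotC (- io) A B' C' g' by rewrite EB EC Eg -{2 3 4}[io]opprK rotCK.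
have Eg' : g = rotg (- io) A B' g' by rewrite EB Eg -{2 3}[io]opprK rotgK.
have [Hh Ah] := rot_hom io2 EB' EC' Eg' Ex Ey.
have EB2 : B' = rotB (- - io) A B g by rewrite opprK.
have EC2 : C' = rotC (- - io) A B C0 g by rewrite opprK.
have Eg2 : g' = rotg (- - io) A B g by rewrite opprK.
have [Hk Ak] := @rot_hom C A B' C' g' B C0 g (- io) _ _ ion2 EB2 EC2 Eg2 erefl erefl.
split=> //; apply: (affine_iso Hh Hk).
- by have := affine_map_comp Hk Ah Ak; congr affine_map; field: io2.
- by have := affine_map_comp Hh Ak Ah; congr affine_map; field: io2.
Qed.

End RotationIso.

Lemma sign_iso (C : numClosedFieldType) (A B C0 g : C) :
  @alg_iso _ (relD (cubic A B C0) g) (relD (cubic A B C0) (- g)) (@Theta C (cubic A B C0) g)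
  /\ affine_map (@Theta C (cubic A B C0) g) 1 0 0 0 (-1) 0 (-1).
Proof.
have [Hh Ah] := @sign_hom C A B C0 g B C0 (- g) erefl erefl erefl.
have [Hk Ak] := @sign_hom C A B C0 (- g) B C0 g erefl erefl (esym (opprK g)).
split=> //; apply: (affine_iso Hh Hk).
- by have := affine_map_comp Hk Ah Ak; congr affine_map; ring.
- by have := affine_map_comp Hh Ak Ah; congr affine_map; ring.
Qed.

Section Isos.
Variables (C : numClosedFieldType) (A B C0 g : C).
Local Notation Q := (cubic A B C0).
Local Notation e := (1 + A / 4).
Local Open Scope classical_set_scope.

Definition affine_arrow (h : arrow_from Q g) (al be de al' be' de' k : C) : Prop :=
  [/\ isos_from Q g h & affine_map (arrow_fun h) al be de al' be' de' k].

Lemma arrow_ext (h h' : arrow_from Q g) al be de al' be' de' k :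
  cod_poly h = cod_poly h' -> cod_par h = cod_par h' ->
  affine_arrow h al be de al' be' de' k ->
  affine_arrow h' al be de al' be' de' k -> h = h'.
Proof.
case: h h' => [Q1 g1 f] [Q2 g2 f'] /= EQ Eg; subst Q2 g2.
move=> [[_ _ [Hf _]] Af] [[_ _ [Hf' _]] Af'] /=.
by congr Arrow; exact: affine_map_ext Hf Hf' Af Af'.
Qed.

Lemma affine_arrow_id : affine_arrow (arrow_id Q g) 1 0 0 0 1 0 1.
Proof.
split; last exact: affine_map_id.
by split; [exact: cubic_monic|rewrite /= size_cubic|exact: alg_iso_id].
Qed.

Lemma affine_arrow_Theta : affine_arrow (arrow_Theta Q g) 1 0 0 0 (-1) 0 (-1).
Proof.
have [H1 H2] := sign_iso A B C0 g.
by split=> //; split=> //; [exact: cubic_monic|rewrite /= size_cubic].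
Qed.

Lemma affine_arrow_Psi : affine_arrow (arrow_Psi A B C0 g)
  (- 2^-1) (- ('i / 2)) (- e) (- (3 * 'i / 2)) (- 2^-1) (- ('i * e)) 1.
Proof.
pose D' := algD (cubic A (tB A B g) (tC A B C0 g)) (tg A B g).
have Ex (u v t : D') : - (('i / 2) *: v) - 2^-1 *: u - e *: t
    = (- 2^-1) *: u + (- ('i / 2)) *: v + (- e) *: t.
  by rewrite !scaleNr; congr (_ - _); exact: addrC.
have Ey (u v t : D') : - (2^-1 *: v) - (3 * 'i / 2) *: u - ('i * e) *: t
    = (- (3 * 'i / 2)) *: u + (- 2^-1) *: v + (- ('i * e)) *: t.
  by rewrite !scaleNr; congr (_ - _); exact: addrC.
have [H1 H2] := rot_iso (sqrCi C) erefl erefl erefl (Ex _ _ _) (Ey _ _ _).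
by split=> //; split=> //; [exact: cubic_monic|rewrite /= size_cubic].
Qed.

Lemma affine_arrow_PsiV : affine_arrow (arrow_PsiV A B C0 g)
  (- 2^-1) ('i / 2) (- e) (3 * 'i / 2) (- 2^-1) ('i * e) 1.
Proof.
have i2 : (- 'i) ^+ 2 = -1 :> C by rewrite sqrrN sqrCi.
have EB : hB A B g = rotB (- 'i) A B g by rewrite /hB /rotB; field.
have EC : hC A B C0 g = rotC (- 'i) A B C0 g by rewrite /hC /rotC; field.
have Eg : hg A B g = rotg (- 'i) A B g by rewrite /hg /rotg; field: (sqrCi C).
pose D' := algD (cubic A (hB A B g) (hC A B C0 g)) (hg A B g).
have Ex (u v t : D') : ('i / 2) *: v - 2^-1 *: u - e *: t
    = (- 2^-1) *: u + (- (- 'i / 2)) *: v + (- e) *: t.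
  by rewrite !scaleNr mulNr scaleNr opprK; congr (_ - _); exact: addrC.
have Ey (u v t : D') : - (2^-1 *: v) + (3 * 'i / 2) *: u + ('i * e) *: t
    = (- (3 * - 'i / 2)) *: u + (- 2^-1) *: v + (- (- 'i * e)) *: t.
  by rewrite !(mulNr, mulrN, scaleNr, opprK); congr (_ + _); exact: addrC.
have [H1 H2] := rot_iso i2 EB EC Eg (Ex _ _ _) (Ey _ _ _).
split; first by split; [exact: cubic_monic|rewrite /= size_cubic|exact: H1].
by move: H2; congr affine_map; field.
Qed.

Lemma affine_arrow_Theta_after a' b' c' (h : arrow_from Q g) al be de al' be' de' k :
  cod_poly h = cubic a' b' c' -> affine_arrow h al be de al' be' de' k ->
  affine_arrow (Theta_after h) al (- be) de al' (- be') de' (- k).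
Proof.
case: h => [Q1 g1 f] /= EQ; subst Q1; move=> [[_ _ Hf] Af].
have [H1 H2] := sign_iso a' b' c' g1; split; last first.
  by have := affine_map_comp H1.1 Af H2; congr affine_map; ring.
by split; [exact: cubic_monic|rewrite /= size_cubic|exact: alg_iso_comp H1 Hf].
Qed.

Lemma isos_from_cubic : isos_from Q g
  = [set arrow_id Q g; arrow_Psi A B C0 g; arrow_PsiV A B C0 g; arrow_Theta Q g;
     Theta_after (arrow_Psi A B C0 g); Theta_after (arrow_PsiV A B C0 g)].
Proof.
have AT := affine_arrow_Theta_after
  (erefl : cod_poly (arrow_Psi A B C0 g) = cubic _ _ _) affine_arrow_Psi.
have ATV := affine_arrow_Theta_after
  (erefl : cod_poly (arrow_PsiV A B C0 g) = cubic _ _ _) affine_arrow_PsiV.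
apply/seteqP; split=> [h|h]; last first.
  move=> [[[[[->|->]|->]|->]|->]|->].
  - by case: affine_arrow_id.
  - by case: affine_arrow_Psi.
  - by case: affine_arrow_PsiV.
  - by case: affine_arrow_Theta.
  - by case: AT.
  - by case: ATV.
move=> Hh; have [mQ' sQ' Hf] := Hh.
have sqr1 (x : C) : x ^+ 2 = 1 -> x = 1 \/ x = -1.
  by move/eqP; rewrite sqrf_eq1 => /orP [] /eqP; [left|right].
have [[eta [/sqr1 [] eta1 EQ Eg Ah]]|] := iso_classification mQ' sQ' Hf.
- do 5!left; apply: arrow_ext affine_arrow_id; rewrite // ?Eg ?eta1 ?mul1r //.
  by split=> //; rewrite eta1 in Ah.
- do 2!left; right; apply: arrow_ext affine_arrow_Theta; rewrite // ?Eg ?eta1 ?mulN1r //.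
  by split=> //; rewrite eta1 in Ah.
move=> [io [eta [io2 /sqr1 eta2 EQ Eg Ah]]].
have : io = 'i \/ io = - 'i.
  by move/eqP: io2; rewrite -(sqrCi C) eqf_sqr => /orP [] /eqP; [left|right].
case: eta2 => eta1 [] io1; rewrite {}eta1 {}io1 in EQ Eg Ah.
- do 4!left; right; apply: arrow_ext affine_arrow_Psi; rewrite ?EQ ?Eg ?mul1r //.
  by split=> //; move: Ah; congr affine_map; ring.
- do 3!left; right; apply: arrow_ext affine_arrow_PsiV.
  + by rewrite EQ mul1r; congr cubic; rewrite /rotB /rotC /hB /hC; field.
  + by rewrite Eg mul1r /rotg /= /hg; field: (sqrCi C).
  + by split=> //; move: Ah; congr affine_map; field.
(* For eta = -1 the roots trade places: rotating (B, - gamma) by i gives the same B as rotating (B,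
   gamma) by - i, and the opposite gamma. *)
- right; apply: arrow_ext ATV.
  + by rewrite EQ; congr cubic; rewrite /rotB /rotC /hB /hC; field.
  + by rewrite Eg /rotg /= /hg; field: (sqrCi C).
  + by split=> //; move: Ah; congr affine_map; field.
- left; right; apply: arrow_ext AT.
  + by rewrite EQ; congr cubic; rewrite /rotB /rotC /tB /tC; field.
  + by rewrite Eg /rotg /= /tg; field: (sqrCi C).
  + by split=> //; move: Ah; congr affine_map; field.
Qed.

End Isos.

Local Open Scope classical_set_scope.
Local Open Scope card_scope.
Local Open Scope ring_scope.

Lemma aut_arrow_inj (C : numClosedFieldType) (Q : {poly C}) (g : C) :
  injective (@aut_arrow C Q g).
Proof.
move=> f f' E; apply: aut_ext => x; rewrite -[x]to_quotK.
(* The type of [arrow_fun h] depends on h, so E cannot be applied to values directly. Writing the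
   values as classes of elements of the free algebra gives a statement that makes sense for every
   h. *)
have R (h : arrow_from Q g) (t : free_alg C) : h = aut_arrow f' ->
    arrow_fun h (to_quot (relD Q g) (quot_repr x)) = to_quot _ t ->
    f' (to_quot (relD Q g) (quot_repr x)) = to_quot _ t by move=> ->.
have := R _ (quot_repr (f (to_quot (relD Q g) (quot_repr x)))) E.
by rewrite !to_quotK => /(_ erefl).
Qed.

Lemma arrow_aut (C : numClosedFieldType) (Q : {poly C}) (g : C) (h : arrow_from Q g) :
  isos_from Q g h -> cod_poly h = Q -> cod_par h = g ->
  exists f : autD Q g, aut_arrow f = h.
Proof.
case: h => [Q1 g1 f] [_ _ Hf] /= EQ Eg; subst Q1 g1.
by exists (@AlgAut _ (relD Q g) f Hf).
Qed.

Lemma aut_affine_ext (C : numClosedFieldType) (Q : {poly C}) (g : C) (f f' : autD Q g)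
    al be de al' be' de' k :
  affine_map (aut_fun f) al be de al' be' de' k ->
  affine_map (aut_fun f') al be de al' be' de' k -> f = f'.
Proof.
move=> Af Af'; apply: aut_ext => x.
have := affine_map_ext (aut_iso f).1 (aut_iso f').1 Af Af'.
exact: (congr1 (fun k : algD Q g -> algD Q g => k x)).
Qed.

Lemma aut_affine_mul (C : numClosedFieldType) (Q : {poly C}) (g : C) (f h : autD Q g)
    a b c a' b' c' k x y z x' y' z' l :
  affine_map (aut_fun f) a b c a' b' c' k -> affine_map (aut_fun h) x y z x' y' z' l ->
  affine_map (aut_fun (h * f)%g) (a * x + b * x') (a * y + b * y') (a * z + b * z' + c)
    (a' * x + b' * x') (a' * y + b' * y') (a' * z + b' * z' + c') (k * l).
Proof. exact: (affine_map_comp (aut_iso h).1). Qed.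

Lemma generates_pair (G : groupType) (x : G) : (forall y, y = 1%g \/ y = x) ->
  generates [set x].
Proof.
move=> Gx H [H1 _] HS y.
by case: (Gx y) => -> //; apply: HS.
Qed.

Lemma card_pair (T : Type) (x y : T) : x <> y -> (forall z, z = x \/ z = y) ->
  [set: T] #= `I_2.
Proof.
move=> xy H; pose F n := if n is 0%N then x else y.
have -> : [set: T] = [set F i | i in `I_2].
  apply/seteqP; split=> // z _.
  by case: (H z) => ->; [exists 0%N|exists 1%N].
apply: inj_card_eq => -[|[|i]] [|[|j]]; rewrite !inE //= => _ _ E.
by case: xy.
Qed.

(** * The six isomorphisms are distinct *)

Section Six.
Variables (C : numClosedFieldType) (A B C0 g : C).
Local Notation Q := (cubic A B C0).
Local Notation psi := (arrow_Psi A B C0 g).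
Local Notation psiV := (arrow_PsiV A B C0 g).
Local Notation theta := (arrow_Theta Q g).

(** The order is such that, when all six are automorphisms, entry 3 j + i is the composite of the
    j-th power of Theta with the i-th power of Psi. *)
Definition six_arrows : seq (arrow_from Q g) :=
  [:: arrow_id Q g; psi; psiV; theta; Theta_after psi; Theta_after psiV].

Local Notation six := (nth (arrow_id Q g) six_arrows).

Lemma isos_from_nth : isos_from Q g = [set six i | i in `I_6].
Proof.
rewrite isos_from_cubic; apply/seteqP; split=> h.
  move=> [[[[[->|->]|->]|->]|->]|->].
  - by exists 0%N.
  - by exists 1%N.
  - by exists 2.
  - by exists 3.
  - by exists 4.
  - by exists 5.
case=> -[|[|[|[|[|[|//]]]]]] _ /= <-; by [do 5!left|do 4!left; right|do 3!left; right
  |do 2!left; right|left; right|right].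
Qed.

(* The coefficients of v in the images of u and v, in the units i/2 and 1/2. *)
Definition arrow_slopes (h : arrow_from Q g) (z : int * int) : Prop :=
  (exists a b c, cod_poly h = cubic a b c) /\
  exists al de al' de' k,
    affine_map (arrow_fun h) al (z.1%:~R * ('i / 2)) de al' (z.2%:~R / 2) de' k.

Lemma arrow_slopes_uniq h z z' : arrow_slopes h z -> arrow_slopes h z' -> z = z'.
Proof.
case: h => [Q1 g1 f] [[a [b [c /= EQ]]] H] [_ H']; subst Q1.
case: H => [al [de [al' [de' [k H]]]]]; case: H' => [al2 [de2 [al2' [de2' [k2 H']]]]].
have [/mulIf + /mulIf] := affine_map_uniq H H'.
have i0 : 'i / 2 != 0 :> C by rewrite mulf_neq0 ?neq0Ci // invr_eq0 pnatr_eq0.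
move=> /(_ i0) /intr_inj E1 /(_ _) E2.
rewrite [z]surjective_pairing [z']surjective_pairing E1.
by rewrite (intr_inj (E2 _)) // invr_eq0 pnatr_eq0.
Qed.

Lemma six_slopes i : (i < 6)%N -> arrow_slopes (six i)
  (nth (0, 0) [:: (0, 2); (-1, -1); (1, -1); (0, -2); (1, 1); (-1, 1)] i).
Proof.
have [_ H1] := affine_arrow_id A B C0 g; have [_ H4] := affine_arrow_Theta A B C0 g.
have H2 := affine_arrow_Psi A B C0 g; have H3 := affine_arrow_PsiV A B C0 g.
have [_ H5] := affine_arrow_Theta_after (erefl : cod_poly psi = cubic _ _ _) H2.
have [_ H6] := affine_arrow_Theta_after (erefl : cod_poly psiV = cubic _ _ _) H3.
move: H2 H3 => [_ H2] [_ H3].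
case: i => [|[|[|[|[|[|//]]]]]] _; (split; [by do 3!eexists|]); do 5!eexists.
- by move: H1; congr affine_map; rewrite /=; field.
- by move: H2; congr affine_map; rewrite /=; field.
- by move: H3; congr affine_map; rewrite /=; field.
- by move: H4; congr affine_map; rewrite /=; field.
- by move: H5; congr affine_map; rewrite /=; field.
- by move: H6; congr affine_map; rewrite /=; field.
Qed.

Lemma six_inj i j : (i < 6)%N -> (j < 6)%N -> six i = six j -> i = j.
Proof.
move=> i6 j6 E; have := six_slopes i6; rewrite E => /arrow_slopes_uniq /(_ (six_slopes j6)).
by move/eqP; rewrite nth_uniq // => /eqP.
Qed.

Lemma card_isos_from : isos_from Q g #= `I_6.
Proof.
rewrite isos_from_nth; apply: inj_card_eq => i j.
by rewrite !inE => /six_inj H /H; apply.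
Qed.

Lemma six_isos i : (i < 6)%N -> isos_from Q g (six i).
Proof. by move=> i6; rewrite isos_from_nth; exists i. Qed.

End Six.

Lemma group_closedX (G : groupType) (H : {pred G}) (x : G) n :
  group_closed H -> x \in H -> (x ^+ n)%g \in H.
Proof.
move=> HG Hx; elim: n => [|n IH]; first by rewrite expg0; case: HG.
by rewrite expgS; exact: group_closedM.
Qed.

(** * Automorphism groups *)

Section Automorphisms.
Variables (C : numClosedFieldType) (A B C0 g : C).
Local Notation Q := (cubic A B C0).
Local Notation b0 := (4 * (A ^+ 2 / 16 - 1)).
Local Notation psi := (arrow_Psi A B C0 g).
Local Notation psiV := (arrow_PsiV A B C0 g).
Local Notation theta := (arrow_Theta Q g).
Local Notation six := (nth (arrow_id Q g) (six_arrows A B C0 g)).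

(** When the i-th arrow ends where it starts. For Psi, equality of the coefficients B means B = b0 +
    i gamma; the new gamma is then - gamma, so Psi itself requires gamma = 0, whereas Theta after
    Psi requires nothing more. *)
Definition six_fixed i : Prop :=
  match i with
  | 0%N => True
  | 1%N | 2 => g = 0 /\ B = b0
  | 3 => g = 0
  | 4 => B = b0 + 'i * g
  | _ => B = b0 - 'i * g
  end.

Lemma six_codP i : (i < 6)%N ->
  (cod_poly (six i) = Q /\ cod_par (six i) = g) <-> six_fixed i.
Proof.
have i2 := sqrCi C.
have tBE : tB A B g = B -> B = b0 + 'i * g.
  (* Solves an equation linear in B: one occurrence of B is replaced by [tB], whose - B/2 cancels
     against B/2. *)
  rewrite /tB => E1; transitivity ((B + B / 2) * (2 / 3)); first by field.
  by rewrite -{1}E1; field.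
have hBE : hB A B g = B -> B = b0 - 'i * g.
  rewrite /hB => E1; transitivity ((B + B / 2) * (2 / 3)); first by field.
  by rewrite -{1}E1; field.
have cubicQ b c : b = B -> c = C0 -> cubic A b c = Q by move=> -> ->.
case: i => [|[|[|[|[|[|//]]]]]] _ //=; split.
- move=> [/cubic_inj [_ /tBE EB _]]; rewrite /tg EB => Eg.
  have g0 : g = 0.
    by transitivity ((g + g) / 2); [|rewrite -{1}Eg]; field: i2.
  by rewrite g0 mulr0 addr0.
- move=> [g0 EB]; split; last by rewrite /tg EB g0; field.
  by apply: cubicQ; rewrite /tB /tC EB g0; field.
- move=> [/cubic_inj [_ /hBE EB _]]; rewrite /hg EB => Eg.
  have g0 : g = 0.
    by transitivity ((g + g) / 2); [|rewrite -{1}Eg]; field: i2.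
  by rewrite g0 mulr0 subr0.
- move=> [g0 EB]; split; last by rewrite /hg EB g0; field.
  by apply: cubicQ; rewrite /hB /hC EB g0; field.
- by move=> [_ E]; transitivity ((g + g) / 2); [|rewrite -{1}E]; field.
- by move=> ->; rewrite oppr0.
- by move=> [/cubic_inj [_ /tBE]].
- move=> EB; split; last by rewrite /tg EB; field: i2.
  by apply: cubicQ; rewrite /tB /tC EB; field.
- by move=> [/cubic_inj [_ /hBE]].
- move=> EB; split; last by rewrite /hg EB; field: i2.
  by apply: cubicQ; rewrite /hB /hC EB; field.
Qed.

Lemma six_aut i : (i < 6)%N -> six_fixed i -> exists f : autD Q g, aut_arrow f = six i.
Proof. by move=> i6 /(six_codP i6) []; apply: arrow_aut; exact: six_isos. Qed.

Lemma aut_six (f : autD Q g) :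
  exists i, [/\ (i < 6)%N, six_fixed i & aut_arrow f = six i].
Proof.
have : isos_from Q g (aut_arrow f).
  by split; [exact: cubic_monic|rewrite /= size_cubic|exact: aut_iso].
rewrite isos_from_nth => -[i i6 E]; exists i; split=> //.
by apply/(six_codP i6); rewrite E.
Qed.

Lemma aut_pair i (f : autD Q g) : (0 < i < 6)%N -> aut_arrow f = six i ->
  (forall j, (0 < j < 6)%N -> six_fixed j -> j = i) ->
  [set: autD Q g] #= `I_2 /\ generates [set f].
Proof.
move=> /andP[i0 i6] Ef H.
have cases (x : autD Q g) : x = 1%g \/ x = f.
  have [j [j6 Fj Ex]] := aut_six x; case: (posnP j) => [j0|j0]; [left|right].
    by apply: aut_arrow_inj; rewrite Ex j0.
  by apply: aut_arrow_inj; rewrite Ex Ef (H j) // j0.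
split; last exact: generates_pair.
apply: card_pair cases => E1; move: i0.
by rewrite (@six_inj _ A B C0 g i 0%N) // -Ef -E1.
Qed.

Section Symmetric.
Hypotheses (g0 : g = 0) (EB : B = b0).
Variables f h : autD Q g.
Hypotheses (Ef : aut_arrow f = psi) (Eh : aut_arrow h = theta).

Let Af : affine_map (aut_fun f) (- 2^-1) (- ('i / 2)) (- (1 + A / 4))
  (- (3 * 'i / 2)) (- 2^-1) (- ('i * (1 + A / 4))) 1.
Proof.
have [_] := affine_arrow_Psi A B C0 g; by rewrite -Ef.
Qed.

Let Ah : affine_map (aut_fun h) 1 0 0 0 (-1) 0 (-1).
Proof.
have [_] := affine_arrow_Theta A B C0 g; by rewrite -Eh.
Qed.

Let Af2 : affine_map (aut_fun (f ^+ 2)%g) (- 2^-1) ('i / 2) (- (1 + A / 4))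
  (3 * 'i / 2) (- 2^-1) ('i * (1 + A / 4)) 1.
Proof.
have i2 := sqrCi C.
by have := aut_affine_mul Af Af; rewrite -expg2; congr affine_map; field: i2.
Qed.

Let f3 : (f ^+ 3 = 1)%g.
Proof.
have i2 := sqrCi C; rewrite expgSr.
apply: (aut_affine_ext (aut_affine_mul Af Af2)).
by have := @affine_map_id _ Q g; congr affine_map; field: i2.
Qed.

Let h2 : (h ^+ 2 = 1)%g.
Proof.
rewrite expg2; apply: (aut_affine_ext (aut_affine_mul Ah Ah)).
by have := @affine_map_id _ Q g; congr affine_map; ring.
Qed.

Let fh : (f * h = h * f ^+ 2)%g.
Proof.
apply: (aut_affine_ext (aut_affine_mul Ah Af)).
by have := aut_affine_mul Af2 Ah; congr affine_map; ring.
Qed.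

Let dih_six (x : 'I_3 * bool) : aut_arrow (dih f h x) = six (3 * x.2 + x.1)%N.
Proof.
have fixed i : (i < 6)%N -> cod_poly (six i) = Q /\ cod_par (six i) = g.
  move=> i6; apply/(six_codP i6).
  by case: i i6 => [|[|[|[|[|[|//]]]]]] //=; rewrite g0 EB mulr0 ?addr0 ?subr0.
have ext (y : autD Q g) i al be de al' be' de' k : (i < 6)%N ->
    affine_map (aut_fun y) al be de al' be' de' k ->
    affine_arrow (six i) al be de al' be' de' k -> aut_arrow y = six i.
  move=> i6 Ay; have [Ec Eg] := fixed i i6; apply: arrow_ext; rewrite ?Ec ?Eg //.
  by split=> //; split; [exact: cubic_monic|rewrite /= size_cubic|exact: aut_iso].
have HP := affine_arrow_Psi A B C0 g.
have HPV := affine_arrow_PsiV A B C0 g.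
have HTP := affine_arrow_Theta_after (erefl : cod_poly psi = cubic _ _ _) HP.
have HTPV := affine_arrow_Theta_after (erefl : cod_poly psiV = cubic _ _ _) HPV.
case: x => [[[|[|[|//]]] lti] []]; rewrite /dih /= ?expg0 ?expg1 ?mulg1 ?mul1g //.
- apply: (ext _ 4 _ _ _ _ _ _ _ isT _ HTP).
  by have := aut_affine_mul Af Ah; congr affine_map; ring.
- apply: (ext _ 5 _ _ _ _ _ _ _ isT _ HTPV).
  by have := aut_affine_mul Af2 Ah; congr affine_map; ring.
- exact: (ext _ 2 _ _ _ _ _ _ _ isT Af2 HPV).
Qed.

Let dih_surj (y : autD Q g) : exists x, dih f h x = y.
Proof.
have [i [i6 _ Ey]] := aut_six y.
exists (inord (i %% 3), 2 < i)%N; apply: aut_arrow_inj; rewrite dih_six Ey /=.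
by rewrite inordK ?ltn_pmod //; case: i i6 {Ey} => [|[|[|[|[|[|//]]]]]].
Qed.

Lemma aut_S3 : group_isog (autD Q g) 'S_3.
Proof.
apply: (isog_S3 f3 h2 fh); have [k kK] := choice dih_surj.
exists k => [x|]; last exact: kK.
have := kK (dih f h x).
move/(congr1 (@aut_arrow _ _ _)); rewrite !dih_six => /six_inj.
move: (k _) {kK} => [i j]; case: x => [i' j'] /=.
have := ltn_ord i; have := ltn_ord i' => li' li E.
have {}E : (3 * j + i = 3 * j' + i')%N by apply: E; lia.
have -> : i = i' by apply: val_inj => /=; case: j j' E => [] [] /=; lia.
by congr (_, _); case: j j' E => [] [] /=; lia.
Qed.

Lemma aut_S3_gen : generates [set f; h].
Proof.
move=> H HG HS y; have [x <-] := dih_surj y.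
by apply: group_closedM => //; apply: group_closedX => //; apply: HS; [right|left].
Qed.

End Symmetric.

Theorem isos_and_automorphisms :
  [/\ isos_from Q g
        = [set arrow_id Q g; psi; psiV; theta; Theta_after psi; Theta_after psiV]
      /\ isos_from Q g #= `I_6,
      g = 0 -> B = b0 ->
        group_isog (autD Q g) 'S_3 /\
        exists f h : autD Q g,
          [/\ aut_arrow f = psi, aut_arrow h = theta & generates [set f; h]],
      [/\ count_mem 0 [:: B - b0 - 'i * g; B - b0 + 'i * g; g] = 1%N ->
            [set: autD Q g] #= `I_2,
          B = b0 + 'i * g -> g != 0 ->
            exists2 f : autD Q g, aut_arrow f = Theta_after psi & generates [set f],
          B = b0 - 'i * g -> g != 0 ->
            exists2 f : autD Q g, aut_arrow f = Theta_after psiV & generates [set f]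
        & g = 0 -> B != b0 ->
            exists2 f : autD Q g, aut_arrow f = theta & generates [set f]]
    & g != 0 -> B != b0 + 'i * g -> B != b0 - 'i * g ->
        forall f : autD Q g, f = 1%g].
Proof.
have neqN : g != 0 -> 'i * g <> - ('i * g).
  move=> g0 /eqP; rewrite -addr_eq0 -mulr2n -mulr_natl !mulf_eq0 pnatr_eq0.
  by rewrite (negbTE (neq0Ci _)) (negbTE g0).
have uniq4 : g != 0 -> B = b0 + 'i * g -> forall j, (0 < j < 6)%N -> six_fixed j -> j = 4.
  move=> g0 EB [|[|[|[|[|[|//]]]]]] //= _.
  - by case=> E; rewrite E eqxx in g0.
  - by case=> E; rewrite E eqxx in g0.
  - by move=> E; rewrite E eqxx in g0.
  - by rewrite EB => /addrI /(neqN g0).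
have uniq5 : g != 0 -> B = b0 - 'i * g -> forall j, (0 < j < 6)%N -> six_fixed j -> j = 5.
  move=> g0 EB [|[|[|[|[|[|//]]]]]] //= _.
  - by case=> E; rewrite E eqxx in g0.
  - by case=> E; rewrite E eqxx in g0.
  - by move=> E; rewrite E eqxx in g0.
  - by rewrite EB => /addrI /esym /(neqN g0).
have uniq3 : g = 0 -> B != b0 -> forall j, (0 < j < 6)%N -> six_fixed j -> j = 3.
  move=> g0 /eqP nB [|[|[|[|[|[|//]]]]]] //= _.
  - by case.
  - by case.
  - by rewrite g0 mulr0 addr0.
  - by rewrite g0 mulr0 subr0.
have c4 : B = b0 + 'i * g -> g != 0 -> exists2 f : autD Q g,
    aut_arrow f = Theta_after psi & [set: autD Q g] #= `I_2 /\ generates [set f].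
  move=> EB g0; have [f Ef] := @six_aut 4 isT EB; exists f => //.
  by apply: (@aut_pair 4) => //; exact: uniq4.
have c5 : B = b0 - 'i * g -> g != 0 -> exists2 f : autD Q g,
    aut_arrow f = Theta_after psiV & [set: autD Q g] #= `I_2 /\ generates [set f].
  move=> EB g0; have [f Ef] := @six_aut 5 isT EB; exists f => //.
  by apply: (@aut_pair 5) => //; exact: uniq5.
have c3 : g = 0 -> B != b0 -> exists2 f : autD Q g,
    aut_arrow f = theta & [set: autD Q g] #= `I_2 /\ generates [set f].
  move=> g0 nB; have [f Ef] := @six_aut 3 isT g0; exists f => //.
  by apply: (@aut_pair 3) => //; exact: uniq3.
split.
- by split; [exact: isos_from_cubic|exact: card_isos_from].
- move=> g0 EB; have [f Ef] := @six_aut 1 isT (conj g0 EB); have [h Eh] := @six_aut 3 isT g0.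
  split; first exact: (aut_S3 g0 EB Ef Eh).
  by exists f, h; split=> //; exact: (aut_S3_gen g0 EB Ef Eh).
- split.
  (* For gamma = 0 the first two numbers coincide, so exactly one zero among the three means B !=
     b0. *)
  + have [g0|g0] := eqVneq g 0.
      rewrite g0 mulr0 subr0 addr0 /= eqxx subr_eq0; case: eqP => // nB _.
      by rewrite -g0; move/eqP: nB => /(c3 g0) [f _ []].
    have -> : B - b0 - 'i * g = B - (b0 + 'i * g) by rewrite -addrA -opprD.
    have -> : B - b0 + 'i * g = B - (b0 - 'i * g) by rewrite opprB addrA addrAC.
    rewrite /= (negbTE g0) !subr_eq0.
    by case: eqP => [/c4 /(_ g0) [f _ []]|_] //; case: eqP => // /c5 /(_ g0) [f _ []].
  + by move=> EB /(c4 EB) [f ? []]; exists f.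
  + by move=> EB /(c5 EB) [f ? []]; exists f.
  + by move=> g0 /(c3 g0) [f ? []]; exists f.
- move=> g0 /eqP n4 /eqP n5 f; have [i [i6 Fi Ef]] := aut_six f.
  case: i i6 Fi Ef => [|[|[|[|[|[|//]]]]]] /= _ Fi Ef.
  + by apply: aut_arrow_inj; rewrite Ef.
  + by case: Fi => E; rewrite E eqxx in g0.
  + by case: Fi => E; rewrite E eqxx in g0.
  + by rewrite Fi eqxx in g0.
  + by [].
  + by [].
Qed.

End Automorphisms.

Theorem theorem4p6 (R : realType) (A B C gamma : R[i]) :
  let Q := cubic A B C in
  let b0 := 4 * (A ^+ 2 / 16 - 1) in
  let id_ := arrow_id Q gamma in
  let psi := arrow_Psi A B C gamma in
  let psiV := arrow_PsiV A B C gamma in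
  let theta := arrow_Theta Q gamma in
  [/\ (* (a) *)
      isos_from Q gamma
        = [set id_; psi; psiV; theta; Theta_after psi; Theta_after psiV]
      /\ isos_from Q gamma #= `I_6,
      (* (b) *)
      gamma = 0 -> B = b0 ->
        group_isog (autD Q gamma) 'S_3 /\
        exists f h : autD Q gamma,
          [/\ aut_arrow f = psi, aut_arrow h = theta & generates [set f; h]],
      (* (c) *)
      [/\ count_mem 0 [:: B - b0 - 'i * gamma; B - b0 + 'i * gamma; gamma] = 1%N ->
            [set: autD Q gamma] #= `I_2,
          B = b0 + 'i * gamma -> gamma != 0 ->
            exists2 f : autD Q gamma,
              aut_arrow f = Theta_after psi & generates [set f],
          B = b0 - 'i * gamma -> gamma != 0 ->
            exists2 f : autD Q gamma,
              aut_arrow f = Theta_after psiV & generates [set f]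
        & gamma = 0 -> B != b0 ->
            exists2 f : autD Q gamma,
              aut_arrow f = theta & generates [set f]]
    & (* (d) *)
      gamma != 0 -> B != b0 + 'i * gamma -> B != b0 - 'i * gamma ->
        forall f : autD Q gamma, f = 1%g].
Proof. exact: isos_and_automorphisms. Qed.
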